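(* Let $m$ be a positive integer, and let $\mathcal{C}_m$ and $\mathcal{D}_m$ be the Shi arrangements of type C and type D. (1) Fix distinct $H,H'\in\mathcal{C}_m$ which are parallel to each other. Then the characteristic quasi-polynomial of $\mathcal{C}_m\setminus\{H,H'\}$ is a polynomial if and only if, up to interchanging $H$ and $H'$, one of the following is satisfied: - $m$ is odd, $H=\{2x_{(m+1)/2}=0\}$ and $H'=\{2x_{(m+1)/2}=1\}$; - $H=\{x_i-x_j=0\}$ and $H'=\{x_i-x_j=1\}$ for some $1\leq i<j\leq m$; - $H=\{x_i+x_{m+1-i}=0\}$ and $H'=\{x_i+x_{m+1-i}=1\}$ for some $1\leq i\leq m$. (2) Fix distinct $H,H'\in\mathcal{D}_m$ which are parallel to each other. Then the characteristic quasi-polynomial of $\mathcal{D}_m\setminus\{H,H'\}$ is a polynomial if and only if, up to interchanging $H$ and $H'$, one of the following is satisfied: - $H=\{x_i-x_{m+1-i}=0\}$ and $H'=\{x_i-x_{m+1-i}=1\}$ for some $1\leq i\leq m$; - $H=\{x_i+x_{m+1-i}=0\}$ and $H'=\{x_i+x_{m+1-i}=1\}$ for some $1\leq i\leq m$.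
   Context: For $q\in\mathbb{Z}_{>0}$ put $\mathbb{Z}_q=\mathbb{Z}/q\mathbb{Z}$. A hyperplane $H$ given by an integral equation $a_1x_1+\cdots+a_mx_m=b$ ($a_k,b\in\mathbb{Z}$) defines $H[q]=\{x\in\mathbb{Z}_q^m \mid a_1x_1+\cdots+a_mx_m= b \text{ in } \mathbb{Z}_q\}$, using the equation exactly as written (so $\{2x_i=0\}$ is not replaced by $\{x_i=0\}$). For a finite set $\mathcal{A}$ of such hyperplanes, $M(\mathcal{A}_q)=\mathbb{Z}_q^m\setminus\bigcup_{H\in\mathcal{A}}H[q]$. It is known (Kamiya–Takemura–Terao) that for all sufficiently large $q$ the number $|M(\mathcal{A}_q)|$ is given by a quasi-polynomial in $q$ (there are $\rho\ge1$ and polynomials $f_1,\dots,f_\rho$ with $|M(\mathcal{A}_q)|=f_r(q)$ whenever $q\equiv r \bmod \rho$), called the characteristic quasi-polynomial of $\mathcal{A}$. It is a polynomial if there is a single polynomial $f$ with $|M(\mathcal{A}_q)|=f(q)$ for all sufficiently large $q$. The arrangements are $\mathcal{C}_m=\{\{2x_i=0\},\{2x_i=1\}\mid 1\le i\le m\}\cup\{\{x_i\pm x_j=0\},\{x_i\pm x_j=1\}\mid 1\leq i<j\leq m\}$ and $\mathcal{D}_m=\{\{x_i\pm x_j=0\},\{x_i\pm x_j=1\}\mid 1\leq i<j\leq m\}$. Two equations defining the same hyperplane up to sign, such as $x_i-x_j=0$ and $x_j-x_i=0$, denote the same element. Parallel means parallel as affine hyperplanes in $\mathbb{R}^m$; thus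 the pairs of distinct parallel hyperplanes are $\{2x_i=0\},\{2x_i=1\}$ (type C only) and $\{x_i\pm x_j=0\},\{x_i\pm x_j=1\}$ (same sign in both). In the listed conditions $H$ and $H'$ are always the given elements of $\mathcal{C}_m$ (resp. $\mathcal{D}_m$); in type C the expression $x_i+x_{m+1-i}$ with $i=m+1-i$ is $2x_i$. *)

(* Defs.v *)
From HB Require Import structures.
From mathcomp Require Import all_boot all_order all_algebra.
From mathcomp Require Import finmap reals.

Set Implicit Arguments.
Unset Strict Implicit.
Unset Printing Implicit Defensive.

Import GRing.Theory.
Local Open Scope ring_scope.

(* The equation a_1 x_1 + ... + a_m x_m = b, kept exactly as written: the pair
   (a, b), with no normalisation of common factors. *)
Definition hyperplane (m : nat) := ('rV[int]_m * int)%type.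

(* The ring is a parameter, so that the same equation can be read in R^m and in
   ('Z_q)^m. *)
Definition on_hyperplane (m : nat) (S : nzRingType) (H : hyperplane m)
    (x : 'rV[S]_m) : bool :=
  \sum_(k < m) (H.1 0 k)%:~R * x 0 k == (H.2)%:~R.

(* - H is the equation with all coefficients and the constant negated. *)
Definition same_hyperplane (m : nat) (H K : hyperplane m) : bool :=
  (H == K) || (H == - K).

Definition same_pair (m : nat) (H H' K K' : hyperplane m) : bool :=
  (same_hyperplane H K && same_hyperplane H' K') ||
  (same_hyperplane H K' && same_hyperplane H' K).

(* Parallel affine hyperplanes of R^m: one is a translate of the other. *)
Definition parallel (R : realType) (m : nat) (H K : hyperplane m) : Prop :=
  exists v : 'rV[R]_m, forall x : 'rV[R]_m,
    on_hyperplane H x = on_hyperplane K (x + v).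

(* Faithful to Z/qZ only for 1 < q, since 'Z_0 and 'Z_1 are both Z/2Z. *)
Definition complement_mod (m : nat) (A : {fset hyperplane m}) (q : nat) :
    {set 'rV['Z_q]_m} :=
  [set x | [forall H : A, ~~ on_hyperplane (val H) x]].

(* Rational coefficients lose no generality: a polynomial with integer values
   at all large integers has rational coefficients. *)
Definition char_quasi_poly_is_poly (m : nat) (A : {fset hyperplane m}) : Prop :=
  exists (f : {poly rat}) (N : nat), forall q : nat,
    (1 < q)%N -> (N <= q)%N -> #|complement_mod A q|%:R = f.[q%:R].

Definition coord (m : nat) (i : 'I_m) : 'rV[int]_m := delta_mx 0 i.
Notation "''x_' i" := (coord i) (at level 8, i at level 2, format "''x_' i").

(* The condition i < j selects one of the two equations of each hyperplane, so
   distinct elements of these sets are distinct hyperplanes. *)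
Definition shi_D (m : nat) : {fset hyperplane m} :=
  \big[fsetU/fset0]_(p : 'I_m * 'I_m | (p.1 < p.2)%N)
    [fset ('x_(p.1) - 'x_(p.2), 0)%R; ('x_(p.1) - 'x_(p.2), 1)%R;
          ('x_(p.1) + 'x_(p.2), 0)%R; ('x_(p.1) + 'x_(p.2), 1)%R]%fset.

Definition shi_C (m : nat) : {fset hyperplane m} :=
  (\big[fsetU/fset0]_(i : 'I_m) [fset ('x_i *+ 2, 0)%R; ('x_i *+ 2, 1)%R]
   `|` shi_D m)%fset.

(* Main.v *)
Require Import Defs.
From mathcomp Require Import all_boot all_order all_algebra.
From mathcomp Require Import finmap reals.
From mathcomp Require Import zify ring lra.

(** Fold the circle Z/q at 0: a residue u has a position p between 0 and q/2 and
a side, plus if u = p and minus if u = -p.  A point x of (Z/q)^m becomes a word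
with one symbol for each position, where the symbol at p is the signed coordinate
that sits there, if any.  Give the signed coordinates +1, ..., +m the ranks
1, ..., m and -m, ..., -1 the ranks m+2, ..., 2m+1.  Then x lies on none of the
hyperplanes x_i +- x_j = 0, 1 exactly when the positions of its coordinates are
distinct and the ranks increase from a position to the next one whenever both are
occupied ([pair_fold], [avoid_pairP]).  The hyperplanes 2x_i = 0, 1, and in type D
the sign ambiguity at the fixed points of u -> -u, merely restrict the ranks that
may stand at the two ends of the word ([ends_fit]).  Apart from the length of the
word, the parity of q enters only through the right end.

Such words are counted by inserting the letters one after the other into a word
of gaps.  A run of increasing ranks accepts a new letter in exactly one place, so
the number of places for a letter does not depend on the letters already
inserted ([slots_insertions]), and the number of words is a product
([size_fillings]).

Deleting the two parallel hyperplanes z0 - y0 = 0, 1, where z0 and y0 are signed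
coordinates, adds the points at which z0 and y0 coincide or follow one another in
the wrong order.  Their words carry a block: one symbol that stands for both
letters and behaves like the interval of ranks [rank z0, rank y0], or the two
letters y0 z0.  A block changes the number of places for each other letter by a
constant, wherever it stands ([slots_placed]); so the count is again a product,
multiplied by the number of positions of the block, minus the words with the block
at an end of the word that the remaining hyperplanes exclude ([size_allowed]).
When z0 and y0 are opposite, the deleted hyperplanes are 2x_i = 0, 1, and the words
to add are those with the coordinate i at an end.

With P = q - 2m in type C and P = q - 2m + 2 in type D, the result is a polynomial
in P for each parity of q ([card_deletion]).  It depends on the number a of
coordinates before i and the number c of coordinates after j.  The two polynomials
are the same if a = c, that is j = m + 1 - i, and also for x_i - x_j in type C, where
both parities offer the block the same number of places
([deletion_poly_balanced]).  In all other cases their values at P = 1 differ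
([deletion_poly_unbalanced]). *)

Set Implicit Arguments.
Unset Strict Implicit.
Unset Printing Implicit Defensive.

Import GRing.Theory.

(** * Words and the insertion of letters *)

(** The pair (lo, hi) is all that the neighbours of an occupied position see: the
symbol before it must have its hi below lo, and the symbol after it its lo above hi.
A lone letter of rank y is (y, y).  A gap is (top, 0) with top above all ranks, so
that it fits next to every letter.  A position that carries two letters, or the first
letter of a block, has lo different from hi. *)
Definition symbol := (nat * nat)%type.
Definition fits (u v : symbol) := u.2 < v.1.
Definition solo (y : nat) : symbol := (y, y).

Definition slot y (u v : symbol) := fits u (solo y) && fits (solo y) v.

Fixpoint slots y s (w : seq symbol) t : nat :=
  if w is z :: w' then slot y s z + slots y z w' t else slot y s t.

Fixpoint insertions y s (w : seq symbol) t : seq (seq symbol) :=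
  if w is z :: w' then
    (if slot y s z then [:: solo y :: z :: w'] else [::])
      ++ [seq z :: v | v <- insertions y z w' t]
  else if slot y s t then [:: [:: solo y]] else [::].

Definition insert_letter (ab : nat * nat) s w t :=
  insertions ab.1 s w t ++ insertions ab.2 s w t.

Fixpoint fillings s t (ws : seq (seq symbol)) (L : seq (nat * nat)) :=
  if L is ab :: L' then flatten [seq insert_letter ab s w t | w <- fillings s t ws L'] else ws.

(** A letter is given by the pair of ranks of its two signs; a word contains one
of them. *)
Definition carries (ab : nat * nat) (u : symbol) := (u == solo ab.1) || (u == solo ab.2).
Definition letter (L : seq (nat * nat)) u := has (carries^~ u) L.
Definition ranks (L : seq (nat * nat)) := flatten [seq [:: ab.1; ab.2] | ab <- L].
Definition skeleton L (w : seq symbol) := [seq u <- w | ~~ letter L u].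

Lemma letterE L u : letter L u = (u.1 == u.2) && (u.1 \in ranks L).
Proof.
elim: L => [|[a b] L IH] /=; first by rewrite andbF.
rewrite IH /carries /ranks /= !inE -/(ranks L); case: u {IH} => p q.
rewrite /solo /= !xpair_eqE; have [->|nq] := eqVneq p q.
  by rewrite /= !andbb orbA.
rewrite /=; apply/negP=> /orP[]; last by [].
by move=> /orP[] /andP[/eqP e1 /eqP e2]; rewrite e1 e2 eqxx in nq.
Qed.

Lemma size_insertions y s w t : size (insertions y s w t) = slots y s w t.
Proof.
elim: w s => [|z w IH] s /=; first by case: ifP.
by rewrite size_cat size_map IH; case: ifP.
Qed.

Lemma insertionsP y s w t v :
  reflect (exists w1 w2, [/\ w = w1 ++ w2, v = w1 ++ solo y :: w2
            & slot y (last s w1) (head t w2)])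
          (v \in insertions y s w t).
Proof.
apply: (iffP idP).
  elim: w s v => [|z w IH] s v /=.
    by case: ifP => // sl; rewrite inE => /eqP->; exists [::], [::].
  rewrite mem_cat => /orP[].
    by case: ifP => // sl; rewrite inE => /eqP->; exists [::], (z :: w).
  case/mapP => v' /IH[w1 [w2 [-> -> sl]]] ->.
  by exists (z :: w1), w2.
case=> w1 [w2 [-> -> {v}]]; elim: w1 s => [|z w1 IH] s /=.
  case: w2 => [|z w2] /= sl; rewrite sl ?mem_cat ?inE //=.
  by rewrite eqxx.
by move/IH=> h; rewrite mem_cat map_f ?orbT.
Qed.

Lemma slots_cat y s w1 z w2 t :
  slots y s (w1 ++ z :: w2) t = slots y s w1 z + slots y z w2 t.
Proof. by elim: w1 s => [|u w1 IH] s //=; rewrite IH addnA. Qed.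

(** The place that y takes splits a slot in two.  If a rank y' other than y is
accepted by that slot, it is accepted by exactly one of the two halves: the left one
if y' < y, the right one if y < y'. *)
Lemma slots_insertions y y' s w t v : v \in insertions y s w t -> y' != y ->
  slots y' s v t = slots y' s w t.
Proof.
case/insertionsP=> w1 [w2 [-> -> sl]] ny; elim: w1 s sl => [|u w1 IH] s sl /=.
  by case: w2 sl => [|z w2] /=; rewrite /slot /fits /=; lia.
by rewrite (IH u).
Qed.

Lemma path_insertions y s w t v : v \in insertions y s w t ->
  path fits s (rcons w t) -> path fits s (rcons v t).
Proof.
case/insertionsP=> w1 [w2 [-> -> /andP[sl1 sl2]]].
rewrite !rcons_cat !cat_path => /andP[-> /=]; rewrite sl1 /=.
by case: w2 sl2 => [|z w2] /= -> //= /andP[].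
Qed.

(** A lone letter has lo = hi, so [fits] is transitive through it. *)
Lemma path_del y s w1 w2 t : path fits s (rcons (w1 ++ solo y :: w2) t) ->
  slot y (last s w1) (head t w2) && path fits s (rcons (w1 ++ w2) t).
Proof.
rewrite !rcons_cat !cat_path /= => /and3P[-> sl1].
rewrite /slot sl1; case: w2 => [|z w2] /=; rewrite ?andbT => h.
  by rewrite h; move: sl1 h; rewrite /fits /=; lia.
move: h => /andP[h ->]; rewrite h.
by move: sl1 h; rewrite /fits /=; lia.
Qed.

Lemma path_skeleton L s w t : path fits s (rcons w t) ->
  path fits s (rcons (skeleton L w) t).
Proof.
rewrite /skeleton; elim: w s => [|z w IH] s //= /andP[sz /IH pz].
case: (boolP (letter L z)) => [|_] /=; last by rewrite sz.
rewrite letterE => /andP[/eqP ez _].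
have : z.2 >= s.2.+1 by rewrite -ez.
move: pz; case: [seq _ <- _ | _] => [|x l] /=; rewrite ?andbT /fits.
  by lia.
by move=> /andP[h ->] ?; rewrite andbT; lia.
Qed.

Section Fill.
Variables (s t : symbol) (ws : seq (seq symbol)).

Lemma mem_fillings_cons ab L v : reflect
  (exists w y, [/\ w \in fillings s t ws L, y \in [:: ab.1; ab.2] & v \in insertions y s w t])
  (v \in fillings s t ws (ab :: L)).
Proof.
apply: (iffP flatten_mapP) => [[w wf]|[w [y [wf]]]].
  rewrite mem_cat => /orP[] h; exists w;
   [exists ab.1|exists ab.2]; by rewrite !inE eqxx ?orbT.
by rewrite !inE => /orP[]/eqP-> h; exists w => //; rewrite mem_cat h ?orbT.
Qed.

(** Letters can be taken out of a valid word one by one without making it invalid,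
so iterated insertion reaches every valid word over the given skeletons. *)
Lemma mem_fillings L w : uniq (ranks L) ->
    {in ws, forall v, path fits s (rcons v t) && ~~ has (letter L) v} ->
  (w \in fillings s t ws L) =
    [&& path fits s (rcons w t), skeleton L w \in ws
      & all (fun ab => count (carries ab) w == 1) L].
Proof.
elim: L w => [|[a b] L IH] w /=.
  move=> _ hws; rewrite andbT /skeleton filter_predT.
  apply/idP/andP => [h|[] //]; split => //.
  by have /andP[] := hws _ h.
rewrite -/(ranks L) !inE => /and3P[/norP[nab anL] bnL uL] hws.
have hws' : {in ws, forall v, path fits s (rcons v t) && ~~ has (letter L) v}.
  move=> v /hws /andP[-> /hasPn h]; apply/hasPn => u /h.
  by rewrite /letter /= => /norP[].
have nyL y : y \in [:: a; b] -> ~~ letter L (solo y).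
  by rewrite letterE /= eqxx /= !inE => /orP[]/eqP->.
have nyn y ab' : y \in [:: a; b] -> ab' \in L -> ~~ carries ab' (solo y).
  by move=> hy h; apply: contra (nyL y hy) => n; apply/hasP; exists ab'.
have skE w1 w2 y : y \in [:: a; b] ->
    skeleton ((a, b) :: L) (w1 ++ solo y :: w2) = skeleton ((a, b) :: L) (w1 ++ w2).
  move=> hy; rewrite /skeleton !filter_cat /= /letter /= /carries /= /solo !xpair_eqE !andbb.
  by move: hy; rewrite !inE => ->.
have skE' w' : ~~ has (carries (a, b)) w' ->
    skeleton ((a, b) :: L) w' = skeleton L w'.
  move/hasPn => h; apply: eq_in_filter => u /h.
  by rewrite /letter /= => /negPf->.
have allE w1 w2 y : y \in [:: a; b] ->
    all (fun ab => count (carries ab) (w1 ++ solo y :: w2) == 1) L =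
    all (fun ab => count (carries ab) (w1 ++ w2) == 1) L.
  move=> hy; apply: eq_in_all => ab' h; rewrite !count_cat /=.
  by rewrite (negPf (nyn _ _ hy h)) add0n.
have nnamed w' : w' \in fillings s t ws L -> ~~ has (carries (a, b)) w'.
  rewrite IH // => /and3P[_ hsk _].
  apply/hasPn => u uw; apply/negP => nu.
  have /hws /andP[_ /hasPn] := hsk => /(_ u).
  have nu2 : exists2 y, y \in [:: a; b] & u = solo y.
    by move/orP: nu => [] /eqP->; [exists a|exists b]; rewrite ?inE ?eqxx ?orbT.
  rewrite mem_filter uw andbT; case: nu2 => y hy eu; rewrite {1}eu nyL // => /(_ isT).
  by rewrite /letter /= nu.
apply/mem_fillings_cons/and3P => [[w' [y [w'f hy]]]|[pw skw /andP[cw aw]]].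
  move=> wi; have nw' := nnamed _ w'f.
  move: w'f; rewrite IH // => /and3P[pw' sw' aw'].
  split; first exact: path_insertions wi pw'.
    by case/insertionsP: wi => w1 [w2 [e -> _]]; rewrite skE // -e skE'.
  case/insertionsP: wi => w1 [w2 [e -> _]]; rewrite allE // -e aw' andbT.
  move: nw'; rewrite has_count -leqNgt leqn0 e !count_cat /= /carries /= /solo.
  rewrite !xpair_eqE !andbb; move: hy; rewrite !inE => ->; lia.
have hasw : has (carries (a, b)) w by rewrite has_count (eqP cw).
case/split_find: hasw pw skw cw aw => u w1 w2 nu _ pw skw cw aw.
have [y hy eu] : exists2 y, y \in [:: a; b] & u = solo y.
  by move/orP: nu => [] /eqP->; [exists a|exists b]; rewrite ?inE ?eqxx ?orbT.
move: pw skw cw aw; rewrite cat_rcons eu => /path_del/andP[sl pw].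
rewrite skE // allE // => skw cw aw.
exists (w1 ++ w2), y; split=> //; last by apply/insertionsP; exists w1, w2.
rewrite IH // pw aw -skE' ?skw //.
move: cw; rewrite has_count !count_cat /= -eu nu; lia.
Qed.
Lemma uniq_insertions y s' w : solo y \notin w -> uniq (insertions y s' w t).
Proof.
elim: w s' => [|z w IH] s' /=; first by case: ifP.
rewrite inE negb_or => /andP[nz nw].
rewrite cat_uniq map_inj_uniq ?IH //; last by move=> ? ? [].
rewrite andbT; case: ifP => _ /=; apply/hasPn => u /mapP[v _ ->] //; rewrite mem_seq1.
apply/negP => /eqP[e _].
by rewrite e eqxx in nz.
Qed.

Lemma insertions_del y s' w v : v \in insertions y s' w t -> solo y \notin w ->
  rem (solo y) v = w.
Proof.
case/insertionsP=> w1 [w2 [-> -> _]]; elim: w1 => [|u w1 IH] /=; first by rewrite eqxx.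
by rewrite inE negb_or eq_sym => /andP[/negPf-> /IH->].
Qed.

Lemma uniq_fillings L : uniq (ranks L) -> uniq ws ->
    {in ws, forall v, path fits s (rcons v t) && ~~ has (letter L) v} ->
  uniq (fillings s t ws L).
Proof.
elim: L => [|[a b] L IH] //= uL uws hws.
have mfill w : w \in fillings s t ws L -> (solo a \notin w) && (solo b \notin w).
  move: uL; rewrite !inE -/(ranks L) => /and3P[/norP[nab anL] bnL uL].
  rewrite mem_fillings //; last first.
    move=> v /hws /andP[-> /hasPn h]; apply/hasPn => u /h.
    by rewrite /letter /= => /norP[].
  case/and3P => _ /hws /andP[_ /hasPn h] _.
  have nin y : y \in [:: a; b] -> y \notin ranks L -> solo y \notin w.
    move=> hy yL; apply/negP => yw; have := h (solo y).
    rewrite mem_filter yw letterE /= eqxx (negPf yL) => /(_ isT).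
    rewrite /letter /= /carries /solo /= !xpair_eqE !andbb.
    by move: hy; rewrite !inE => ->.
  by rewrite !nin ?inE ?eqxx ?orbT.
have {IH} uf : uniq (fillings s t ws L).
  apply: IH => //; first by move: uL; rewrite !inE => /and3P[].
  move=> v /hws /andP[-> /hasPn h]; apply/hasPn => u /h.
  by rewrite /letter /= => /norP[].
have nab : a != b by move: uL; rewrite !inE => /and3P[/norP[]].
have amem (w : seq symbol) w1 w2 y : w = w1 ++ w2 -> (solo y \in w1 ++ solo y :: w2).
  by rewrite mem_cat inE eqxx orbT.
have disj w v : (solo a \notin w) && (solo b \notin w) -> v \in insert_letter (a, b) s w t ->
    w = rem (solo b) (rem (solo a) v).
  case/andP=> na nb; rewrite mem_cat /= => /orP[] vi.
    by rewrite (insertions_del vi) // rem_id.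
  have : solo a \notin v.
    case/insertionsP: vi => w1 [w2 [e -> _]]; move: na; rewrite e !mem_cat inE.
    by rewrite /solo xpair_eqE (negPf nab).
  by move/rem_id->; rewrite (insertions_del vi).
elim: (fillings s t ws L) mfill uf => [|w l IHl] //= mfill /andP[wl ul].
have hw := mfill w (mem_head _ _); have /andP[na nb] := hw.
rewrite cat_uniq IHl //; last by move=> v vl; apply: mfill; rewrite inE vl orbT.
rewrite andbT; apply/andP; split.
  rewrite cat_uniq !uniq_insertions // andbT /=; apply/hasPn => v /= vi.
  apply/negP => vi'; have : solo a \in v.
    by case/insertionsP: vi' => w1 [w2 [_ -> _]]; rewrite mem_cat inE eqxx orbT.
  case/insertionsP: vi => w1 [w2 [e -> _]]; move: na; rewrite e !mem_cat inE.
  by rewrite /solo xpair_eqE (negPf nab) /= => /negPf->.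
apply/hasPn => v /flatten_mapP[w' w'l vi'].
apply/negP => vi; move: wl; rewrite (disj w v) // -(disj w' v) ?w'l //.
by apply: mfill; rewrite inE w'l orbT.
Qed.

Lemma slots_fillings L w : w \in fillings s t ws L ->
  exists2 v, v \in ws & forall y, y \notin ranks L -> slots y s w t = slots y s v t.
Proof.
elim: L w => [|ab L IH] w /=; first by exists w.
case/mem_fillings_cons => w' [y [/IH[v vw hv] hy wi]]; exists v => // y'.
rewrite /ranks /= -/(ranks L) !inE => /norP[na /norP[nb nL]].
rewrite (slots_insertions wi) ?hv //; move: hy; rewrite !inE => /orP[]/eqP-> //.
Qed.

(** An insertion multiplies the number of words by the number of slots, and this
number is that of the skeleton because of [slots_insertions]. *)
Lemma size_fillings L (F : nat * nat -> nat) : uniq (ranks L) ->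
  {in ws & L, forall v ab, slots ab.1 s v t + slots ab.2 s v t = F ab} ->
  size (fillings s t ws L) = size ws * \prod_(ab <- L) F ab.
Proof.
elim: L => [|[a b] L IH] /=; first by rewrite big_nil muln1.
rewrite !inE -/(ranks L) => /and3P[/norP[nab anL] bnL uL] hF.
rewrite big_cons mulnCA -IH //; last first.
  by move=> v ab vw abL; apply: hF => //; rewrite inE abL orbT.
rewrite size_flatten /shape -map_comp sumnE big_map.
rewrite (eq_big_seq (fun=> F (a, b))) => [|w wf].
  by rewrite big_const_seq count_predT iter_addn_0 mulnC.
rewrite /= size_cat !size_insertions; have [v vw hv] := slots_fillings wf.
by rewrite !hv // (hF v (a, b)) // mem_head.
Qed.
End Fill.

(** * Words with a block *)
Section Blocks.
Variables (top : nat) (L : seq (nat * nat)).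
Hypotheses (uL : uniq (ranks L))
  (rL : {in ranks L, forall y, 0 < y < top}).
Let gap : symbol := (top, 0).

(** Between E gaps there are E - 1 slots that accept both signs of a letter; the
slot before the first gap accepts the ranks above [s.2], the slot after the last one
those below [t.1]. *)
Definition room (s t : symbol) E (ab : nat * nat) :=
  (s.2 < ab.1) + (s.2 < ab.2) + 2 * E.-1 + ((ab.1 < t.1) + (ab.2 < t.1)).

Lemma mem_ranks ab : ab \in L -> (ab.1 \in ranks L) && (ab.2 \in ranks L).
Proof.
by move=> abL; apply/andP; split; apply/flatten_mapP; exists ab => //;
  rewrite !inE eqxx ?orbT.
Qed.

Lemma slots_gap y E t : 0 < y < top ->
  slots y gap (nseq E gap) t = E + (y < t.1).
Proof.
move=> hy; elim: E => [|E IH] /=; rewrite /slot /fits /=; first by lia.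
by rewrite IH; lia.
Qed.

Lemma slots_gaps y s E t : 0 < y < top ->
  slots y s (nseq E.+1 gap) t = (s.2 < y) + E + (y < t.1).
Proof.
by move=> hy; rewrite /= slots_gap // /slot /fits /=; lia.
Qed.

Lemma path_gaps E t : 0 < top -> 0 < t.1 -> path fits gap (rcons (nseq E gap) t).
Proof.
by move=> h ht; elim: E => [|E IH] /=; rewrite /fits /= ?andbT // h.
Qed.

Lemma path_gapsS s E t : s.2 < top -> 0 < t.1 -> path fits s (rcons (nseq E.+1 gap) t).
Proof. by move=> hs ht; rewrite /= path_gaps ?andbT //; lia. Qed.

Lemma letter_gap : letter L gap = false.
Proof.
rewrite letterE /=; apply/negP => /andP[_ /rL]; lia.
Qed.

Lemma letter_gaps E : has (letter L) (nseq E gap) = false.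
Proof. by rewrite has_nseq letter_gap andbF. Qed.

Lemma gaps_valid s E t : s.2 < top -> 0 < t.1 ->
  {in [:: nseq E.+1 gap], forall v,
    path fits s (rcons v t) && ~~ has (letter L) v}.
Proof.
by move=> hs ht v; rewrite inE => /eqP->; rewrite path_gapsS // letter_gaps.
Qed.

Lemma size_fillings_gaps s E t :
  size (fillings s t [:: nseq E.+1 gap] L) = \prod_(ab <- L) room s t E.+1 ab.
Proof.
rewrite (size_fillings (F := room s t E.+1)) ?mul1n // => v ab.
rewrite inE => /eqP-> /mem_ranks /andP[/rL r1 /rL r2].
by rewrite !slots_gaps // /room /=; lia.
Qed.

(* A block is the sequence [hd b :: tl b]; its two mirror images are
   indexed by b.  Only its first and its last symbol touch other letters. *)
Variables (s t : symbol) (E : nat).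
Hypotheses (hs : s.2 < top) (ht : 0 < t.1).
Variables (hd : bool -> symbol) (tl : bool -> seq symbol).
Let la b := last (hd b) (tl b).
Let B b := hd b :: tl b.
Hypotheses (hd1 : forall b, 0 < (hd b).1) (la2 : forall b, (la b).2 < top).
Hypothesis hd_neq : hd true != hd false.
Hypothesis hd_gap : forall b, hd b != gap.
Hypothesis la_gap : forall b, la b != gap.
Hypothesis la_neq : la true != la false.
Hypothesis B_path : forall b, path fits (hd b) (tl b).
Hypothesis B_letter : forall b, ~~ has (letter L) (B b).
Hypothesis B_slots : forall b y v, y \in ranks L ->
  slots y (hd b) (tl b) v = slot y (la b) v.

Definition placed b p := nseq p gap ++ B b ++ nseq (E.+1 - p) gap.
Definition placements :=
  [seq v <- [seq placed b p | b <- [:: true; false], p <- iota 0 E.+2]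
     | path fits s (rcons v t)].

Lemma placementsP v :
  reflect (exists b p, [/\ v = placed b p, p <= E.+1 & path fits s (rcons v t)])
    (v \in placements).
Proof.
rewrite mem_filter; apply: (iffP andP) => [[pv /allpairsP[[b p] [_]]]|].
  by rewrite mem_iota => h e; exists b, p; split.
case=> b [p [-> hp ->]]; split=> //; apply/allpairsP; exists (b, p).
split; [by case: (b) | by rewrite mem_iota /= ltnS | by []].
Qed.

Lemma path_placed b p : p <= E.+1 ->
  path fits s (rcons (placed b p) t) =
    ((p == 0) ==> fits s (hd b)) && ((p == E.+1) ==> fits (la b) t).
Proof.
move=> hp; rewrite /placed !rcons_cat !cat_path /= B_path /= -/(la b).
rewrite andbT andbA.
have -> : path fits s (nseq p gap) && fits (last s (nseq p gap)) (hd b) =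
    ((p == 0) ==> fits s (hd b)).
  case: p {hp} => [|p] //=.
  have /path_gaps : 0 < top by lia.
  move=> /(_ p (hd b) (hd1 b)); rewrite rcons_path => h.
  rewrite [fits s gap]/fits hs /=; exact: h.
have -> : path fits (la b) (rcons (nseq (E.+1 - p) gap) t) =
    ((p == E.+1) ==> fits (la b) t).
  have [->|np] := eqVneq p E.+1; first by rewrite subnn /= andbT.
  have -> : E.+1 - p = (E - p).+1 by lia.
  by rewrite path_gapsS.
by [].
Qed.

Lemma placed_inj b p b' p' : p <= E.+1 -> p' <= E.+1 ->
  placed b p = placed b' p' -> (b, p) = (b', p').
Proof.
have nthp b1 p1 : nth gap (placed b1 p1) p1 = hd b1.
  by rewrite nth_cat size_nseq ltnn subnn.
have nthp' b1 p1 k : k < p1 -> nth gap (placed b1 p1) k = gap.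
  by move=> h; rewrite nth_cat size_nseq h nth_nseq h.
move=> hp hp' e; have ep : p = p'.
  case: (ltngtP p p') => // h.
    by move: (nthp b p); rewrite e nthp' // => /esym/eqP; rewrite (negPf (hd_gap b)).
  by move: (nthp b' p'); rewrite -e nthp' // => /esym/eqP; rewrite (negPf (hd_gap _)).
subst p'; have := nthp b p; rewrite e nthp => eh.
by move: hd_neq; case: b b' eh {e} => [] [] //= ->; rewrite eqxx.
Qed.

Lemma uniq_placements : uniq placements.
Proof.
apply: filter_uniq; apply: allpairs_uniq => //; first exact: iota_uniq.
move=> [b p] [b' p'] /allpairsP[[? ?] [_ h [-> ->]]].
move=> /allpairsP[[? ?] [_ h' [-> ->]]]; move: h h'; rewrite !mem_iota => h h'.
by apply: placed_inj.
Qed.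

Lemma size_placements :
  size placements = \sum_(b : bool) (fits s (hd b) + E + fits (la b) t).
Proof.
have cnt b : count (fun p => path fits s (rcons (placed b p) t)) (iota 0 E.+2) =
    fits s (hd b) + E + fits (la b) t.
  rewrite (eq_in_count (a2 := fun p => ((p == 0) ==> fits s (hd b)) &&
    ((p == E.+1) ==> fits (la b) t))); last first.
    by move=> p; rewrite mem_iota => hp; apply: path_placed.
  rewrite (_ : E.+2 = 1 + (E + 1)); last by lia.
  rewrite iotaD iotaD !count_cat addnA /= !addn0 eqxx.
  rewrite (eq_in_count (a2 := predT)) ?count_predT ?size_iota => [|p].
    by rewrite andbT.
  rewrite mem_iota => hp.
  have [-> ->] : (p == 0) = false /\ (p == E.+1) = false by lia.
  by [].
rewrite big_bool -!cnt size_filter; move: (iota 0 E.+2) => I.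
by rewrite /= cats0 count_cat !count_map.
Qed.

Lemma placements_valid : {in placements, forall v,
  path fits s (rcons v t) && ~~ has (letter L) v}.
Proof.
move=> v /placementsP[b [p [-> hp ->]]]; rewrite !has_cat !letter_gaps /=.
by rewrite orbF; apply: B_letter.
Qed.

Variable F : nat * nat -> nat.
Hypothesis F_def : forall b, {in L, forall ab,
  F ab + (((hd b).1 <= ab.1 <= (la b).2) + ((hd b).1 <= ab.2 <= (la b).2)) =
  room s t E.+1 ab +
    (((la b).2 < ab.1 < (hd b).1) + ((la b).2 < ab.2 < (hd b).1))}.

(** Put between two gaps, a block (lo, ..., hi) offers a slot before it to the ranks
below lo and a slot after it to the ranks above hi, in place of one slot for all ranks:
it takes away the ranks of [lo, hi], or counts twice those strictly between hi and lo.
At an end of the word the condition that the block fits there gives the same balance. *)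
Lemma slots_placed b p y : y \in ranks L -> p <= E.+1 ->
    path fits s (rcons (placed b p) t) ->
  slots y s (placed b p) t + ((hd b).1 <= y <= (la b).2) =
    (s.2 < y) + E + (y < t.1) + ((la b).2 < y < (hd b).1).
Proof.
move=> yL hp; have hy := rL yL; rewrite path_placed // => /andP[h1 h2].
(* The block replaces one slot between u and v by two. *)
have slot_split u v : u.2 < (hd b).1 -> (la b).2 < v.1 -> u.2 < v.1 ->
    slot y u (hd b) + slot y (la b) v + ((hd b).1 <= y <= (la b).2) =
    slot y u v + ((la b).2 < y < (hd b).1).
  by rewrite /slot /fits /=; lia.
have slotO u : slot y u gap = (u.2 < y) :> nat by rewrite /slot /fits /=; lia.
have Oslot v : slot y gap v = (y < v.1) :> nat by rewrite /slot /fits /=; lia.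
rewrite /placed -[B b ++ _]/(hd b :: (tl b ++ nseq (E.+1 - p) gap)) slots_cat.
have [ep|np] := eqVneq p E.+1.
  move: h2; rewrite ep eqxx subnn cats0 B_slots // slots_gaps // => /= h2.
  have := slot_split gap t (hd1 b) h2 ht; rewrite !Oslot; lia.
have -> : E.+1 - p = (E - p).+1 by lia.
rewrite [nseq (E - p).+1 _]/= slots_cat B_slots // slots_gap //.
case: p {h2} np hp h1 => [|p] np hp h1.
  have /= := slot_split s gap h1 (la2 b) hs; rewrite !slotO; lia.
have top0 : 0 < top by lia.
have := slot_split gap gap (hd1 b) (la2 b) top0.
by rewrite slots_gaps // !slotO !Oslot /=; lia.
Qed.

Lemma size_fillings_placements : size (fillings s t placements L) =
  (\sum_(b : bool) (fits s (hd b) + E + fits (la b) t)) * \prod_(ab <- L) F ab.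
Proof.
rewrite -size_placements; apply: size_fillings => // v ab.
move=> /placementsP[b [p [-> hp pv]]] abL.
have /andP[r1 r2] := mem_ranks abL.
have := slots_placed r1 hp pv; have := slots_placed r2 hp pv.
have := F_def b abL; rewrite /room /=; lia.
Qed.

Definition starts b (w : seq symbol) := take (size (B b)) w == B b.
Definition ends b (w : seq symbol) := drop (size w - size (B b)) w == B b.

Lemma skeleton_B b : skeleton L (B b) = B b.
Proof.
apply/all_filterP/allP => u uB; apply/negP => lu.
by move/hasPn: (B_letter b) => /(_ u uB); rewrite lu.
Qed.

Lemma startsP b w : reflect (exists w', w = B b ++ w') (starts b w).
Proof.
apply: (iffP eqP) => [e|[w' ->]]; last by rewrite take_size_cat.
by exists (drop (size (B b)) w); rewrite -[LHS](cat_take_drop (size (B b))) e.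
Qed.

Lemma endsP b w : reflect (exists w', w = w' ++ B b) (ends b w).
Proof.
apply: (iffP eqP) => [e|[w' ->]]; last by rewrite size_cat addnK drop_size_cat.
by exists (take (size w - size (B b)) w);
  rewrite -[LHS](cat_take_drop (size w - size (B b))) e.
Qed.

Lemma count_carries_B b w ab : ab \in L ->
  count (carries ab) (B b ++ w) = count (carries ab) w.
Proof.
move=> abL; rewrite count_cat (_ : count _ (B b) = 0) //.
apply/eqP; rewrite -leqn0 leqNgt -has_count; apply/hasPn => u uB.
by apply/negP => nu; move/hasPn: (B_letter b) => /(_ u uB) /hasPn /(_ _ abL); rewrite nu.
Qed.

Lemma all_carries_B b w : all (fun ab => count (carries ab) (B b ++ w) == 1) L =
  all (fun ab => count (carries ab) w == 1) L.
Proof. by apply: eq_in_all => ab abL; rewrite count_carries_B. Qed.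

Lemma skeleton_starts b w : w \in fillings s t placements L -> starts b w ->
  skeleton L w = placed b 0.
Proof.
rewrite (mem_fillings _ uL placements_valid) => /and3P[_ /placementsP[b' [p [e hp _]]] _].
move=> /startsP[w' ew].
have e' : skeleton L w = B b ++ skeleton L w'.
  by rewrite ew {1}/skeleton filter_cat -!/(skeleton L _) skeleton_B.
rewrite e; move: e; rewrite e'.
case: p hp => [|p] hp [eh _]; last by have := hd_gap b; rewrite eh eqxx.
have -> // : b = b'.
by move: hd_neq; case: b b' eh {ew e'} => [] [] //= ->; rewrite eqxx.
Qed.

Lemma skeleton_ends b w : w \in fillings s t placements L -> ends b w ->
  skeleton L w = placed b E.+1.
Proof.
rewrite (mem_fillings _ uL placements_valid) => /and3P[_ /placementsP[b' [p [e hp _]]] _].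
move=> /endsP[w' ew].
have el : la b = last gap (placed b' p).
  by rewrite -e ew {1}/skeleton filter_cat -!/(skeleton L _) skeleton_B last_cat.
rewrite e {e}.
have ep : p = E.+1.
  apply/eqP; rewrite eqn_leq hp leqNgt; apply/negP => lp; move: el.
  rewrite /placed (_ : E.+1 - p = (E - p) + 1); last by lia.
  by rewrite nseqD !last_cat /= => el; have := la_gap b; rewrite el eqxx.
move: el; rewrite ep {1}/placed subnn cats0 last_cat /= -/(la b') => el.
have -> // : b = b'.
by move: la_neq; case: b b' {ew} el => [] [] //= ->; rewrite eqxx.
Qed.

(** After a block at the start there follows an arbitrary valid word whose left end
is the last symbol of the block. *)
Lemma count_starts b : count (starts b) (fillings s t placements L) =
  if fits s (hd b) then \prod_(ab <- L) room (la b) t E.+1 ab else 0.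
Proof.
case: ifP => h; last first.
  apply/eqP; rewrite -leqn0 leqNgt -has_count; apply/hasPn => w wf.
  apply/negP => /startsP[w' ew]; move: wf; rewrite (mem_fillings _ uL placements_valid) ew.
  by rewrite rcons_cat /= h.
rewrite -size_fillings_gaps -(size_map (cat (B b))) -size_filter.
apply: perm_size; apply: uniq_perm.
- by apply/filter_uniq/uniq_fillings => //; [exact: uniq_placements | exact: placements_valid].
- rewrite map_inj_in_uniq; last by move=> u v _ _ /eqP; rewrite eqseq_cat // eqxx => /eqP.
  by apply: uniq_fillings => //; apply: gaps_valid.
move=> w; rewrite mem_filter; apply/andP/mapP.
  case=> sw wf; have := skeleton_starts wf sw; have /startsP[w' ew] := sw.
  rewrite ew {1}/skeleton filter_cat -!/(skeleton L _) skeleton_B /placed cat0s subn0.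
  move/eqP; rewrite eqseq_cat // eqxx => /= /eqP sk.
  exists w' => //; rewrite mem_fillings //; last exact: gaps_valid.
  move: wf; rewrite (mem_fillings _ uL placements_valid) ew all_carries_B => /and3P[pw _ ->].
  move: pw; rewrite rcons_cat cat_path => /andP[_ ->].
  by rewrite sk !inE eqxx.
case=> w'; rewrite mem_fillings //; last exact: gaps_valid.
rewrite inE => /and3P[pw' /eqP sk aw'] ->; split; first by apply/startsP; exists w'.
rewrite (mem_fillings _ uL placements_valid) all_carries_B aw' andbT.
have pB : path fits s (rcons (B b ++ w') t).
  by rewrite rcons_cat cat_path /= h B_path.
rewrite pB; apply/placementsP; exists b, 0.
have e : skeleton L (B b ++ w') = placed b 0.
  by rewrite /skeleton filter_cat -!/(skeleton L _) skeleton_B sk /placed subn0.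
by rewrite e; split=> //; rewrite -e; apply: path_skeleton.
Qed.

Lemma cat_injr (v : seq symbol) : injective (cat^~ v).
Proof.
move=> u1 u2 e; apply: (can_inj revK); move/(congr1 rev): e; rewrite !rev_cat.
by move/eqP; rewrite eqseq_cat // eqxx => /eqP.
Qed.

Lemma count_ends b : count (ends b) (fillings s t placements L) =
  if fits (la b) t then \prod_(ab <- L) room s (hd b) E.+1 ab else 0.
Proof.
have allC w' : all (fun ab => count (carries ab) (w' ++ B b) == 1) L =
  all (fun ab => count (carries ab) w' == 1) L.
  by rewrite -(all_carries_B b w'); apply: eq_all => ab; rewrite !count_cat addnC.
case: ifP => h; last first.
  apply/eqP; rewrite -leqn0 leqNgt -has_count; apply/hasPn => w wf.
  apply/negP => /endsP[w' ew]; move: wf; rewrite (mem_fillings _ uL placements_valid) ew.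
  by rewrite rcons_path last_cat /= -/(la b) h andbF.
rewrite -size_fillings_gaps -(size_map (cat^~ (B b))) -size_filter.
apply: perm_size; apply: uniq_perm.
- by apply/filter_uniq/uniq_fillings => //; [exact: uniq_placements | exact: placements_valid].
- rewrite map_inj_in_uniq.
    by apply: uniq_fillings => //; apply: gaps_valid.
  by move=> u v _ _; apply: cat_injr.
move=> w; rewrite mem_filter; apply/andP/mapP.
  case=> sw wf; have := skeleton_ends wf sw; have /endsP[w' ew] := sw.
  rewrite ew {1}/skeleton filter_cat -!/(skeleton L _) skeleton_B /placed subnn cats0.
  move=> sk.
  exists w' => //; rewrite mem_fillings //; last exact: gaps_valid.
  move: wf; rewrite (mem_fillings _ uL placements_valid) ew allC => /and3P[pw _ ->].
  move: pw; rewrite rcons_cat /= -cat_rcons cat_path => /andP[-> _].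
  by rewrite andbT (cat_injr sk) mem_head.
case=> w'; rewrite mem_fillings //; last exact: gaps_valid.
rewrite inE => /and3P[pw' /eqP sk aw'] ->; split; first by apply/endsP; exists w'.
rewrite (mem_fillings _ uL placements_valid) allC aw' andbT.
have pB : path fits s (rcons (w' ++ B b) t).
  by rewrite rcons_cat /= -cat_rcons cat_path pw' last_rcons rcons_path B_path h.
rewrite pB; apply/placementsP; exists b, E.+1.
have e : skeleton L (w' ++ B b) = placed b E.+1.
  by rewrite /skeleton filter_cat -!/(skeleton L _) skeleton_B sk /placed subnn cats0.
by rewrite e; split=> //; rewrite -e; apply: path_skeleton.
Qed.

Variables (xs xt : bool -> bool).
(** The words with a block at an end where the orientation b is forbidden, at the
start by [xs] and at the end by [xt]. *)
Definition barred w := [|| xs true && starts true w, xs false && starts false w,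
  xt true && ends true w | xt false && ends false w].
Definition allowed := [seq w <- fillings s t placements L | ~~ barred w].

(** The excluded events are disjoint because the skeleton of a word determines
the place and the orientation of its block. *)
Lemma size_allowed : size allowed +
   \sum_(b : bool) (
     (if xs b && fits s (hd b) then \prod_(ab <- L) room (la b) t E.+1 ab else 0) +
     (if xt b && fits (la b) t then \prod_(ab <- L) room s (hd b) E.+1 ab else 0)) =
  (\sum_(b : bool) (fits s (hd b) + E + fits (la b) t)) * \prod_(ab <- L) F ab.
Proof.
rewrite -size_fillings_placements; set X := fillings s t placements L.
rewrite size_filter -(count_predC (fun w => ~~ barred w) X); congr (_ + _).
have cS b : (if xs b && fits s (hd b) then \prod_(ab <- L) room (la b) t E.+1 ab else 0)
   = count (fun w => xs b && starts b w) X.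
  by case: (xs b) => /=; rewrite ?count_pred0 // count_starts.
have cE b : (if xt b && fits (la b) t then \prod_(ab <- L) room s (hd b) E.+1 ab else 0)
   = count (fun w => xt b && ends b w) X.
  by case: (xt b) => /=; rewrite ?count_pred0 // count_ends.
rewrite big_bool !cS !cE {cS cE}.
have disj b p b' p' w : p <= E.+1 -> p' <= E.+1 -> skeleton L w = placed b p ->
    skeleton L w = placed b' p' -> (b, p) = (b', p').
  by move=> hp hp' -> /placed_inj; apply.
have key : {in X, forall w, barred w =
    (xs true && starts true w) + (xt true && ends true w) +
    ((xs false && starts false w) + (xt false && ends false w)) :> nat}.
  move=> w wX; rewrite /barred.
  have := @skeleton_starts true w wX; have := @skeleton_starts false w wX.
  have := @skeleton_ends true w wX; have := @skeleton_ends false w wX.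
  have l0 : 0 <= E.+1 by []. have lE := leqnn E.+1.
  case: (ends false w) => [/(_ isT) h1|_]; case: (ends true w) => [/(_ isT) h2|_];
  case: (starts false w) => [/(_ isT) h3|_]; case: (starts true w) => [/(_ isT) h4|_];
  rewrite ?andbF ?andbT ?orbF ?addn0 ?add0n //.
  all: try by case: (disj _ _ _ _ _ lE lE h1 h2).
  all: try by case: (disj _ _ _ _ _ lE l0 h1 h3).
  all: try by case: (disj _ _ _ _ _ lE l0 h1 h4).
  all: try by case: (disj _ _ _ _ _ lE l0 h2 h3).
  all: try by case: (disj _ _ _ _ _ lE l0 h2 h4).
  all: try by case: (disj _ _ _ _ _ l0 l0 h3 h4).
elim: X key => //= w X IH key; rewrite negbK key ?mem_head // -IH; last first.
  by move=> v vX; apply: key; rewrite inE vX orbT.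
lia.
Qed.
End Blocks.

(** * Folding the circle *)

Local Open Scope ring_scope.

Lemma ord_eqD1 n (u v : 'I_n.+2) : (u == v + 1) =
  ((u == v.+1 :> nat) || (u == 0%N :> nat) && (v == n.+1 :> nat)).
Proof.
rewrite -(inj_eq val_inj) /= (modn_small (m := 1)) // addn1.
move: (ltn_ord u) (ltn_ord v); move: (nat_of_ord u) (nat_of_ord v) => a b ha hb.
have [->|ne] := eqVneq b n.+1; first by rewrite modnn; lia.
rewrite modn_small; lia.
Qed.

Lemma ord_eqN n (u v : 'I_n.+2) : (u == - v) = ((u + v == 0)%N || (u + v == n.+2)%N).
Proof.
rewrite -(inj_eq val_inj) /=.
move: (ltn_ord u) (ltn_ord v); move: (nat_of_ord u) (nat_of_ord v) => a b ha hb.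
have [->|ne] := eqVneq b 0%N; first by rewrite subn0 modnn; lia.
rewrite modn_small; lia.
Qed.

Section Fold.
Variable q : nat.
Hypothesis q_gt1 : (1 < q)%N.
Implicit Types u v : 'Z_q.

Lemma Zq_lt u : (u < q)%N.
Proof. by rewrite -[X in (_ < X)%N](Zp_cast q_gt1) ltn_ord. Qed.

Lemma Zq_eqD1 u v : (u == v + 1) =
  ((u == v.+1 :> nat) || (u == 0%N :> nat) && (v == q.-1 :> nat)).
Proof. case: q q_gt1 u v => [|[|n]] // _ u v; exact: ord_eqD1. Qed.

Lemma Zq_eqN u v : (u == - v) = ((u + v == 0)%N || (u + v == q)%N).
Proof. case: q q_gt1 u v => [|[|n]] // _ u v; exact: ord_eqN. Qed.

Lemma Zq_eq1N u v : (u == - v + 1) = ((u + v == 1)%N || (u + v == q.+1)%N).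
Proof.
rewrite -subr_eq Zq_eqN.
have := Zq_eqD1 u (u - 1); rewrite subrK eqxx.
have := Zq_lt u; have := Zq_lt v; have := Zq_lt (u - 1).
move: (nat_of_ord u) (nat_of_ord v) (nat_of_ord (u - 1)) => a b c; lia.
Qed.

(** The circle folded at 0.  At the fixed points of u -> -u the side is a
convention: minus at 0, and plus at q/2 if q is even.  With this choice a letter at a
fixed point acts on its neighbour like any other letter of that sign. *)
Definition side u := (0 < u <= q./2)%N.
Definition pos u : nat := if side u then nat_of_ord u else if u == 0 then 0%N else (q - u)%N.

Definition signed_pos (b : bool) (p : nat) : 'Z_q := if b then p%:R else - p%:R.
(** The pairs (sign, position) that occur. *)
Definition canonical (b : bool) (p : nat) :=
  [&& (p <= q./2)%N, b ==> (0 < p)%N & (~~ b && (p == q./2)) ==> odd q].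

Lemma Zq_eq0 u : (u == 0) = (u == 0%N :> nat).
Proof. by rewrite -val_eqE. Qed.

Lemma canonical_fold u : canonical (side u) (pos u).
Proof.
rewrite /canonical /pos /side Zq_eq0; have := Zq_lt u.
case: (posnP (u : nat)) => [->|u0] /=; first by case: (q) q_gt1 => [|[|[|n]]] //=; lia.
have [h|h] := leqP u q./2; lia.
Qed.

Lemma foldK u : signed_pos (side u) (pos u) = u.
Proof.
rewrite /signed_pos /pos; case: (side u); first by rewrite natr_Zp.
case: eqP => [->|_]; first by rewrite oppr0.
apply/eqP; rewrite eqr_oppLR natrB ?(ltnW (Zq_lt u)) // natr_Zp.
by rewrite pchar_Zp // sub0r.
Qed.

Lemma val_natr p : (p < q)%N -> (p%:R : 'Z_q) = p :> nat.
Proof. by move=> h; rewrite val_Zp_nat // modn_small. Qed.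

Lemma signed_posK b p : canonical b p ->
  side (signed_pos b p) = b /\ pos (signed_pos b p) = p.
Proof.
case/and3P => h1 h2 h3; have hp : (p < q)%N by lia.
rewrite /pos /side Zq_eq0 /signed_pos; case: b h2 h3 => h2 h3.
  by move: h2; rewrite val_natr //= => h2; rewrite h2 h1.
have := Zq_eqN (- p%:R) p%:R; rewrite eqxx val_natr // => /esym.
have := Zq_lt (- p%:R); move: (nat_of_ord (- p%:R)) => c hc1 hc2.
have -> : (0 < c <= q./2)%N = false by lia.
by split=> //; case: eqP; lia.
Qed.

Variant fold_spec u : bool -> nat -> Type :=
  | FoldPos of (0 < u <= q./2)%N : fold_spec u true u
  | FoldZero of u = 0%N :> nat : fold_spec u false 0
  | FoldNeg of (q./2 < u < q)%N : fold_spec u false (q - u).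

Lemma foldP u : fold_spec u (side u) (pos u).
Proof.
rewrite /pos /side Zq_eq0; have [e|u0] := posnP (u : nat).
  by apply: FoldZero.
have [h|h] /= := leqP u q./2; first by apply: FoldPos; rewrite u0.
by apply: FoldNeg; rewrite h Zq_lt.
Qed.

(** The four equations say that u and v have the same position, or neighbouring
positions in the wrong order.  For two coordinates u before v in the index order, the
order of the ranks depends on the sign of u alone: plus comes before both signs of v,
minus after both. *)
Lemma pair_fold u v :
  [&& u != v, u != v + 1, u != - v & u != - v + 1] =
  [&& pos u != pos v, (pos v == (pos u).+1) ==> side u & (pos u == (pos v).+1) ==> ~~ side u].
Proof.
rewrite Zq_eqD1 Zq_eqN Zq_eq1N -(inj_eq val_inj) /=.
by case: (foldP u); case: (foldP v); lia.
Qed.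

(** 2u = 0 holds at the fixed points, and 2u = 1 only at (q + 1)/2, which for odd q
is the last position with sign minus. *)
Lemma self_fold u :
  (u != - u) && (u != - u + 1) =
  [&& pos u != 0%N, (pos u == q./2) ==> odd q & (pos u == q./2) ==> side u].
Proof. by rewrite Zq_eqN Zq_eq1N; case: (foldP u); lia. Qed.
End Fold.

(** * Points and words *)
Lemma path_mkseq (T : Type) (e : rel T) (s t : T) (f : nat -> T) n :
  reflect [/\ e s (f 0%N), forall p, (p < n)%N -> e (f p) (f p.+1) & e (f n) t]
    (path e s (rcons (mkseq f n.+1) t)).
Proof.
have pE k : path e s (mkseq f k.+1) <->
    e s (f 0%N) /\ forall p, (p < k)%N -> e (f p) (f p.+1).
  elim: k => [|k IH]; first by rewrite /= andbT; split=> [|[]].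
  rewrite mkseqS rcons_path {2}mkseqS last_rcons; split.
    case/andP => /IH[e0 ep] ek; split=> // p; rewrite ltnS leq_eqVlt.
    by case/orP => [/eqP->|/ep].
  case=> e0 ep; rewrite ep // andbT; apply/IH; split=> // p hp.
  by apply: ep; apply: ltnW.
rewrite rcons_path {2}mkseqS last_rcons.
by apply: (iffP andP) => [[/pE[]]|[? ? ?]] //; split=> //; apply/pE.
Qed.

Lemma count_two (T : Type) (x0 : T) (P : pred T) s i j :
  (i < j < size s)%N -> P (nth x0 s i) -> P (nth x0 s j) -> (1 < count P s)%N.
Proof.
case/andP => ij js Pi Pj; rewrite -(cat_take_drop j s) count_cat.
have : (0 < count P (take j s))%N.
  rewrite -has_count; apply/(has_nthP x0); exists i; last by rewrite nth_take.
  by rewrite size_take js.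
have : (0 < count P (drop j s))%N; last by lia.
rewrite -has_count; apply/(has_nthP x0); exists 0%N; last by rewrite nth_drop addn0.
by rewrite size_drop subn_gt0.
Qed.

Section Code.
Variables (q m : nat).
Hypothesis q_gt1 : (1 < q)%N.
Let h := q./2.
Let gap : symbol := ((2 * m).+2, 0)%N.
(* The coordinates of D are drawn; [sy k b] is the symbol of coordinate k
   with sign b.  A coordinate outside D shares its position with one of D. *)
Variables (D : pred 'I_m) (sy : 'I_m -> bool -> symbol).
Hypothesis sy_inj : forall k k' b b', D k -> D k' -> sy k b = sy k' b' -> k = k' /\ b = b'.
Hypothesis sy_gap : forall k b, D k -> sy k b != gap.
Implicit Type x : 'rV['Z_q]_m.

Definition content x (p : nat) : symbol :=
  if [pick k | D k && (pos (x 0 k) == p)] is Some k then sy k (side (x 0 k)) else gap.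
Definition word x := mkseq (content x) h.+1.
Definition spread x := forall k l, D k -> D l -> pos (x 0 k) = pos (x 0 l) -> k = l.

Lemma size_word x : size (word x) = h.+1.
Proof. exact: size_mkseq. Qed.

Lemma pos_le (u : 'Z_q) : (pos u <= h)%N.
Proof. by have /and3P[] := canonical_fold q_gt1 u. Qed.

Lemma nth_word x p : (p <= h)%N -> nth gap (word x) p = content x p.
Proof. by move=> hp; rewrite nth_mkseq. Qed.

Lemma content_at x k : spread x -> D k -> content x (pos (x 0 k)) = sy k (side (x 0 k)).
Proof.
move=> inj Dk; rewrite /content; case: pickP => [l /andP[Dl /eqP e]|/(_ k)].
  by rewrite (inj l k Dl Dk e).
by rewrite Dk eqxx.
Qed.

Lemma contentP x p u : content x p = u ->
  u = gap \/ exists2 k, D k & pos (x 0 k) = p /\ u = sy k (side (x 0 k)).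
Proof.
rewrite /content; case: pickP => [l /andP[Dl /eqP e] <-|_ <-]; last by left.
by right; exists l.
Qed.

Lemma content_sy x p k b : spread x -> D k ->
  (content x p == sy k b) = (pos (x 0 k) == p) && (side (x 0 k) == b).
Proof.
move=> inj Dk; apply/eqP/andP => [/contentP[e|[l Dl [<- /sy_inj []]]]|].
- by have := sy_gap b Dk; rewrite e eqxx.
- by [].
- by [].
- by move=> -> ->; rewrite !eqxx.
by case=> /eqP<- /eqP<-; apply: content_at.
Qed.

Lemma count_sy x k : spread x -> D k ->
  count (fun u => (u == sy k true) || (u == sy k false)) (word x) = 1%N.
Proof.
move=> inj Dk; rewrite count_map -[RHS](_ : count (pred1 (pos (x 0 k))) (iota 0 h.+1) = 1%N).
  apply: eq_count => p /=; rewrite !content_sy // -andb_orr eq_sym.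
  by case: (side _); rewrite andbT.
by rewrite count_uniq_mem ?iota_uniq // mem_iota /= ltnS pos_le.
Qed.

(** The last clause is the sign convention at the two fixed points; without it two
words could describe the same point. *)
Definition decodable (w : seq symbol) := [/\ size w = h.+1,
  {in w, forall u, u = gap \/ exists k b, D k /\ u = sy k b},
  forall k, D k -> count (fun u => (u == sy k true) || (u == sy k false)) w = 1%N &
  forall k, D k -> nth gap w 0 != sy k true /\ (~~ odd q -> nth gap w h != sy k false)].

Definition decode w k : 'Z_q :=
  signed_pos q (sy k true \in w) (index (sy k (sy k true \in w)) w).

Lemma decodableP w k : decodable w -> D k ->
  exists b p, [/\ canonical q b p, decode w k = signed_pos q b p &
    forall p' b', (p' <= h)%N -> (nth gap w p' == sy k b') = (p' == p) && (b' == b)].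
Proof.
case=> sw mw cw cank Dk.
set b := sy k true \in w; set p := index (sy k b) w; exists b, p.
have bw : sy k b \in w.
  have : has (fun u => (u == sy k true) || (u == sy k false)) w by rewrite has_count cw.
  case/hasP => u uw /orP[]/eqP e; rewrite {}e in uw; rewrite /b ?uw //.
  by have [kt|_] := boolP (sy k true \in w).
have hp : (p <= h)%N by rewrite -ltnS -sw index_mem.
have np : nth gap w p = sy k b by rewrite nth_index.
have un p' b' : (p' <= h)%N -> (nth gap w p' == sy k b') = (p' == p) && (b' == b).
  move=> hp'; apply/idP/andP => [/eqP e|[/eqP-> /eqP->]]; last by rewrite np.
  suff ep : p' = p.
    by rewrite ep eqxx; move: e; rewrite ep np => /sy_inj[] // _ ->.
  apply/eqP/negP => /negP ne; have := cw k Dk.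
  set P := fun _ => _ || _ => c1.
  have P1 : P (nth gap w p) by rewrite np /P; case: (b); rewrite eqxx ?orbT.
  have P2 : P (nth gap w p') by rewrite e /P; case: (b'); rewrite eqxx ?orbT.
  case: (ltngtP p' p) ne => // lt _.
    by have := count_two _ P2 P1; rewrite c1 lt sw ltnS hp => /(_ isT).
  by have := count_two _ P1 P2; rewrite c1 lt sw ltnS hp' => /(_ isT).
split=> //; rewrite /canonical hp /=.
have [c1 c2] := cank k Dk; apply/andP; split.
  apply/implyP => eb; rewrite lt0n; apply/eqP => e0.
  by move: c1; rewrite -e0 np eb eqxx.
apply/implyP => /andP[eb /eqP ep]; apply: contraT => /c2.
by rewrite /h -ep np (negPf eb) eqxx.
Qed.

Lemma word_decode w x : decodable w -> (forall k, D k -> x 0 k = decode w k) ->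
  spread x /\ word x = w.
Proof.
move=> dw xE; have [sw mw cw cank] := dw.
have sx : spread x.
  move=> k l Dk Dl; rewrite !xE //.
  have [b [p [cp -> np]]] := decodableP dw Dk.
  have [b' [p' [cp' -> np']]] := decodableP dw Dl.
  have [_ ->] := signed_posK q_gt1 cp; have [_ ->] := signed_posK q_gt1 cp' => e.
  have hp : (p <= h)%N by case/and3P: cp.
  have /eqP e1 := np p b hp; have := np' p b'; rewrite -e hp !eqxx.
  move=> /(_ isT) /eqP e2; move: (np p b hp); rewrite !eqxx => /eqP e3.
  by have [] := sy_inj Dk Dl (etrans (esym e3) e2).
split=> //; apply: (@eq_from_nth _ gap); first by rewrite size_word sw.
move=> p; rewrite size_word ltnS => hp; rewrite nth_word //.
have /mw[e|[k [b [Dk e]]]] : nth gap w p \in w by rewrite mem_nth ?sw.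
  rewrite e; case: (contentP (erefl (content x p))) => // -[k Dk [ek ->]].
  move: ek; rewrite xE //; have [b' [p' [cp -> np]]] := decodableP dw Dk.
  have [_ -> ep] := signed_posK q_gt1 cp; have := np p b' hp.
  by rewrite ep !eqxx e => /eqP oe; have := sy_gap b' Dk; rewrite -oe eqxx.
apply/eqP; rewrite e content_sy // xE //.
have [b' [p' [cp -> np]]] := decodableP dw Dk.
have [-> ->] := signed_posK q_gt1 cp; have := np p b hp.
by rewrite e eqxx => /esym/andP[/eqP-> /eqP->]; rewrite !eqxx.
Qed.

(** The coordinates outside D are determined by those of D on the set S, so the word
determines the point. *)
Lemma card_words (S : {set 'rV['Z_q]_m}) (W : seq (seq symbol)) : uniq W ->
    {in S, forall x, spread x /\ word x \in W} ->
    {in S &, forall x x', (forall k, D k -> x 0 k = x' 0 k) -> x = x'} ->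
    {in W, forall w, decodable w /\
      exists2 x, x \in S & forall k, D k -> x 0 k = decode w k} ->
  #|S| = size W.
Proof.
move=> uW hS injS hW; rewrite cardE -(size_map word).
apply: perm_size; apply: uniq_perm => //.
  rewrite map_inj_in_uniq ?enum_uniq // => x x'; rewrite !mem_enum => xS x'S e.
  apply: injS => // k Dk; have [sx _] := hS x xS; have [sx' _] := hS x' x'S.
  have := content_at sx Dk; rewrite -nth_word ?pos_le // e nth_word ?pos_le //.
  move/eqP; rewrite content_sy // => /andP[/eqP ep /eqP eb].
  by rewrite -(foldK q_gt1 (x 0 k)) -ep -eb foldK.
move=> w; apply/mapP/idP => [[x]|wW].
  by rewrite mem_enum => /hS[_ h1] ->.
have [dw [x xS xE]] := hW w wW; exists x; first by rewrite mem_enum.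
by have [_ ->] := word_decode dw xE.
Qed.

Variables (s t : symbol).
Hypotheses (sO : fits s gap) (Ot : fits gap t).
Hypothesis sy_bounds : forall k b, D k -> fits (sy k b) gap && fits gap (sy k b).

Lemma path_word x : spread x -> reflect
  [/\ forall k, D k -> pos (x 0 k) = 0%N -> fits s (sy k (side (x 0 k))),
      forall k l, D k -> D l -> pos (x 0 l) = (pos (x 0 k)).+1 ->
        fits (sy k (side (x 0 k))) (sy l (side (x 0 l))) &
      forall k, D k -> pos (x 0 k) = h -> fits (sy k (side (x 0 k))) t]
  (path fits s (rcons (word x) t)).
Proof.
move=> sx; have OO : fits gap gap by [].
apply: (iffP (path_mkseq _ _ _ _ _)) => [[h0 hp hh]|[h0 hp hh]]; split.
- by move=> k Dk e; rewrite -content_at // e.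
- move=> k l Dk Dl e; rewrite -!content_at // e; apply: hp.
  by rewrite -ltnS -e ltnS pos_le.
- by move=> k Dk e; rewrite -content_at // e.
- case: (contentP (erefl (content x 0))) => [-> //|[k Dk [e ->]]]; exact: h0.
- move=> p ph.
  case: (contentP (erefl (content x p))) => [->|[k Dk [e ->]]];
  case: (contentP (erefl (content x p.+1))) => [->|[l Dl [e' ->]]] //.
  + by have /andP[] := sy_bounds (side (x 0 l)) Dl.
  + by have /andP[] := sy_bounds (side (x 0 k)) Dk.
  by apply: hp => //; rewrite e e'.
case: (contentP (erefl (content x h))) => [-> //|[k Dk [e ->]]]; exact: hh.
Qed.
End Code.

Lemma size_skeleton L (w : seq symbol) : uniq (ranks L) ->
  all (fun ab => count (carries ab) w == 1%N) L ->
  size w = (size L + size (skeleton L w))%N.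
Proof.
move=> uL aL; rewrite size_filter -(count_predC (letter L) w); congr (_ + _)%N.
elim: L uL aL => [|[a b] L IH] /=; first by rewrite -[RHS](count_pred0 w).
rewrite !inE -/(ranks L) => /and3P[/norP[nab anL] bnL uL] /andP[/eqP c1 /(IH uL) <-].
rewrite -add1n -c1 -(count_predUI (carries (a, b))).
rewrite -[LHS]addn0; congr (_ + _)%N; apply/esym/eqP; rewrite -leqn0 leqNgt -has_count.
apply/hasPn => u _ /=; apply/negP => /andP[/orP[]/eqP->]; rewrite letterE eqxx /=;
  [exact/negP | exact/negP].
Qed.

(** * Ranks of signed coordinates *)
Section Ranks.
Variable m : nat.

(** For i < j, z the coordinate i and y the coordinate j with either sign, the equation
z - y = 1 says that the letter y is immediately followed by z, or -z by -y.  In this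
order the second of these two letters always has the smaller rank.  Changing all signs
reflects the ranks in m + 1, which is the rank of no letter. *)
Definition rank (k : 'I_m) (b : bool) : nat := if b then k.+1 else ((2 * m).+1 - k)%N.

Lemma rank_inj k l b b' : rank k b = rank l b' -> k = l /\ b = b'.
Proof.
move=> e; have hk := ltn_ord k; have hl := ltn_ord l.
have eb : b = b' by move: e; rewrite /rank; case: b b' => [] []; lia.
split=> //; apply/val_inj => /=; move: e; rewrite eb /rank; case: (b'); lia.
Qed.

Lemma rank_bound k b : (0 < rank k b < (2 * m).+2)%N.
Proof. by have hk := ltn_ord k; rewrite /rank; case: b; lia. Qed.

Lemma rank_lt (k l : 'I_m) b b' : (k < l)%N -> (rank k b < rank l b')%N = b.
Proof. by move=> kl; have := ltn_ord l; rewrite /rank; case: b b' => [] []; lia. Qed.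

Lemma rank_gt (k l : 'I_m) b b' : (k < l)%N -> (rank l b' < rank k b)%N = ~~ b.
Proof. by move=> kl; have := ltn_ord l; rewrite /rank; case: b b' => [] []; lia. Qed.

Lemma rank_opp (k l : 'I_m) b b' :
  (rank k (~~ b) < rank l (~~ b'))%N = (rank l b' < rank k b)%N.
Proof.
have : (rank l b' <= (2 * m).+2)%N by have := rank_bound l b'; lia.
have E (i : 'I_m) e : rank i (~~ e) = ((2 * m).+2 - rank i e)%N.
  by have := ltn_ord i; rewrite /rank; case: e => /=; lia.
by rewrite !E; have := rank_bound k b; lia.
Qed.

Definition letters (P : pred 'I_m) := [seq (rank k true, rank k false) | k <- enum P].

Variable P : pred 'I_m.
Let L := letters P.

Lemma ranksP y : reflect (exists k b, P k /\ y = rank k b) (y \in ranks L).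
Proof.
apply: (iffP flatten_mapP) => [[_ /mapP[k Pk ->]]|[k [b [Pk ->]]]].
  rewrite mem_enum in Pk; rewrite !inE => /orP[]/eqP->;
    by [exists k, true | exists k, false].
exists (rank k true, rank k false); last by case: b; rewrite !inE eqxx ?orbT.
by apply: map_f; rewrite mem_enum.
Qed.

Lemma uniq_ranks : uniq (ranks L).
Proof.
have -> : ranks L = [seq rank k b | k <- enum P, b <- [:: true; false]].
  by rewrite /ranks /L /letters -map_comp.
apply: allpairs_uniq; rewrite ?enum_uniq //.
by move=> [k b] [l b'] _ _ /= /rank_inj[-> ->].
Qed.

Lemma ranks_bound : {in ranks L, forall y, 0 < y < (2 * m).+2}%N.
Proof. by move=> y /ranksP[k [b [_ ->]]]; apply: rank_bound. Qed.

Lemma letterP u : reflect (exists k b, P k /\ u = solo (rank k b)) (letter L u).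
Proof.
rewrite letterE; apply: (iffP andP) => [[/eqP e /ranksP[k [b [Pk e']]]]|].
  by exists k, b; split=> //; case: u e e' => ? ? /= -> ->.
by case=> k [b [Pk ->]] /=; split=> //; apply/ranksP; exists k, b.
Qed.

Lemma size_letters : size L = #|P|.
Proof. by rewrite size_map cardE. Qed.

Lemma prod_letters (F : nat * nat -> nat) :
  (\prod_(ab <- L) F ab = \prod_(k | P k) F (rank k true, rank k false))%N.
Proof. by rewrite big_map big_enum. Qed.

End Ranks.

Section Decodable.
Variables (q m : nat).
Hypothesis q_gt1 : (1 < q)%N.
Let h := q./2.
Let gap : symbol := ((2 * m).+2, 0)%N.
Variables (P D : pred 'I_m) (sy : 'I_m -> bool -> symbol).
Hypothesis PD : subpred P D.
Hypothesis sy_P : forall k b, P k -> sy k b = solo (rank k b).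
Hypothesis sy_inj : forall k k' b b', D k -> D k' -> sy k b = sy k' b' -> k = k' /\ b = b'.
Hypothesis sy_gap : forall k b, D k -> sy k b != gap.
Let L := letters P.

Lemma carries_sy k : P k ->
  carries (rank k true, rank k false) =1 (fun u => (u == sy k true) || (u == sy k false)).
Proof. by move=> Pk u; rewrite !sy_P. Qed.

Lemma not_letter_sy k b : D k -> ~~ P k -> ~~ letter L (sy k b).
Proof.
move=> Dk nPk; apply/negP => /letterP[l [b' [Pl e]]].
have [kl _] : k = l /\ b = b' by apply: sy_inj => //; [exact: PD | rewrite e sy_P].
by rewrite kl Pl in nPk.
Qed.

(** The letters of P are inserted into skeletons that contain the other drawn
coordinates, so the counts and symbols need a check on the skeleton only. *)
Lemma fillings_decodable (w : seq symbol) :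
    size w = h.+1 ->
    all (fun ab => count (carries ab) w == 1%N) L ->
    {in skeleton L w, forall u, u = gap \/ exists k b, D k /\ u = sy k b} ->
    (forall k, D k -> ~~ P k ->
      count (fun u => (u == sy k true) || (u == sy k false)) (skeleton L w) = 1%N) ->
    (forall k, D k -> nth gap w 0 != sy k true /\ (~~ odd q -> nth gap w h != sy k false)) ->
  decodable q D sy w.
Proof.
move=> sw aw mw cw cank; split=> // [u uw|k Dk].
  have [/letterP[k [b [Pk ->]]]|nu] := boolP (letter L u); last first.
    by apply: mw; rewrite mem_filter nu.
  by right; exists k, b; rewrite sy_P //; split=> //; apply: PD.
have [Pk|nPk] := boolP (P k).
  rewrite -(eq_count (carries_sy Pk)); apply/eqP; move/allP: aw; apply.
  by apply: map_f; rewrite mem_enum.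
rewrite -(cw k Dk nPk) count_filter; apply: eq_count => u /=.
apply/idP/andP => [e|[] //]; split=> //.
by case/orP: e => /eqP->; apply: not_letter_sy.
Qed.

Lemma all_count_word (x : 'rV['Z_q]_m) : spread D x ->
  all (fun ab => count (carries ab) (word D sy x) == 1%N) L.
Proof.
move=> sx; apply/allP => _ /mapP[k Pk ->]; rewrite mem_enum in Pk; apply/eqP.
by rewrite (eq_count (carries_sy Pk)) count_sy //; apply: PD.
Qed.

Lemma size_gaps (w : seq symbol) : all (fun ab => count (carries ab) w == 1%N) L ->
  size w = (#|P| + size (skeleton L w))%N.
Proof. by move/size_skeleton => -> //; rewrite ?size_letters // uniq_ranks. Qed.

End Decodable.

(** * Points off all hyperplanes *)
Section Arrangement.
Variables (typeC : bool) (q m : nat).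
Hypothesis q_gt1 : (1 < q)%N.
Let h := q./2.
Let gap : symbol := ((2 * m).+2, 0)%N.
Implicit Types (x : 'rV['Z_q]_m) (u v : 'Z_q) (k l i j : 'I_m) (b : bool).

Definition signed b v := if b then v else - v.
Definition avoid u v b := (u != signed b v) && (u != signed b v + 1).

(** In type C the hyperplane 2x_i = 0 leaves only a gap at the fixed points, and
2x_i = 1 forbids the sign minus at the last position when q is odd.  In type D
the bound m + 1, which separates plus from minus, expresses the sign convention at a
fixed point. *)
Definition left_end : symbol := (0, if typeC then (2 * m).+1 else m.+1)%N.
Definition right_end : symbol :=
  (if typeC then (if odd q then m.+1 else 1)
   else (if odd q then (2 * m).+2 else m.+1), 0)%N.

Definition avoid_pair x k l := if (k < l)%N
  then avoid (x 0 k) (x 0 l) true && avoid (x 0 k) (x 0 l) false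
  else avoid (x 0 l) (x 0 k) true && avoid (x 0 l) (x 0 k) false.

Definition own_rank x k : nat := rank k (side (x 0 k)).

Lemma avoid_both u v : avoid u v true && avoid u v false =
  [&& pos u != pos v, (pos v == (pos u).+1) ==> side u & (pos u == (pos v).+1) ==> ~~ side u].
Proof. by rewrite -pair_fold // /avoid /= -andbA. Qed.

Lemma avoid_pairP x k l : k != l -> avoid_pair x k l =
  [&& pos (x 0 k) != pos (x 0 l),
    (pos (x 0 l) == (pos (x 0 k)).+1) ==> (own_rank x k < own_rank x l)%N &
    (pos (x 0 k) == (pos (x 0 l)).+1) ==> (own_rank x l < own_rank x k)%N].
Proof.
rewrite /avoid_pair -val_eqE => /= kl; case: ltnP => lt; rewrite avoid_both /own_rank.
  by rewrite (rank_lt _ _ lt) (rank_gt _ _ lt).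
have lt' : (l < k)%N by lia.
by rewrite (rank_lt _ _ lt') (rank_gt _ _ lt') eq_sym; congr (_ && _); rewrite andbC.
Qed.

Lemma avoid_pairC x k l : k != l -> avoid_pair x k l = avoid_pair x l k.
Proof.
move=> kl; rewrite avoid_pairP // avoid_pairP 1?eq_sym //; congr (_ && _).
by rewrite andbC.
Qed.

Lemma avoid_self u : avoid u u false =
  [&& pos u != 0%N, (pos u == h) ==> odd q & (pos u == h) ==> side u].
Proof. by rewrite -self_fold. Qed.

Lemma ends_fit x k : (typeC ==> avoid (x 0 k) (x 0 k) false) =
  ((pos (x 0 k) == 0%N) ==> (left_end.2 < own_rank x k)%N) &&
  ((pos (x 0 k) == h) ==> (own_rank x k < right_end.1)%N).
Proof.
rewrite avoid_self /own_rank /left_end /right_end; have := ltn_ord k.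
have := canonical_fold q_gt1 (x 0 k); rewrite /canonical /rank -/h.
by case: typeC; case: (side _); case: (odd q); rewrite /=; lia.
Qed.

Lemma left_end_gap : fits left_end gap. Proof. by rewrite /fits /=; case: typeC; lia. Qed.
Lemma gap_right_end : fits gap right_end.
Proof. by rewrite /fits /=; case: typeC; case: (odd q). Qed.

Definition all_avoid x :=
  [forall k, typeC ==> avoid (x 0 k) (x 0 k) false] &&
  [forall k, forall l, (k != l) ==> avoid_pair x k l].

Definition everyone := [pred k : 'I_m | true].
Definition plain k b := solo (rank k b).

Lemma plain_inj k k' b b' : plain k b = plain k' b' -> k = k' /\ b = b'.
Proof. by case=> /rank_inj. Qed.

Lemma plain_gap k b : plain k b != gap.
Proof. by have := rank_bound k b; rewrite /plain /solo /gap xpair_eqE; lia. Qed.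

Lemma plain_bounds k b : fits (plain k b) gap && fits gap (plain k b).
Proof. by have := rank_bound k b; rewrite /fits /=; lia. Qed.

Lemma left_end_pos k : fits left_end (plain k true) = false.
Proof. by have := ltn_ord k; rewrite /fits /=; case: typeC; lia. Qed.

Lemma neg_right_end k : ~~ odd q -> fits (plain k false) right_end = false.
Proof.
by move=> /negPf oq; have := ltn_ord k; rewrite /fits /= oq; case: typeC; lia.
Qed.

Lemma path_nth s w t : path fits s (rcons w t) -> size w = h.+1 ->
  [/\ fits s (nth gap w 0), fits (nth gap w h) t &
    forall p, (p < h)%N -> fits (nth gap w p) (nth gap w p.+1)].
Proof.
move=> pw sw; have := pw; rewrite -{1}(mkseq_nth gap w) sw => /path_mkseq[? ? ?].
by split.
Qed.

(** The words are those obtained by inserting all the letters between E + 1 gaps. *)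
Lemma card_all_avoid E : (h.+1 = m + E.+1)%N ->
  #|[set x | all_avoid x]| =
    (\prod_(k < m) room left_end right_end E.+1 (rank k true, rank k false))%N.
Proof.
move=> hE; pose L := letters everyone.
have uL : uniq (ranks L) by apply: uniq_ranks.
have bL : {in ranks L, forall y, 0 < y < (2 * m).+2}%N by apply: ranks_bound.
have hs : (left_end.2 < (2 * m).+2)%N := left_end_gap.
have ht : (0 < right_end.1)%N := gap_right_end.
have vld := @gaps_valid _ _ uL bL _ E _ hs ht.
have pinj k k' b b' : everyone k -> everyone k' -> plain k b = plain k' b' ->
  k = k' /\ b = b' by move=> _ _; apply: plain_inj.
have pO k b : everyone k -> plain k b != gap by move=> _; apply: plain_gap.
have pB k b : everyone k -> fits (plain k b) gap && fits gap (plain k b).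
  by move=> _; apply: plain_bounds.
have card_everyone : #|everyone| = m by rewrite -[RHS]card_ord; apply: eq_card.
rewrite -(prod_letters everyone (room left_end right_end E.+1)) -(size_fillings_gaps uL bL).
apply: (card_words q_gt1 pinj pO).
- by apply: uniq_fillings.
- move=> x; rewrite inE => /andP[/forallP selfx /forallP pairx].
  have pairx' k l : k != l -> avoid_pair x k l.
    by move: (pairx k) => /forallP/(_ l)/implyP.
  have sx : spread everyone x.
    move=> k l _ _ e; apply/eqP/negPn/negP => kl.
    by move: (pairx' k l kl); rewrite avoid_pairP // e eqxx.
  have aw := all_count_word q_gt1 (P := everyone) (sy := plain) (fun _ h => h)
    (fun _ _ _ => erefl) pinj pO sx.
  split=> //; rewrite mem_fillings //; apply/and3P; split=> //.
    apply/(path_word q_gt1 left_end_gap gap_right_end pB sx); split.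
    - by move=> k _ e; have := selfx k; rewrite ends_fit e eqxx => /andP[].
    - move=> k l _ _ e; have kl : k != l by apply/eqP => kl; move: e; rewrite kl; lia.
      by have := pairx' k l kl; rewrite avoid_pairP // e eqxx => /and3P[].
    - by move=> k _ e; have := selfx k; rewrite ends_fit e eqxx => /andP[].
  rewrite inE; apply/eqP.
  have /all_pred1P -> : all (pred1 gap) (skeleton L (word everyone plain x)).
    apply/allP => u; rewrite mem_filter => /andP[nl /mapP[p _ eu]].
    case: (contentP (esym eu)) => [->|[k _ [_ e]]]; first exact: eqxx.
    by case/negP: nl; apply/letterP; exists k, (side (x 0 k)).
  by congr nseq; have := size_gaps aw; rewrite size_word card_everyone -/h hE => /addnI <-.
- by move=> x x' _ _ e; apply/rowP => k; apply: e.
move=> w; rewrite mem_fillings // inE => /and3P[pw /eqP sk aw].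
have sw : size w = h.+1.
  by rewrite (size_gaps aw) sk size_nseq hE card_everyone.
have [w0 wh _] := path_nth pw sw.
have dw : decodable q everyone plain w.
  apply: (fillings_decodable (P := everyone)) => //.
  - by rewrite sk => u /nseqP[-> _]; left.
  - move=> k _; split.
      by apply/eqP => e; move: w0; rewrite e left_end_pos.
    by move=> oq; apply/eqP => e; move: wh; rewrite e neg_right_end.
split=> //; exists (\row_k decode q plain w k); last by move=> k _; rewrite mxE.
set x := \row_k _.
have [|sx wx] := word_decode q_gt1 pinj pO (x := x) dw; first by move=> k _; rewrite mxE.
move: pw; rewrite -wx => /(path_word q_gt1 left_end_gap gap_right_end pB sx)[h0 hp hh].
rewrite inE; apply/andP; split.
  apply/forallP => k; rewrite ends_fit; apply/andP; split; apply/implyP => /eqP e.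
    exact: h0.
  exact: hh.
apply/forallP => k; apply/forallP => l; apply/implyP => kl; rewrite avoid_pairP //.
apply/and3P; split; last 2 first.
- by apply/implyP => /eqP; apply: hp.
- by apply/implyP => /eqP; apply: hp.
by apply: contra kl => /eqP e; apply/eqP; apply: sx.
Qed.

Lemma fold_opp u : u != - u -> side (- u) = ~~ side u /\ pos (- u) = pos u.
Proof.
have := Zq_eqN q_gt1 (- u) u; rewrite eqxx Zq_eqN // => /esym.
by case: (foldP q_gt1 u); case: (foldP q_gt1 (- u)); split; lia.
Qed.

Lemma fold_signed b u : u != - u ->
  side (signed b u) = (side u == b) /\ pos (signed b u) = pos u.
Proof.
by move=> nu; case: b => /=; [rewrite eqb_id | rewrite eqbF_neg; apply: fold_opp].
Qed.

Lemma signedK b : involutive (signed b).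
Proof. by move=> u; case: b => //=; rewrite opprK. Qed.

Lemma succ_neq x k l : pos (x 0 l) = (pos (x 0 k)).+1 -> k != l.
Proof.
move=> e; apply/eqP => kl; move: e; rewrite kl => /esym/eqP.
by rewrite eqn_leq ltnn.
Qed.

Lemma gaps_skeleton L (s : seq symbol) :
    {in s, forall u : symbol, letter L u \/ u = gap} ->
  skeleton L s = nseq (size (skeleton L s)) gap.
Proof.
move=> hs; apply/all_pred1P/allP => u; rewrite mem_filter => /andP[nl /hs[l|->]].
  by rewrite l in nl.
exact: eqxx.
Qed.

(** * Two coinciding coordinates *)
Section Pair.
Variables (i0 j0 : 'I_m) (b0 : bool).
Hypothesis lt_ij : (i0 < j0)%N.

Definition others := [pred k : 'I_m | (k != i0) && (k != j0)].

(** All hyperplanes except the two given by the coordinates i0 and j0 with the sign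
of b0. *)
Definition avoid_others x :=
  [&& [forall k, typeC ==> avoid (x 0 k) (x 0 k) false],
    [forall k, forall l, (k != l) && (others k || others l) ==> avoid_pair x k l]
    & avoid (x 0 i0) (x 0 j0) (~~ b0)].

Lemma card_others : (#|others| + 2 = m)%N.
Proof.
rewrite -[RHS]card_ord -(cardC others); congr (_ + _)%N.
have -> : #|[predC others]| = #|pred2 i0 j0|.
  by apply: eq_card => k; rewrite !inE negb_and !negbK.
by rewrite card2; have -> : (i0 != j0) = true by apply/eqP => e; move: lt_ij; rewrite e ltnn.
Qed.

Let L := letters others.
Let uL : uniq (ranks L). Proof. exact: uniq_ranks. Qed.
Let bL : {in ranks L, forall y, 0 < y < (2 * m).+2}%N.
Proof. exact: ranks_bound. Qed.
Let hs : (left_end.2 < (2 * m).+2)%N := left_end_gap.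
Let ht : (0 < right_end.1)%N := gap_right_end.

Lemma others_neq k : others k -> k != i0 /\ k != j0.
Proof. by case/andP. Qed.

(** Where the values of +i0 and of j0 with sign b0 coincide, the position carries
both letters, and its neighbours must fit both: it acts as the interval between the
two ranks.  The other orientation, which carries the opposite letters, is its mirror
image. *)
Definition merged b : symbol :=
  if b then (rank i0 true, rank j0 b0) else (rank j0 (~~ b0), rank i0 false).

Definition merged_symbol k b := if k == i0 then merged b else plain k b.
Let D := [pred k : 'I_m | k != j0].

Definition merged_room E ab := (room left_end right_end E.+1 ab -
  ((rank i0 true <= ab.1 <= rank j0 b0) + (rank i0 true <= ab.2 <= rank j0 b0)))%N.

Lemma merged1 b : (merged b).1 = if b then rank i0 true else rank j0 (~~ b0).
Proof. by case: b. Qed.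

Lemma merged2 b : (merged b).2 = if b then rank j0 b0 else rank i0 false.
Proof. by case: b. Qed.

Lemma merged_room_def E b : (0 < E)%N -> {in L, forall ab, (merged_room E ab +
    (((merged b).1 <= ab.1 <= (merged b).2) + ((merged b).1 <= ab.2 <= (merged b).2)) =
    room left_end right_end E.+1 ab + (((merged b).2 < ab.1 < (merged b).1) +
      ((merged b).2 < ab.2 < (merged b).1)))%N}.
Proof.
move=> E0 _ /mapP[k _ ->]; rewrite merged1 merged2 /merged_room.
have nil (u v y : nat) : (v < u)%N -> (u < y < v)%N = false.
  by move=> vu; apply/negP => /andP[uy /(ltn_trans uy)]; rewrite ltnNge ltnW.
(* Changing all signs exchanges the two orientations. *)
have mir b' : ((rank j0 (~~ b0) <= rank k b' <= rank i0 false) =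
   (rank i0 true <= rank k (~~ b') <= rank j0 b0))%N.
  by rewrite !(leqNgt (rank _ _)) -(rank_opp k j0) -(rank_opp i0 k) negbK andbC.
have lt1 : (rank i0 true < rank j0 b0)%N by rewrite rank_lt.
have lt2 : (rank j0 (~~ b0) < rank i0 false)%N by rewrite rank_gt.
have : (2 <= room left_end right_end E.+1 (rank k true, rank k false))%N by rewrite /room; lia.
move: (room _ _ _ _) => g g2.
have le2 (x y : bool) : (x + y <= g)%N by apply: leq_trans g2; case: x y => [] [].
move: (mir true) (mir false) lt1 lt2; move: (@rank m) => r /= m1 m2 lt1 lt2.
case: b; rewrite !(nil _ _ _ lt1, nil _ _ _ lt2) addn0 ?subnK //.
by rewrite m1 m2 [X in (_ + X)%N]addnC subnK.
Qed.

Definition coincide x := avoid_others x && (x 0 i0 == signed b0 (x 0 j0)).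

(** The remaining hyperplanes of i0 and j0 become 2x_i0 = 0 and 2x_i0 = 1 on the
set x_i0 = x_j0 up to sign; they exclude the fixed points and (q + 1)/2.  Hence
the block is barred at the left end, and at the right end unless q is odd and
i0 has sign plus. *)
Lemma card_coincide E : (0 < E)%N -> (h.+1 = m + E)%N ->
  (#|[set x | coincide x]| +
    \sum_(b : bool)
      ((if fits left_end (merged b) then \prod_(ab <- letters others)
          room (merged b) right_end E.+1 ab else 0) +
       (if (odd q ==> ~~ b) && fits (merged b) right_end then \prod_(ab <- letters others)
          room left_end (merged b) E.+1 ab else 0)) =
  (\sum_(b : bool) (fits left_end (merged b) + E + fits (merged b) right_end)) *
    \prod_(ab <- letters others) merged_room E ab)%N.
Proof.
move=> E0 hE.
have hi := ltn_ord i0; have hj := ltn_ord j0.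
have ij : i0 != j0 by apply/eqP => e; move: lt_ij; rewrite e ltnn.
have mergeO b : merged b != gap.
  by rewrite /merged /gap; have := rank_bound i0 false; have := rank_bound j0 b0;
    case: b; rewrite xpair_eqE; lia.
have merge_neq : merged true != merged false.
  by rewrite xpair_eqE /rank /=; apply/negP; case: (b0); lia.
have merge_pt b y : merged b != solo y.
  by rewrite /merged /solo /rank; case: b; case: (b0); rewrite xpair_eqE /=; lia.
have merge_letter b : ~~ letter L (merged b).
  by apply/negP => /letterP[k [b' [_ /eqP]]]; apply/negP.
have sI k k' b b' : D k -> D k' -> merged_symbol k b = merged_symbol k' b' ->
    k = k' /\ b = b'.
  move=> Dk Dk'; rewrite /merged_symbol.
  have [->|nk] := eqVneq k i0; have [->|nk'] := eqVneq k' i0.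
  - move=> e; split=> //; move: merge_neq.
    by case: b b' e => [] [] // ->; rewrite eqxx.
  - by move=> /eqP e; have := merge_pt b (rank k' b'); rewrite e.
  - by move=> /esym/eqP e; have := merge_pt b' (rank k b); rewrite e.
  - exact: plain_inj.
have sO k b : D k -> merged_symbol k b != gap.
  by move=> _; rewrite /merged_symbol; case: ifP => _; rewrite ?mergeO ?plain_gap.
have sB k b : D k -> fits (merged_symbol k b) gap && fits gap (merged_symbol k b).
  move=> _; rewrite /merged_symbol; case: ifP => _; last exact: plain_bounds.
  have := rank_bound i0 b; have := rank_bound j0 b0; have := rank_bound j0 (~~ b0).
  by rewrite /fits merged1 merged2 /=; case: b; lia.
have PD : subpred others D by move=> k /andP[].
have sP k b : others k -> merged_symbol k b = solo (rank k b).
  by move=> /andP[/negPf nk _]; rewrite /merged_symbol nk.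
have Dnot k : D k -> ~~ others k -> k = i0.
  by rewrite /= => nj; rewrite nj andbT negbK => /eqP.
have symi0 b : merged_symbol i0 b = merged b by rewrite /merged_symbol eqxx.
have Di0 : D i0 by [].
have Dothers k : D k -> k != i0 -> others k by move=> /= nj ni; rewrite ni nj.
have hd1 b : (0 < (merged b).1)%N by have /andP[] := sB i0 b Di0; rewrite symi0.
have la2 b : ((merged b).2 < (2 * m).+2)%N by have /andP[] := sB i0 b Di0; rewrite symi0.
have Blet b : ~~ has (letter L) [:: merged b] by rewrite /= orbF.
have F_def b := merged_room_def b E0.
have := @size_allowed _ _ uL bL left_end right_end E hs ht merged (fun=> [::]) hd1 la2
  merge_neq mergeO mergeO merge_neq (fun=> isT) Blet (fun _ _ _ _ => erefl) _ F_def
  predT (fun b => odd q ==> ~~ b).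
rewrite /=.
set W := allowed _ _ _ _ _ _ _ _ _; move=> <-; congr (_ + _)%N.
have vld : {in placements (2 * m).+2 left_end right_end E merged (fun=> [::]),
    forall v : seq symbol, path fits left_end (rcons v right_end) && ~~ has (letter L) v}.
  exact: placements_valid.
have barredE w : size w = h.+1 ->
    barred merged (fun=> [::]) predT (fun b => odd q ==> ~~ b) w =
  [|| nth gap w 0 == merged true, nth gap w 0 == merged false,
     ~~ odd q && (nth gap w h == merged true) | nth gap w h == merged false].
  move=> sw; rewrite /barred /starts /ends /= sw subSS subn0.
  have tk a : (take 1 w == [:: a]) = (nth gap w 0 == a).
    by case: (w) sw => //= u w' _; rewrite take0 eqseq_cons eqxx andbT.
  have dr a : (drop h w == [:: a]) = (nth gap w h == a).
    rewrite (drop_nth gap) ?sw // drop_oversize ?sw // eqseq_cons eqxx andbT //.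
  by rewrite !tk !dr implybT implybF.
apply: (card_words q_gt1 sI sO).
- apply/filter_uniq/uniq_fillings => //; exact: uniq_placements.
- move=> x; rewrite inE => /andP[/and3P[/forallP selfx /forallP pairx otherx] /eqP xij].
  have pairx' k l : k != l -> others k || others l -> avoid_pair x k l.
    by move=> kl o; move: (pairx k) => /forallP/(_ l)/implyP; apply; rewrite kl.
  have xji : x 0 j0 = signed b0 (x 0 i0) by rewrite xij signedK.
  have selfi : avoid (x 0 i0) (x 0 i0) false.
    by move: otherx; rewrite xji /avoid; case: (b0); rewrite /= ?opprK.
  have ui : x 0 i0 != - x 0 i0 by case/andP: selfi.
  have [sgj psj] : side (x 0 j0) = (side (x 0 i0) == b0) /\ pos (x 0 j0) = pos (x 0 i0).
    by rewrite xji; apply: fold_signed.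
  have litj : own_rank x j0 = rank j0 (side (x 0 i0) == b0) by rewrite /own_rank sgj.
  have sx : spread D x.
    move=> k l Dk Dl e; apply/eqP/negPn/negP => kl.
    have o : others k || others l.
      apply/negPn/negP => /norP[nk nl]; case/negP: kl.
      by rewrite (Dnot k Dk nk) (Dnot l Dl nl).
    by have := pairx' k l kl o; rewrite avoid_pairP // e eqxx.
  have aw := all_count_word q_gt1 PD sP sI sO sx.
  have pw : path fits left_end (rcons (word D merged_symbol x) right_end).
    apply/(path_word q_gt1 left_end_gap gap_right_end sB sx); split.
    - move=> k Dk e; have [ek|nk] := eqVneq k i0.
        by move: selfi; rewrite avoid_self -ek e.
      rewrite sP; last exact: Dothers.
      by have := selfx k; rewrite ends_fit e eqxx => /andP[].
    - move=> k l Dk Dl e; have kl := succ_neq e.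
      have [ek|nk] := eqVneq k i0; have [el|nl] := eqVneq l i0.
      + by rewrite ek el eqxx in kl.
      + have ol := Dothers l Dl nl; rewrite (sP l) // ek symi0 /fits merged2.
        have [_ nlj] := others_neq ol.
        have := pairx' i0 l; rewrite ol orbT eq_sym nl => /(_ isT isT).
        have := pairx' j0 l; rewrite ol orbT eq_sym nlj => /(_ isT isT).
        rewrite !avoid_pairP 1?eq_sym // litj psj -ek e eqxx ek.
        move=> /and3P[_ /= h1 _] /and3P[_ /= h2 _].
        by move: h1 h2; rewrite /own_rank; case: (side (x 0 i0)).
      + have ok := Dothers k Dk nk; rewrite (sP k) // el symi0 /fits merged1.
        have [_ nkj] := others_neq ok.
        have := pairx' k i0; rewrite ok nk => /(_ isT isT).
        have := pairx' k j0; rewrite ok nkj => /(_ isT isT).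
        rewrite !avoid_pairP // litj psj -el e eqxx el.
        move=> /and3P[_ /= h1 _] /and3P[_ /= h2 _].
        by move: h1 h2; rewrite /own_rank; case: (side (x 0 i0)); case: (b0).
      have ok := Dothers k Dk nk; have ol := Dothers l Dl nl; rewrite !sP //.
      by have := pairx' k l kl; rewrite ok avoid_pairP // e eqxx => /(_ isT) /and3P[].
    move=> k Dk e; have [ek|nk] := eqVneq k i0; last first.
      rewrite sP; last exact: Dothers.
      by have := selfx k; rewrite ends_fit e eqxx => /andP[].
    move: selfi; rewrite -ek avoid_self e eqxx => /and3P[_ _ /= sgk].
    rewrite sgk ek symi0 /fits merged2.
    have := selfx j0; rewrite ends_fit psj -ek e eqxx => /andP[_ /=].
    by rewrite litj -ek sgk eq_sym; case: (b0).
  have ci p b : (content D merged_symbol x p == merged b) =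
      (pos (x 0 i0) == p) && (side (x 0 i0) == b).
    by rewrite -symi0 content_sy.
  split=> //; rewrite mem_filter barredE ?size_word // !nth_word // !ci.
  apply/andP; split.
    move: selfi; rewrite avoid_self; case: (pos _ == 0%N) => //=.
    by case: (pos _ == h) => //=; case: (odd q); case: (side (x 0 i0)).
  rewrite (mem_fillings _ uL vld) pw aw andbT andTb.
  apply/placementsP; set p := pos (x 0 i0); set b := side (x 0 i0).
  have ph : (p <= h)%N by apply: pos_le.
  have gapP p' : p' != p -> letter L (content D merged_symbol x p') \/
      content D merged_symbol x p' = gap.
    move=> np; case: (contentP (erefl (content D merged_symbol x p'))) => [->|[k Dk [e ->]]].
      by right.
    left; have nk : k != i0 by apply: contra np => /eqP ek; rewrite -e ek.
    by apply/letterP; exists k, (side (x 0 k)); rewrite sP Dothers.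
  have wE : word D merged_symbol x = mkseq (content D merged_symbol x) p ++
      merged b :: map (content D merged_symbol x) (iota p.+1 (h - p)).
    rewrite /word /mkseq (_ : h.+1 = p + (h - p).+1)%N; last by move: ph; clear; lia.
    have /eqP cp : content D merged_symbol x p == merged b by rewrite ci !eqxx.
    by rewrite iotaD map_cat add0n /= cp.
  have [c1 [c2 sk1]] : exists c1 c2, skeleton L (word D merged_symbol x) =
      nseq c1 gap ++ merged b :: nseq c2 gap.
    exists (size (skeleton L (mkseq (content D merged_symbol x) p))).
    exists (size (skeleton L (map (content D merged_symbol x) (iota p.+1 (h - p))))).
    rewrite -!gaps_skeleton; first by rewrite wE /skeleton filter_cat /= merge_letter.
      move=> u /mapP[p']; rewrite mem_iota => /andP[lo _] ->.
      by apply: gapP; rewrite neq_ltn lo orbT.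
    move=> u /mapP[p']; rewrite mem_iota add0n => /andP[_ lo] ->.
    by apply: gapP; rewrite neq_ltn lo.
  have := size_gaps aw; rewrite sk1 size_word size_cat /= !size_nseq -/h => hsz.
  have hsum : (c1 + c2 = E.+1)%N.
    move: hsz hE card_others; move: #|_| (q./2) => N h'; clear; lia.
  exists b, c1; split.
  - by rewrite /placed -hsum addKn.
  - by rewrite -hsum leq_addr.
  by have := path_skeleton L pw; rewrite sk1.
- move=> x x'; rewrite !inE => /andP[_ /eqP xij] /andP[_ /eqP xij'] e.
  apply/rowP => k; have [->|nk] := eqVneq k j0; last exact: e.
  by rewrite -[LHS](signedK b0) -xij e // xij' signedK.
move=> w; rewrite mem_filter => /andP[nb]; rewrite (mem_fillings _ uL vld).
case/and3P=> pw /placementsP[b [p [sk hp _]]] aw.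
have sw : size w = h.+1.
  rewrite (size_gaps aw) sk /placed !size_cat !size_nseq /= hE.
  by move: hp card_others; move: #|_| => N; clear; lia.
have [w0 wh _] := path_nth pw sw.
have dw : decodable q D merged_symbol w.
  apply: (fillings_decodable PD sP sI sw aw).
  - move=> u; rewrite sk !mem_cat => /or3P[/nseqP[-> _]||/nseqP[-> _]]; [by left| |by left].
    by rewrite inE => /eqP->; right; exists i0, b.
  - move=> k Dk /(Dnot k Dk) ->; rewrite sk /placed !count_cat !count_nseq /=.
    rewrite ![gap == _]eq_sym !(negPf (sO _ _ Di0)) !symi0.
    by case: (b); rewrite eqxx ?orbT.
  move=> k Dk; split.
    apply/eqP => e; move: w0; rewrite e /merged_symbol; case: ifP => [_|_];
      last by rewrite left_end_pos.
    by rewrite -[fits _ _]/(fits left_end (plain i0 true)) left_end_pos.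
  move=> oq; apply/eqP => e; move: wh; rewrite e /merged_symbol; case: ifP => [_|_];
    last by rewrite neg_right_end.
  by rewrite -[fits _ _]/(fits (plain i0 false) right_end) neg_right_end.
split=> //; pose f := decode q merged_symbol w.
exists (\row_k if k == j0 then signed b0 (f i0) else f k); last first.
  by move=> k Dk; rewrite mxE (negPf Dk).
set x := \row_k _.
have xE k : D k -> x 0 k = f k by move=> Dk; rewrite mxE (negPf Dk).
have xj : x 0 j0 = signed b0 (x 0 i0) by rewrite [LHS]mxE eqxx xE.
have [sx wx] := word_decode q_gt1 sI sO dw xE.
move: pw; rewrite -wx => /(path_word q_gt1 left_end_gap gap_right_end sB sx)[h0 hp' hh].
have ci p' b' : (content D merged_symbol x p' == merged b') =
    (pos (x 0 i0) == p') && (side (x 0 i0) == b') by rewrite -symi0 content_sy.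
have selfi : avoid (x 0 i0) (x 0 i0) false.
  move: nb; rewrite barredE // -wx !nth_word // !ci avoid_self.
  case: (pos _ == 0%N) => //=; first by case: (side (x 0 i0)).
  by case: (pos _ == h) => //=; case: (odd q); case: (side (x 0 i0)).
have ui : x 0 i0 != - x 0 i0 by case/andP: selfi.
have [sgj psj] : side (x 0 j0) = (side (x 0 i0) == b0) /\ pos (x 0 j0) = pos (x 0 i0).
  by rewrite xj; apply: fold_signed.
have litj : own_rank x j0 = rank j0 (side (x 0 i0) == b0) by rewrite /own_rank sgj.
have merge_i : ((merged (side (x 0%R i0))).1 <= own_rank x i0
    <= (merged (side (x 0%R i0))).2)%N.
  rewrite merged1 merged2 /own_rank; case: (side _); rewrite leqnn ?andbT; apply: ltnW.
    by rewrite rank_lt.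
  by rewrite rank_gt.
have merge_j : ((merged (side (x 0%R i0))).1 <= own_rank x j0
    <= (merged (side (x 0%R i0))).2)%N.
  rewrite merged1 merged2 litj; case: (side _).
    have -> : (true == b0) = b0 by case: (b0).
    by rewrite leqnn andbT; apply: ltnW; rewrite rank_lt.
  have -> : (false == b0) = ~~ b0 by case: (b0).
  by rewrite leqnn; apply: ltnW; rewrite rank_gt.
rewrite inE; apply/andP; split; last by rewrite xj signedK.
have pairs k l : others k -> k != l -> avoid_pair x k l.
  move=> ok kl; have Dk := PD k ok; have [nki nkj] := others_neq ok.
  have near_i (y : nat) :
    ((merged (side (x 0%R i0))).1 <= y <= (merged (side (x 0%R i0))).2)%N ->
    [/\ pos (x 0 k) != pos (x 0 i0),
      (pos (x 0 i0) == (pos (x 0 k)).+1) ==> (own_rank x k < y)%N &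
      (pos (x 0 k) == (pos (x 0 i0)).+1) ==> (y < own_rank x k)%N].
    case/andP=> lo hi'; split.
    - by apply: contra nki => /eqP e; apply/eqP; apply: sx.
    - apply/implyP => /eqP e; have := hp' k i0 Dk Di0 e.
      by rewrite sP // symi0 /fits /= => /leq_trans; apply.
    apply/implyP => /eqP e; have := hp' i0 k Di0 Dk e.
    by rewrite (sP k) // symi0 /fits /=; apply: leq_ltn_trans.
  rewrite avoid_pairP //; have [->|nl] := eqVneq l i0.
    by apply/and3P; apply: near_i.
  have [->|nlj] := eqVneq l j0.
    by rewrite psj; apply/and3P; apply: near_i.
  have ol : others l by rewrite /= nl nlj.
  have Dl := PD l ol; apply/and3P; split.
  - by apply: contra kl => /eqP e; apply/eqP; apply: sx.
  - by apply/implyP => /eqP e; have := hp' k l Dk Dl e; rewrite !sP.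
  by apply/implyP => /eqP e; have := hp' l k Dl Dk e; rewrite !sP.
apply/and3P; split.
- apply/forallP => k; have [->|nk] := eqVneq k i0; first by rewrite selfi implybT.
  rewrite ends_fit; have [->|nkj] := eqVneq k j0.
    rewrite psj; move: selfi; rewrite avoid_self => /and3P[/negPf -> _ /= sgi].
    apply/implyP => ph; have := hh i0 Di0 (eqP ph); rewrite symi0 /fits.
    by apply: leq_ltn_trans; case/andP: merge_j.
  have ok : others k by rewrite /= nk nkj.
  apply/andP; split; apply/implyP => /eqP e.
    by have := h0 k (PD k ok) e; rewrite sP.
  by have := hh k (PD k ok) e; rewrite sP.
- apply/forallP => k; apply/forallP => l; apply/implyP => /andP[kl /orP[ok|ol]].
    exact: pairs.
  by rewrite avoid_pairC //; apply: pairs => //; rewrite eq_sym.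
by move: selfi; rewrite xj /avoid; case: (b0); rewrite /= ?opprK.
Qed.

(** * Two consecutive coordinates *)
(** No letter fits between a1 and a2, so symbols that are neighbours in the
skeleton are neighbours in the word. *)
Lemma block_adjacent (L' : seq (nat * nat)) s t a1 a2 (w c1 c2 : seq symbol) :
    path fits s (rcons w t) -> skeleton L' w = c1 ++ a1 :: a2 :: c2 ->
    (a2.1 <= a1.2.+1)%N ->
  exists w1 w2, [/\ w = w1 ++ a1 :: a2 :: w2, skeleton L' w1 = c1 & skeleton L' w2 = c2].
Proof.
move=> pw sk a12; elim: w s c1 pw sk => [|z w IH] s c1 /=; first by case: c1.
move=> /andP[sz pw]; rewrite {1}/skeleton /=; have [lz|nz] := boolP (letter L' z).
  rewrite /= -/(skeleton L' w) => /(IH z c1 pw)[u [v [-> su sv]]].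
  by exists (z :: u), v; split=> //; rewrite /skeleton /= lz.
rewrite /= -/(skeleton L' w); case: c1 => [|c c1] /= [ez].
  move: pw; rewrite ez; case: w {IH} => //= y w /andP[ay pw].
  rewrite {1}/skeleton /=; have [ly|ny] := boolP (letter L' y).
    rewrite /= -/(skeleton L' w) => sk; have := path_skeleton L' pw;
      rewrite sk /= => /andP[ya _].
    move: ly ay ya; rewrite letterE => /andP[/eqP ey _]; rewrite /fits -ey.
    by move=> ay ya; move: (leq_ltn_trans ay ya); rewrite ltnNge a12.
  by rewrite /= => -[ey sk]; exists [::], w; rewrite ey.
move=> /(IH z c1 pw)[u [v [-> su sv]]]; exists (z :: u), v; split=> //.
by rewrite /skeleton /= nz ez -su.
Qed.

(** On the hyperplane u = v + 1 (up to the sign of v) the letter of v is followed by that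
of u, or, as the mirror image, the negative of u by the negative of v.  The hyperplanes
with the other sign of v keep it away from 0, respectively from q/2. *)
Lemma step_fold b u v :
  avoid u v (~~ b) && (u == signed b v + 1) =
  [&& side v == b, side u, pos u == (pos v).+1 & pos v != 0%N] ||
  [&& side v == ~~ b, ~~ side u, pos v == (pos u).+1 & (pos v == h) ==> odd q].
Proof.
rewrite /avoid /h; case: b => /=.
  by rewrite Zq_eqN // Zq_eq1N // Zq_eqD1 //; case: (foldP q_gt1 u); case: (foldP q_gt1 v);
    move: q_gt1; clear; lia.
rewrite Zq_eq1N // Zq_eqD1 // -(inj_eq val_inj) /=.
by case: (foldP q_gt1 u); case: (foldP q_gt1 v); move: q_gt1; clear; lia.
Qed.

Definition head_letter b := if b then j0 else i0.
Definition head_sign b := if b then b0 else false.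
Definition last_letter b := if b then i0 else j0.
Definition last_sign b := if b then true else ~~ b0.

Definition is_head k b := (k == j0) && (b == b0) || (k == i0) && ~~ b.
(** The value hi lies just below the rank of the next symbol, so that this symbol
fits but no letter can be inserted inside the block. *)
Definition step_head b : symbol :=
  (rank (head_letter b) (head_sign b), (rank (last_letter b) (last_sign b)).-1).
Definition step_symbol k b : symbol :=
  if (k == j0) && (b == b0) then step_head true
  else if (k == i0) && ~~ b then step_head false else plain k b.
Definition step_tail b := [:: plain (last_letter b) (last_sign b)].

Definition step_room E ab := (room left_end right_end E.+1 ab +
  ((rank i0 true < ab.1 < rank j0 b0) + (rank i0 true < ab.2 < rank j0 b0)))%N.

Lemma step_symbol1 k b : (step_symbol k b).1 = rank k b.
Proof.
rewrite /step_symbol; case: ifP => [/andP[/eqP-> /eqP->]|_] //.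
by case: ifP => [/andP[/eqP-> /negPf->]|_].
Qed.

Lemma step_symbol2 k b : ~~ is_head k b -> (step_symbol k b).2 = rank k b.
Proof. by case/norP => h1 h2; rewrite /step_symbol (negPf h1) (negPf h2). Qed.

Lemma step_symbol2_le k b : ((step_symbol k b).2 <= rank k b)%N.
Proof.
rewrite /step_symbol; case: ifP => [/andP[/eqP-> /eqP->]|_].
  by apply: leq_trans (leq_pred _) _; apply: ltnW; rewrite rank_lt.
case: ifP => [/andP[/eqP-> /negPf->]|_] //.
by apply: leq_trans (leq_pred _) _; apply: ltnW; rewrite rank_gt.
Qed.

Definition consecutive x := avoid_others x && (x 0 i0 == signed b0 (x 0 j0) + 1).

Lemma step_room_def E b : {in L, forall ab, (step_room E ab +
    (((step_head b).1 <= ab.1 <= (last (step_head b) (step_tail b)).2) +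
     ((step_head b).1 <= ab.2 <= (last (step_head b) (step_tail b)).2)) =
    room left_end right_end E.+1 ab +
      (((last (step_head b) (step_tail b)).2 < ab.1 < (step_head b).1) +
       ((last (step_head b) (step_tail b)).2 < ab.2 < (step_head b).1)))%N}.
Proof.
move=> _ /mapP[k _ ->].
rewrite /step_room -addnA; congr (_ + _)%N.
rewrite /step_head /step_tail /head_letter /head_sign /last_letter /last_sign.
have empty (u v y : nat) : (v < u)%N -> (u <= y <= v)%N = false.
  by move=> vu; apply/negP => /andP[uy /(leq_trans uy)]; rewrite leqNgt vu.
have mir b' : ((rank j0 (~~ b0) < rank k b' < rank i0 false) =
   (rank i0 true < rank k (~~ b') < rank j0 b0))%N.
  by rewrite -(rank_opp j0) -(rank_opp k i0) negbK andbC.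
have : (rank i0 true < rank j0 b0)%N by rewrite rank_lt.
have : (rank j0 (~~ b0) < rank i0 false)%N by rewrite rank_gt.
move: mir (mir true) (mir false); rewrite /plain; move: (@rank m) => r mir /= m1 m2 lt2 lt1.
case: b => /=; rewrite !(empty _ _ _ lt1, empty _ _ _ lt2) ?addn0 //.
by rewrite m1 m2 addnC.
Qed.

Lemma is_headE k b : is_head k b -> exists2 b', k = head_letter b' & b = head_sign b'.
Proof.
case/orP => /andP[/eqP-> hb]; first by exists true => //; apply/eqP.
by exists false => //; exact: negPf hb.
Qed.

Lemma step_symbol_head b : step_symbol (head_letter b) (head_sign b) = step_head b.
Proof.
rewrite /step_symbol /head_letter /head_sign; case: b; rewrite ?eqxx //=.
case: ifP => [/andP[/eqP e _]|//].
by move: lt_ij; rewrite e ltnn.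
Qed.

Lemma step_symbol_last b :
  step_symbol (last_letter b) (last_sign b) = plain (last_letter b) (last_sign b).
Proof.
have nij : (i0 == j0) = false by apply/negP => /eqP e; move: lt_ij; rewrite e ltnn.
have nji : (j0 == i0) = false by rewrite eq_sym.
rewrite /step_symbol /last_letter /last_sign; case: b; rewrite ?eqxx ?nij ?nji //=.
by case: (b0).
Qed.

(** The barred words are those excluded by the last conditions of the two cases of
[step_fold]. *)
Lemma card_consecutive E : (h.+1 = m + E.+1)%N ->
  (#|[set x | consecutive x]| +
    \sum_(b : bool)
      ((if b && fits left_end (step_head b) then \prod_(ab <- letters others)
          room (plain (last_letter b) (last_sign b)) right_end E.+1 ab else 0) +
       (if (~~ odd q && ~~ b) && fits (plain (last_letter b) (last_sign b)) right_end
        then \prod_(ab <- letters others) room left_end (step_head b) E.+1 ab else 0)) =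
  (\sum_(b : bool) (fits left_end (step_head b) + E +
      fits (plain (last_letter b) (last_sign b)) right_end)) *
    \prod_(ab <- letters others) step_room E ab)%N.
Proof.
move=> hE.
have nij : i0 != j0 by apply/eqP => e; move: lt_ij; rewrite e ltnn.
have hd_pt b y : step_head b != solo y.
  rewrite /step_head /solo xpair_eqE; apply/negP => /andP[/eqP <- /eqP].
  rewrite /head_letter /head_sign /last_letter /last_sign; case: b => e.
    have := rank_lt true b0 lt_ij; rewrite -e => /idP; rewrite ltnNge => /negP; apply.
    exact: leq_pred.
  have := rank_gt false (~~ b0) lt_ij; rewrite -e => /idP; rewrite ltnNge => /negP; apply.
  exact: leq_pred.
have sI k k' b b' : everyone k -> everyone k' -> step_symbol k b = step_symbol k' b' ->
    k = k' /\ b = b'.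
  by move=> _ _ /(congr1 fst); rewrite !step_symbol1; apply: rank_inj.
have sO k b : everyone k -> step_symbol k b != gap.
  move=> _; apply/negP => /eqP /(congr1 fst); rewrite step_symbol1 /= => e.
  by have := rank_bound k b; rewrite e ltnn andbF.
have sB k b : everyone k -> fits (step_symbol k b) gap && fits gap (step_symbol k b).
  move=> _; have /andP[r0 r1] := rank_bound k b; rewrite /fits step_symbol1 r0 andbT.
  exact: leq_ltn_trans (step_symbol2_le k b) r1.
have PD : subpred others everyone by [].
have sP k b : others k -> step_symbol k b = solo (rank k b).
  by move=> /andP[/negPf ni /negPf nj]; rewrite /step_symbol ni nj.
have hd1 b : (0 < (step_head b).1)%N.
  by rewrite -step_symbol_head; have /andP[] := sB (head_letter b) (head_sign b) isT.
have hd_gap b : step_head b != gap by rewrite -step_symbol_head sO.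
have la_gap b : plain (last_letter b) (last_sign b) != gap by apply: plain_gap.
have la2 b : ((plain (last_letter b) (last_sign b)).2 < (2 * m).+2)%N.
  by have /andP[] := rank_bound (last_letter b) (last_sign b).
have hd_neq : step_head true != step_head false.
  apply/negP; rewrite -!step_symbol_head => /eqP /(sI _ _ _ _ isT isT)[e _].
  by move: nij; rewrite -[j0]/(head_letter true) e eqxx.
have la_neq : plain (last_letter true) (last_sign true) !=
    plain (last_letter false) (last_sign false).
  by apply/negP => /eqP /plain_inj[e _]; move: nij; rewrite -[i0]/(last_letter true) e eqxx.
have hl b : fits (step_head b) (plain (last_letter b) (last_sign b)).
  by rewrite /fits /=; have /andP[] := rank_bound (last_letter b) (last_sign b); case: rank.
have nothers b : ~~ others (head_letter b) /\ ~~ others (last_letter b).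
  by rewrite /= /head_letter /last_letter; case: b; rewrite !eqxx ?andbF.
have hd_letter b : ~~ letter L (step_head b).
  by apply/letterP => -[k [b' [_ /eqP]]]; apply/negP.
have la_letter b : ~~ letter L (plain (last_letter b) (last_sign b)).
  apply/letterP => -[k [b' [ok /plain_inj[e _]]]]; have [_] := nothers b.
  by rewrite e ok.
have Blet b : ~~ has (letter L) (step_head b :: step_tail b).
  by rewrite /= orbF negb_or hd_letter la_letter.
have Bpath b : path fits (step_head b) (step_tail b) by rewrite /= hl.
have Bslots b y (v : symbol) : y \in ranks L -> slots y (step_head b) (step_tail b) v =
    slot y (last (step_head b) (step_tail b)) v.
  move=> _; rewrite /= (_ : slot y (step_head b) _ = false) //.
  rewrite /slot /fits /=; have /andP[] := rank_bound (last_letter b) (last_sign b).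
  by case: rank => //= r _ _; apply/negP => /andP[ry]; rewrite ltnS leqNgt ry.
have F_def b := @step_room_def E b.
have := @size_allowed _ _ uL bL left_end right_end E hs ht step_head step_tail hd1 la2 hd_neq
  hd_gap la_gap la_neq Bpath Blet Bslots _ F_def id (fun b => ~~ odd q && ~~ b).
set W := allowed _ _ _ _ _ _ _ _ _; move=> <-; congr (_ + _)%N.
have vld : {in placements (2 * m).+2 left_end right_end E step_head step_tail,
    forall v : seq symbol, path fits left_end (rcons v right_end) && ~~ has (letter L) v}.
  exact: placements_valid.
have orient k : ~~ others k -> exists b, k = head_letter b.
  by rewrite negb_and !negbK => /orP[] /eqP->; [exists false | exists true].
apply: (card_words q_gt1 sI sO).
- apply/filter_uniq/uniq_fillings => //; exact: uniq_placements.
- move=> x; rewrite inE => /andP[/and3P[/forallP selfx /forallP pairx otherx] xij].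
  have pairx' k l : k != l -> others k || others l -> avoid_pair x k l.
    by move=> kl o; move: (pairx k) => /forallP/(_ l)/implyP; apply; rewrite kl.
  have [b [sgh sgl psl nb1 nb2]] : exists b, [/\ side (x 0 (head_letter b)) = head_sign b,
      side (x 0 (last_letter b)) = last_sign b,
      pos (x 0 (last_letter b)) = (pos (x 0 (head_letter b))).+1,
      b -> pos (x 0 j0) != 0%N & ~~ b -> (pos (x 0 j0) == h) ==> odd q].
    have := step_fold b0 (x 0 i0) (x 0 j0); rewrite otherx xij.
    case/esym/orP => /and4P[/eqP e1 e2 /eqP e3 e4]; [exists true|exists false]; split=> //.
    exact: negPf e2.
  have sx : spread everyone x.
    move=> k l _ _ e; apply/eqP/negPn/negP => kl.
    have [o|] := boolP (others k || others l).
      by have := pairx' k l kl o; rewrite avoid_pairP // e eqxx.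
    move=> /norP[/orient[b1 e1] /orient[b2 e2]]; move: kl e; rewrite e1 e2 {e1 e2}.
    move: psl; rewrite /head_letter /last_letter.
    by case: b b1 b2 {sgh sgl nb1 nb2} => [] [] [] //=; rewrite ?eqxx // => -> _ /eqP;
      rewrite ?eqn_leq ltnn ?andbF.
  have aw := all_count_word q_gt1 PD sP sI sO sx.
  have pw : path fits left_end (rcons (word everyone step_symbol x) right_end).
    apply/(path_word q_gt1 left_end_gap gap_right_end sB sx); split.
    - move=> k _ e; rewrite /fits step_symbol1.
      by have := selfx k; rewrite ends_fit e eqxx => /andP[].
    - move=> k l _ _ e; have kl := succ_neq e; rewrite /fits step_symbol1.
      have [o|] := boolP (others k || others l).
        have := pairx' k l kl o; rewrite avoid_pairP // e eqxx => /and3P[_ /= h1 _].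
        exact: leq_ltn_trans (step_symbol2_le _ _) h1.
      move=> /norP[/orient[b1 e1] /orient[b2 e2]].
      have [ek el] : k = head_letter b /\ l = last_letter b.
        move: kl e psl; rewrite e1 e2 {e1 e2} /head_letter /last_letter; clear.
        by case: b b1 b2 => [] [] [] //=; rewrite ?eqxx // => _ -> /eqP;
          rewrite eqn_leq => /andP[_]; rewrite ltnNge leqnSn.
      rewrite ek el sgh sgl step_symbol_head; have := hl b; by rewrite /fits.
    move=> k _ e; apply: leq_ltn_trans (step_symbol2_le _ _) _.
    by have := selfx k; rewrite ends_fit e eqxx => /andP[].
  set p := pos (x 0 (head_letter b)) in psl.
  have ph : (p < h)%N by rewrite -psl; apply: pos_le.
  pose f := content everyone step_symbol x.
  have fp : f p = step_head b by rewrite /f content_at // sgh step_symbol_head.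
  have fp1 : f p.+1 = plain (last_letter b) (last_sign b).
    by rewrite /f -psl content_at // sgl step_symbol_last.
  have f0 b1 : f 0%N = step_head b1 -> pos (x 0 (head_letter b1)) = 0%N /\ b1 = b.
    move/eqP; rewrite /f -step_symbol_head content_sy // => /andP[/eqP e0 /eqP es].
    split=> //; apply/eqP/negPn/negP => nb.
    have el : last_letter b = head_letter b1 by move: nb; case: (b1) (b) => [] [].
    by move: psl; rewrite el e0.
  have fh b1 : f h = plain (last_letter b1) (last_sign b1) ->
      pos (x 0 (last_letter b1)) = h /\ b1 = b.
    move/eqP; rewrite /f -step_symbol_last content_sy // => /andP[/eqP e0 /eqP es].
    split=> //; apply/eqP/negPn/negP => nb.
    have el : head_letter b = last_letter b1 by move: nb; case: (b1) (b) => [] [].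
    by move: ph; rewrite /p el e0 ltnn.
  split=> //; rewrite mem_filter; apply/andP; split.
    rewrite /barred andbF andbT /=; apply/negP => /orP[].
      move=> /startsP[w' ew]; have /f0[e0 eb] : f 0%N = step_head true.
        by rewrite /f -nth_word // ew.
      by have := nb1; rewrite -eb e0 => /(_ isT).
    move=> /andP[oq /endsP[w' ew]].
    have /fh[eh eb] : f h = plain (last_letter false) (last_sign false).
      have sw := @size_word q m everyone step_symbol x.
      rewrite /f -nth_word // -[h]/(h.+1.-1) -sw nth_last ew last_cat //.
    by have := nb2; rewrite -eb eh eqxx (negPf oq) => /(_ isT).
  rewrite (mem_fillings _ uL vld) pw aw andbT andTb.
  apply/placementsP.
  have gapP p' : p' != p -> p' != p.+1 -> letter L (f p') \/ f p' = gap.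
    move=> np np1; case: (contentP (erefl (f p'))) => [->|[k _ [e ->]]]; first by right.
    left; have ok : others k.
      apply: contraT => /orient[b1 ek]; case: (b =P b1) => [eb|nb].
        by move: np; rewrite -e ek -eb /p eqxx.
      have el : head_letter b1 = last_letter b by case: (b) (b1) nb => [] [].
      by move: np1; rewrite -e ek el psl eqxx.
    by apply/letterP; exists k, (side (x 0 k)); rewrite sP.
  have wE : word everyone step_symbol x = mkseq f p ++
      step_head b :: plain (last_letter b) (last_sign b) :: map f (iota p.+2 (h - p.+1)).
    rewrite /word -/f /mkseq (_ : h.+1 = p + (h - p.+1).+2)%N; last by move: ph; clear; lia.
    by rewrite iotaD map_cat add0n /= fp fp1.
  have [c1 [c2 sk1]] : exists c1 c2, skeleton L (word everyone step_symbol x) =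
      nseq c1 gap ++ step_head b :: plain (last_letter b) (last_sign b) :: nseq c2 gap.
    exists (size (skeleton L (mkseq f p))).
    exists (size (skeleton L (map f (iota p.+2 (h - p.+1))))).
    rewrite -!gaps_skeleton.
    - by rewrite wE /skeleton filter_cat /= hd_letter la_letter.
    - move=> u /mapP[p']; rewrite mem_iota => /andP[lo _] ->.
      by apply: gapP; rewrite neq_ltn ?lo ?(ltnW lo) orbT.
    move=> u /mapP[p']; rewrite mem_iota add0n => /andP[_ lo] ->.
    by apply: gapP; rewrite neq_ltn ?(ltnW lo) ?lo // ltnS ltnW.
  have := size_gaps aw; rewrite sk1 size_word size_cat /= !size_nseq -/h => hsz.
  have hsum : (c1 + c2 = E.+1)%N.
    move: hsz hE card_others; move: #|_| (q./2) => N h'; clear; lia.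
  exists b, c1; split.
  - by rewrite /placed -hsum addKn.
  - by rewrite -hsum leq_addr.
  by have := path_skeleton L pw; rewrite sk1.
- by move=> x x' _ _ e; apply/rowP => k; apply: e.
move=> w; rewrite mem_filter => /andP[nb]; rewrite (mem_fillings _ uL vld).
case/and3P=> pw /placementsP[b [p [sk hp _]]] aw.
have sw : size w = h.+1.
  rewrite (size_gaps aw) sk /placed !size_cat !size_nseq /= hE.
  by move: hp card_others; move: #|_| => N; clear; lia.
have [w1 [w2 [ew s1 s2]]] := block_adjacent pw sk (leqSpred _).
set p' := size w1.
have ph : (p' < h)%N.
  by move: sw; rewrite ew size_cat /= -/p'; clear; lia.
have np : nth gap w p' = step_head b by rewrite ew nth_cat ltnn subnn.
have np1 : nth gap w p'.+1 = plain (last_letter b) (last_sign b).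
  by rewrite ew nth_cat ltnNge leqnSn /= subSnn.
have [w0 wh _] := path_nth pw sw.
have sE k k' c c' : (step_symbol k c == step_symbol k' c') = (k == k') && (c == c').
  by apply/eqP/andP => [/(sI _ _ _ _ isT isT)[-> ->]|[/eqP-> /eqP->]].
have dw : decodable q everyone step_symbol w.
  apply: (fillings_decodable PD sP sI sw aw).
  - move=> u; rewrite sk !mem_cat => /or3P[/nseqP[-> _]||/nseqP[-> _]]; [by left| |by left].
    rewrite !inE => /orP[]/eqP->; right.
      by exists (head_letter b), (head_sign b); rewrite step_symbol_head.
    by exists (last_letter b), (last_sign b); rewrite step_symbol_last.
  - move=> k _ /orient[b1 ->]; rewrite sk /placed !count_cat !count_nseq /=.
    rewrite ![gap == _]eq_sym !(negPf (sO _ _ isT)) -step_symbol_head -step_symbol_last !sE.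
    have oneE (c c' : bool) : c && (c' == true) || c && (c' == false) = c.
      by case: c c' => [] [].
    rewrite !oneE !mul0n add0n !addn0; clear -nij; rewrite /head_letter /last_letter.
    by case: b b1 => [] []; rewrite ?eqxx ?[j0 == i0]eq_sym ?(negPf nij).
  move=> k _; split.
    apply/eqP => e; move: w0; rewrite e /fits step_symbol1.
    by rewrite -[(_ < _)%N]/(fits left_end (plain k true)) left_end_pos.
  move=> oq; apply/eqP => e; have [hk|nk] := boolP (is_head k false); last first.
    move: wh; rewrite e /fits step_symbol2 //.
    by rewrite -[(_ < _)%N]/(fits (plain k false) right_end) neg_right_end.
  have [b1 ek ec] := is_headE hk; move: e; rewrite ek ec step_symbol_head.
  rewrite -[q./2]/(h.+1.-1) -sw nth_last ew last_cat /= => el.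
  have := mem_last (plain (last_letter b) (last_sign b)) w2;
    rewrite el inE (negPf (hd_pt _ _)) /= => hw2.
  have : step_head b1 \in skeleton L w2 by rewrite mem_filter hd_letter.
  by rewrite s2 => /nseqP[e _]; have := hd_gap b1; rewrite e eqxx.
split=> //; exists (\row_k decode q step_symbol w k); last by move=> k _; rewrite mxE.
set x := \row_k _.
have xE k : everyone k -> x 0 k = decode q step_symbol w k by move=> _; rewrite mxE.
have [sx wx] := word_decode q_gt1 sI sO dw xE.
move: pw; rewrite -wx => /(path_word q_gt1 left_end_gap gap_right_end sB sx)[h0 hp' hh].
have [psh sgh] : pos (x 0 (head_letter b)) = p' /\ side (x 0 (head_letter b)) = head_sign b.
  move/eqP: np; rewrite -wx nth_word ?(ltnW ph) // -step_symbol_head content_sy //.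
  by case/andP => /eqP-> /eqP->.
have [psl sgl] : pos (x 0 (last_letter b)) = p'.+1 /\ side (x 0 (last_letter b)) = last_sign b.
  move/eqP: np1; rewrite -wx nth_word // -step_symbol_last content_sy //.
  by case/andP => /eqP-> /eqP->.
have step : avoid (x 0 i0) (x 0 j0) (~~ b0) && (x 0 i0 == signed b0 (x 0 j0) + 1).
  rewrite step_fold; move: psh sgh psl sgl nb; rewrite /barred /head_letter /last_letter.
  case: b {sk np np1} ew => ew -> -> -> ->; rewrite /= ?eqxx /= => nb.
    apply/orP; left; apply/negP => /eqP e; case/negP: nb.
    apply/orP; left; apply/startsP; exists w2.
    by rewrite ew (size0nil e).
  apply/orP; right; apply/implyP => /eqP eh; apply: contraR nb => oq.
  rewrite oq /=; apply/orP; right; apply/endsP; exists w1.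
  rewrite ew; have /size0nil -> // : size w2 = 0%N.
  move: sw eh; rewrite ew size_cat /= /p' /h; move: (size w1) (size w2) (q./2) => a c e.
  by clear; lia.
have head_pos k : is_head k (side (x 0 k)) -> pos (x 0 k) = p'.
  case/is_headE => b1 ek es; case: (b =P b1) => [eb|nb1]; first by rewrite ek -eb.
  have el : last_letter b = head_letter b1 by case: (b) (b1) nb1 => [] [].
  move: sgl; rewrite el -ek es => e2; exfalso.
  have : step_head b1 = plain (last_letter b) (last_sign b).
    by rewrite -step_symbol_head -step_symbol_last -el e2.
  by move/eqP; rewrite (negPf (hd_pt _ _)).
case/andP: step => otherx xij; rewrite inE /consecutive xij andbT; apply/and3P; split=> //.
- apply/forallP => k; rewrite ends_fit; apply/andP; split; apply/implyP => /eqP e.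
    by have := h0 k isT e; rewrite /fits step_symbol1.
  have := hh k isT e; rewrite /fits step_symbol2 //; apply/negP => /head_pos e2.
  by move: ph; rewrite -e2 e ltnn.
have pairs k l : others k -> k != l -> avoid_pair x k l.
  move=> ok kl; rewrite avoid_pairP //; apply/and3P; split.
  - by apply: contra kl => /eqP e; apply/eqP; apply: sx.
  - by apply/implyP => /eqP e; have := hp' k l isT isT e; rewrite sP // /fits step_symbol1.
  apply/implyP => /eqP e; have := hp' l k isT isT e; rewrite (sP k) // /fits step_symbol2 //.
  apply/negP => /head_pos e2.
  have ek : k = last_letter b by apply: sx => //; rewrite e e2 psl.
  by move: ok; have [_] := nothers b; rewrite ek => /negP.
apply/forallP => k; apply/forallP => l; apply/implyP => /andP[kl /orP[ok|ol]].
  exact: pairs.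
by rewrite avoid_pairC //; apply: pairs => //; rewrite eq_sym.
Qed.
End Pair.

(** * A coordinate with 2x = 0 or 2x = 1 *)
Section Double.
Variable i0 : 'I_m.
Hypothesis isC : typeC.

Definition double_free x :=
  [&& [forall k, (k != i0) ==> avoid (x 0 k) (x 0 k) false],
    [forall k, forall l, (k != l) ==> avoid_pair x k l]
    & ~~ avoid (x 0 i0) (x 0 i0) false].

Definition all_but := [pred k : 'I_m | k != i0].
Let L := letters all_but.
Let uL : uniq (ranks L). Proof. exact: uniq_ranks. Qed.
Let bL : {in ranks L, forall y, 0 < y < (2 * m).+2}%N.
Proof. exact: ranks_bound. Qed.

(** A value u with 2u = 0 or 2u = 1 stands at the first position with sign minus,
or at the last position, where its sign is forced by the parity of q. *)
Definition first_symbol := plain i0 false.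
Definition last_symbol := plain i0 (~~ odd q).

Lemma card_all_but : (#|all_but|.+1 = m)%N.
Proof.
rewrite -[RHS]card_ord -(cardC all_but) -addn1; congr (_ + _)%N.
by rewrite -(card1 i0); apply: eq_card => k; rewrite !inE negbK.
Qed.

(** The coordinate at the end of the word acts as the end of the remaining word. *)
Lemma card_double E : (h.+1 = m + E.+1)%N ->
  #|[set x | double_free x]| =
    (\prod_(ab <- letters all_but) room first_symbol right_end E.+1 ab +
     \prod_(ab <- letters all_but) room left_end last_symbol E.+1 ab)%N.
Proof.
move=> hE.
have m0 : (0 < m)%N by apply: leq_ltn_trans (ltn_ord i0).
have h0 : (0 < h)%N by move: hE m0; clear; lia.
have pinj k k' b b' : everyone k -> everyone k' -> plain k b = plain k' b' ->
  k = k' /\ b = b' by move=> _ _; apply: plain_inj.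
have pO k b : everyone k -> plain k b != gap by move=> _; apply: plain_gap.
have pB k b : everyone k -> fits (plain k b) gap && fits gap (plain k b).
  by move=> _; apply: plain_bounds.
have OO : fits gap gap by [].
have PD : subpred all_but everyone by [].
have sP k b : all_but k -> plain k b = solo (rank k b) by [].
have hs : (left_end.2 < (2 * m).+2)%N := left_end_gap.
have ht : (0 < right_end.1)%N := gap_right_end.
have hs1 b : ((plain i0 b).2 < (2 * m).+2)%N by have /andP[] := plain_bounds i0 b.
have ht1 b : (0 < (plain i0 b).1)%N by have /andP[] := plain_bounds i0 b.
have vld1 := @gaps_valid _ _ uL bL first_symbol E right_end (hs1 _) ht.
have vld2 := @gaps_valid _ _ uL bL left_end E last_symbol hs (ht1 _).
have nl b : ~~ letter L (plain i0 b).
  apply/letterP => -[k [b' [rk /plain_inj[e _]]]].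
  by move: rk; rewrite /= e eqxx.
have nn b : all (fun ab => ~~ carries ab (plain i0 b)) L.
  by apply/allP => ab abL; apply: contra (nl b) => n; apply/hasP; exists ab.
have allS b w' : all (fun ab => count (carries ab) (plain i0 b :: w') == 1%N) L =
    all (fun ab => count (carries ab) w' == 1%N) L.
  apply: eq_in_all => ab abL /=; have /allP/(_ ab abL) := nn b.
  by move=> /negPf->.
have allR b w' : all (fun ab => count (carries ab) (rcons w' (plain i0 b)) == 1%N) L =
    all (fun ab => count (carries ab) w' == 1%N) L.
  by rewrite -(allS b w'); apply: eq_all => ab; rewrite -cats1 count_cat addnC /= addn0.
pose W1 := [seq first_symbol :: w'
  | w' <- fillings first_symbol right_end [:: nseq E.+1 gap] L].
pose W2 := [seq rcons w' last_symbol
  | w' <- fillings left_end last_symbol [:: nseq E.+1 gap] L].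
have W1P w : reflect (exists w', [/\ w = first_symbol :: w',
    path fits first_symbol (rcons w' right_end), skeleton L w' = nseq E.+1 gap
    & all (fun ab => count (carries ab) w == 1%N) L]) (w \in W1).
  apply: (iffP mapP) => [[w']|[w' [-> pw sk aw]]].
    rewrite mem_fillings // inE => /and3P[pw /eqP sk aw] ->; exists w'; split=> //.
    by rewrite allS.
  by exists w' => //; rewrite mem_fillings // pw sk inE eqxx -(allS false).
have W2P w : reflect (exists w', [/\ w = rcons w' last_symbol,
    path fits left_end (rcons w' last_symbol), skeleton L w' = nseq E.+1 gap
    & all (fun ab => count (carries ab) w == 1%N) L]) (w \in W2).
  apply: (iffP mapP) => [[w']|[w' [-> pw sk aw]]].
    rewrite mem_fillings // inE => /and3P[pw /eqP sk aw] ->; exists w'; split=> //.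
    by rewrite allR.
  by exists w' => //; rewrite mem_fillings // pw sk inE eqxx -(allR (~~ odd q)).
have skS b w' : skeleton L (plain i0 b :: w') = plain i0 b :: skeleton L w'.
  by rewrite /skeleton /= nl.
have skR b w' : skeleton L (rcons w' (plain i0 b)) = rcons (skeleton L w') (plain i0 b).
  by rewrite /skeleton filter_rcons nl.
have sizeW w : size (skeleton L w) = E.+2 ->
    all (fun ab => count (carries ab) w == 1%N) L -> size w = h.+1.
  move=> sk aw; rewrite (size_gaps aw) sk hE.
  by move: card_all_but; move: #|_| => N; clear; lia.
have -> : (\prod_(ab <- letters all_but) room first_symbol right_end E.+1 ab +
     \prod_(ab <- letters all_but) room left_end last_symbol E.+1 ab)%N = size (W1 ++ W2).
  by rewrite size_cat !size_map -!(size_fillings_gaps uL bL).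
apply: (card_words q_gt1 pinj pO).
- rewrite cat_uniq map_inj_uniq ?uniq_fillings //; last by move=> ? ? [].
  rewrite map_inj_uniq ?uniq_fillings //; last by move=> w1 w2 /rcons_inj[].
  rewrite andbT /=; apply/hasPn => w /W2P[w' [ew _ sk _]].
  apply/W1P => -[w'' [ew' _ sk' _]]; move: ew; rewrite ew' => /(congr1 (skeleton L)).
  rewrite skS skR sk sk' => /(congr1 (head gap)) e; have := plain_gap i0 false.
  by rewrite -[plain _ _]/(head gap (first_symbol :: nseq E.+1 gap)) e eqxx.
- move=> x; rewrite inE => /and3P[/forallP selfx /forallP pairx doublex].
  have pairx' k l : k != l -> avoid_pair x k l.
    by move: (pairx k) => /forallP/(_ l)/implyP.
  have sx : spread everyone x.
    move=> k l _ _ e; apply/eqP/negPn/negP => kl.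
    by move: (pairx' k l kl); rewrite avoid_pairP // e eqxx.
  have aw := all_count_word q_gt1 PD sP pinj pO sx.
  have adj k l : everyone k -> everyone l -> pos (x 0 l) = (pos (x 0 k)).+1 ->
      fits (plain k (side (x 0 k))) (plain l (side (x 0 l))).
    move=> _ _ e; have kl := succ_neq e.
    by have := pairx' k l kl; rewrite avoid_pairP // e eqxx => /and3P[].
  have selfk k : k != i0 -> ((pos (x 0 k) == 0%N) ==> (left_end.2 < own_rank x k)%N) &&
      ((pos (x 0 k) == h) ==> (own_rank x k < right_end.1)%N).
    by move=> nk; rewrite -ends_fit isC; apply: (implyP (selfx k)).
  have other p : p != pos (x 0 i0) -> letter L (content everyone plain x p) \/
      content everyone plain x p = gap.
    move=> np; case: (contentP (erefl (content everyone plain x p))) => [->|[k _ [e ->]]].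
      by right.
    left; apply/letterP; exists k, (side (x 0 k)); split=> //.
    by apply: contra np => /eqP<-; rewrite e.
  have skw w' : all (fun ab => count (carries ab) w' == 1%N) L -> size w' = h ->
      {in w', forall u : symbol, letter L u \/ u = gap} -> skeleton L w' = nseq E.+1 gap.
    move=> aw' sw' gw'; rewrite (gaps_skeleton gw'); congr nseq.
    have := size_gaps aw'; rewrite sw'; move: hE card_all_but; rewrite -/L.
    by move: #|_| (size _) => N c; clear; lia.
  split=> //; rewrite mem_cat; move: doublex; rewrite avoid_self.
  have [e0 _|n0 /=] := eqVneq (pos (x 0 i0)) 0%N.
    have sg0 : side (x 0 i0) = false.
      have := canonical_fold q_gt1 (x 0 i0); rewrite e0 => /and3P[_ h1 _].
      by case: (side _) h1.
    apply/orP; left; apply/W1P; exists (map (content everyone plain x) (iota 1 h)).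
    have ew : word everyone plain x =
        first_symbol :: map (content everyone plain x) (iota 1 h).
      by rewrite /word /mkseq /= -e0 content_at // sg0.
    have : path fits gap (rcons (word everyone plain x) right_end).
      apply/(path_word q_gt1 OO gap_right_end pB sx); split=> //.
        by move=> k _ _; have /andP[] := plain_bounds k (side (x 0 k)).
      move=> k _ e; have nk : k != i0 by apply/eqP => ek; move: h0; rewrite /h -e ek e0.
      by have /andP[_] := selfk k nk; rewrite e eqxx.
    rewrite {1}ew /= => /andP[_ pw]; split=> //.
    apply: skw; first by rewrite -(allS false) -/first_symbol -ew.
      by rewrite size_map size_iota.
    move=> u /mapP[p]; rewrite mem_iota => /andP[p1 _] ->; apply: other.
    by rewrite e0 -lt0n.
  rewrite negb_and !negb_imply => hx; apply/orP; right.
  have [eh sgh] : pos (x 0 i0) = h /\ side (x 0 i0) = ~~ odd q.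
    have := canonical_fold q_gt1 (x 0 i0) => /and3P[_ _]; rewrite -/h.
    case/orP: hx => /andP[/eqP-> hx]; rewrite eqxx /= andbT => h1; split=> //.
      by rewrite hx; case: (side _) h1 => //= h1; rewrite h1 in hx.
    by move: h1; rewrite hx => /= ->; apply: negPf hx.
  apply/W2P; exists (mkseq (content everyone plain x) h).
  have ew : word everyone plain x = rcons (mkseq (content everyone plain x) h) last_symbol.
    rewrite /word mkseqS -/h; congr rcons; rewrite -[in LHS]eh content_at // sgh //.
  have : path fits left_end (rcons (word everyone plain x) gap).
    apply/(path_word q_gt1 left_end_gap OO pB sx); split=> //.
      move=> k _ e; have nk : k != i0 by apply/eqP => ek; move: n0; rewrite -ek e.
      by have /andP[] := selfk k nk; rewrite e eqxx.
    by move=> k _ _; have /andP[] := plain_bounds k (side (x 0 k)).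
  rewrite rcons_path {1}ew => /andP[pw _]; split=> //.
  apply: skw; first by rewrite -(allR (~~ odd q)) -/last_symbol -ew.
    by rewrite size_mkseq.
  move=> u /mapP[p]; rewrite mem_iota add0n => /andP[_ p1] ->; apply: other.
  by rewrite eh neq_ltn p1.
- by move=> x x' _ _ e; apply/rowP => k; apply: e.
have decP w : size w = h.+1 -> all (fun ab => count (carries ab) w == 1%N) L ->
    {in skeleton L w, forall u : symbol, u = gap \/ exists b, u = plain i0 b} ->
    count (fun u : symbol => (u == plain i0 true) || (u == plain i0 false))
      (skeleton L w) = 1%N ->
    (forall k, nth gap w 0 != plain k true) ->
    (~~ odd q -> forall k, nth gap w h != plain k false) ->
  decodable q everyone plain w.
  move=> sw aw mw cw n0 nh; apply: (fillings_decodable PD sP pinj sw aw) => //.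
  - by move=> u /mw[->|[b ->]]; [left|right; exists i0, b].
  - by move=> k _; rewrite negbK => /eqP->.
  by move=> k _; split=> // /nh.
have finish w (x : 'rV['Z_q]_m) : word everyone plain x = w -> spread everyone x ->
    (forall k l, pos (x 0 l) = (pos (x 0 k)).+1 -> (own_rank x k < own_rank x l)%N) ->
    (forall k, k != i0 -> pos (x 0 k) = 0%N -> (left_end.2 < own_rank x k)%N) ->
    (forall k, k != i0 -> pos (x 0 k) = h -> (own_rank x k < right_end.1)%N) ->
    ~~ avoid (x 0 i0) (x 0 i0) false -> double_free x.
  move=> wx sx hp hl hr dx; apply/and3P; split=> //.
    apply/forallP => k; apply/implyP => nk; have := ends_fit x k; rewrite isC /= => ->.
    by apply/andP; split; apply/implyP => /eqP; [apply: hl|apply: hr].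
  apply/forallP => k; apply/forallP => l; apply/implyP => kl; rewrite avoid_pairP //.
  apply/and3P; split.
  - by apply: contra kl => /eqP e; apply/eqP; apply: sx.
  - by apply/implyP => /eqP; apply: hp.
  by apply/implyP => /eqP; apply: hp.
move=> w; rewrite mem_cat => /orP[/W1P|/W2P] [w' [ew pw sk aw]].
  have sw : size w = h.+1 by apply: sizeW => //; rewrite ew skS /= sk size_nseq.
  have pw' : path fits gap (rcons w right_end).
    by rewrite ew /= pw andbT; have /andP[] := plain_bounds i0 false.
  have [_ wh _] := path_nth pw' sw.
  have dw : decodable q everyone plain w.
    apply: decP => //.
    - move=> u; rewrite ew skS sk inE => /orP[/eqP->|/nseqP[-> _]]; last by left.
      by right; exists false.
    - rewrite ew skS sk /= eqxx orbT count_nseq ![gap == _]eq_sym !(negPf (plain_gap _ _)).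
      by rewrite mul0n addn0.
    - by move=> k; rewrite ew; apply/negP => /eqP /plain_inj[].
    move=> oq k; apply/eqP => e; move: wh; rewrite e neg_right_end //.
  split=> //; exists (\row_k decode q plain w k); last by move=> k _; rewrite mxE.
  set x := \row_k _.
  have xE k : everyone k -> x 0 k = decode q plain w k by move=> _; rewrite mxE.
  have [sx wx] := word_decode q_gt1 pinj pO dw xE.
  move: pw'; rewrite -wx => /(path_word q_gt1 OO gap_right_end pB sx)[_ hp hh].
  have /eqP : nth gap w 0 = plain i0 false by rewrite ew.
  rewrite -wx nth_word // content_sy // => /andP[/eqP e0 /eqP s0].
  rewrite inE; apply: (finish _ _ wx sx).
  - by move=> k l; apply: hp.
  - by move=> k nk e; case/negP: nk; apply/eqP/sx => //; rewrite e0.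
  - by move=> k nk e; apply: hh.
  by rewrite avoid_self e0.
have sw : size w = h.+1 by apply: sizeW => //; rewrite ew skR size_rcons sk size_nseq.
have pw' : path fits left_end (rcons w gap).
  by rewrite rcons_path ew pw last_rcons /=; have /andP[] := plain_bounds i0 (~~ odd q).
have [w0 _ _] := path_nth pw' sw.
have nh : nth gap w h = last_symbol.
  by rewrite -[h]/(h.+1.-1) -sw nth_last ew last_rcons.
have dw : decodable q everyone plain w.
  apply: decP => //.
  - move=> u; rewrite ew skR sk mem_rcons inE => /orP[/eqP->|/nseqP[-> _]]; last by left.
    by right; exists (~~ odd q).
  - rewrite ew skR sk -cats1 count_cat /= count_nseq ![gap == _]eq_sym !(negPf (plain_gap _ _)).
    by rewrite mul0n /last_symbol; case: (odd q); rewrite eqxx ?orbT.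
  - by move=> k; apply/eqP => e; move: w0; rewrite e left_end_pos.
  by move=> oq k; rewrite nh /last_symbol oq; apply/negP => /eqP /plain_inj[].
split=> //; exists (\row_k decode q plain w k); last by move=> k _; rewrite mxE.
set x := \row_k _.
have xE k : everyone k -> x 0 k = decode q plain w k by move=> _; rewrite mxE.
have [sx wx] := word_decode q_gt1 pinj pO dw xE.
move: pw'; rewrite -wx => /(path_word q_gt1 left_end_gap OO pB sx)[hl hp _].
move/eqP: nh; rewrite -wx nth_word // content_sy // => /andP[/eqP eh /eqP s0].
rewrite inE; apply: (finish _ _ wx sx).
- by move=> k l; apply: hp.
- by move=> k nk e; apply: hl.
- by move=> k nk e; case/negP: nk; apply/eqP/sx => //; rewrite eh.
by rewrite avoid_self eh eqxx s0; case: (odd q); rewrite /= ?andbF.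
Qed.

End Double.
End Arrangement.

(** * Closed forms *)
Section Products.
Variable m : nat.
Local Open Scope nat_scope.

Lemma prod_const_nat (F : nat -> nat) (A l r : nat) :
  (forall k, l <= k < r -> F k = A) -> \prod_(l <= k < r) F k = A ^ (r - l).
Proof.
move=> h; rewrite (eq_big_nat _ _ h) prod_nat_const_nat //.
Qed.

Lemma prod_others (i j : 'I_m) (F : nat * nat -> nat) A B C : i < j ->
  (forall k : 'I_m, k < i -> F (rank k true, rank k false) = A) ->
  (forall k : 'I_m, i < k < j -> F (rank k true, rank k false) = B) ->
  (forall k : 'I_m, j < k -> F (rank k true, rank k false) = C) ->
  \prod_(ab <- letters (others i j)) F ab = A ^ i * B ^ (j - i.+1) * C ^ (m - j.+1).
Proof.
move=> ij hA hB hC; rewrite prod_letters.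
pose G k := if k < i then A else if k < j then B else C.
rewrite (eq_bigr (fun k : 'I_m => G k)); last first.
  move=> k /andP[]; rewrite -!val_eqE /G /= => ki kj.
  by case: ltnP => h1; [rewrite hA|case: ltnP => h2;
    [rewrite hB // ltn_neqAle eq_sym ki h1|rewrite hC // ltn_neqAle eq_sym kj h2]].
have jm := ltn_ord j.
rewrite -(big_mkord (fun k => (k != i :> nat) && (k != j :> nat)) G) big_mkcond /=.
rewrite (big_cat_nat (n := i)) ?(ltnW (ltn_ord i)) //=.
rewrite (big_ltn (m := i)) // eqxx /= mul1n.
rewrite (big_cat_nat (n := j) (m := i.+1)) ?(ltnW jm) //= (big_ltn (m := j)) // eqxx.
rewrite andbF mul1n.
rewrite (prod_const_nat (A := A) (l := 0)) ?(prod_const_nat (A := B) (l := i.+1))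
  ?(prod_const_nat (A := C) (l := j.+1)) ?subn0 ?mulnA //.
- move=> k /andP[h1 h2]; rewrite /G; have -> : (k != i :> nat) && (k != j :> nat) by lia.
  by have [-> ->] : (k < i) = false /\ (k < j) = false by lia.
- move=> k /andP[h1 h2]; rewrite /G; have -> : (k != i :> nat) && (k != j :> nat) by lia.
  by have [-> ->] : (k < i) = false /\ (k < j) by lia.
move=> k h2; rewrite /G; have -> : (k != i :> nat) && (k != j :> nat) by lia.
by have -> : (k < i) by lia.
Qed.

Lemma prod_all_but (i : 'I_m) (F : nat * nat -> nat) A C :
  (forall k : 'I_m, k < i -> F (rank k true, rank k false) = A) ->
  (forall k : 'I_m, i < k -> F (rank k true, rank k false) = C) ->
  \prod_(ab <- letters (all_but i)) F ab = A ^ i * C ^ (m - i.+1).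
Proof.
move=> hA hC; rewrite prod_letters.
pose G k := if k < i then A else C.
rewrite (eq_bigr (fun k : 'I_m => G k)); last first.
  move=> k; rewrite /= -!val_eqE /G /= => ki.
  by case: ltnP => h1; [rewrite hA|rewrite hC // ltn_neqAle eq_sym ki h1].
have im := ltn_ord i.
rewrite -(big_mkord (fun k => (k != i :> nat)) G) big_mkcond /=.
rewrite (big_cat_nat (n := i)) ?(ltnW im) //= (big_ltn (m := i)) // eqxx /= mul1n.
rewrite (prod_const_nat (A := A) (l := 0)) ?(prod_const_nat (A := C) (l := i.+1)) ?subn0 //.
- move=> k /andP[h1 h2]; rewrite /G; have -> : (k != i :> nat) by lia.
  by have -> : (k < i) = false by lia.
move=> k h2; rewrite /G; have -> : (k != i :> nat) by lia.
by have -> : (k < i) by lia.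
Qed.
End Products.

Section ClosedForms.
Variables (typeC : bool) (q m P : nat).
Hypothesis q_gt1 : (1 < q)%N.
Hypothesis P_def : (q + (if typeC then 0 else 2) = 2 * m + P)%N.
Hypothesis P_big : (7 < P)%N.
Local Open Scope nat_scope.

(** Each letter has P slots among gaps alone. *)
Lemma count_all : #|[set x : 'rV['Z_q]_m | all_avoid typeC x]| = P ^ m.
Proof.
pose E := q./2 - m.
have hE : (q./2).+1 = m + E.+1 by rewrite /E; case: typeC P_def; move: P_big; clear; lia.
rewrite (card_all_avoid typeC q_gt1 hE) (eq_bigr (fun _ => P)) ?prod_nat_const ?card_ord //.
move=> k _; have := ltn_ord k; have oq := odd_double_half q.
move: P_def P_big hE oq; rewrite /room /left_end /right_end /rank /E; clear.
case: typeC; case: (odd q) => /=; lia.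
Qed.

Lemma count_double (i : 'I_m) : typeC ->
  #|[set x : 'rV['Z_q]_m | double_free i x]| =
  if odd q then P.+1 ^ i * P ^ (m - i.+1) + P ^ i * P.+1 ^ (m - i.+1)
  else (P.+1 ^ i * P ^ (m - i.+1)).*2.
Proof.
move=> isC; pose E := q./2 - m.
have hE : (q./2).+1 = m + E.+1 by rewrite /E; case: typeC P_def; move: P_big; clear; lia.
have oq := odd_double_half q.
rewrite (card_double q_gt1 i isC hE) (prod_all_but (A := P.+1) (C := P)).
- rewrite (prod_all_but (A := if odd q then P else P.+1) (C := if odd q then P.+1 else P)).
  + by case: (odd q); rewrite // addnn.
  + move=> k ki; move: P_def P_big hE oq (ltn_ord i) ki; rewrite isC.
    rewrite /room /last_symbol /plain /solo /left_end /rank /E; clear.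
    by case: (odd q) => /=; lia.
  move=> k ki; move: P_def P_big hE oq (ltn_ord k) ki; rewrite isC.
  rewrite /room /last_symbol /plain /solo /left_end /rank /E; clear.
  by case: (odd q) => /=; lia.
- move=> k ki; move: P_def P_big hE oq (ltn_ord i) ki; rewrite isC.
  rewrite /room /first_symbol /plain /solo /right_end /rank /E; clear.
  by case: (odd q) => /=; lia.
move=> k ki; move: P_def P_big hE oq (ltn_ord k) ki; rewrite isC.
rewrite /room /first_symbol /plain /solo /right_end /rank /E; clear.
by case: (odd q) => /=; lia.
Qed.

Variables (i j : 'I_m) (b0 : bool).
Hypothesis lt_ij : i < j.

(** A letter of index below i has both its ranks outside the interval of the block, and
one between i and j has exactly one rank inside; for an index above j there are none
inside if b0 holds, and two otherwise. *)
Lemma count_coincide :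
  #|[set x : 'rV['Z_q]_m | coincide typeC i j b0 x]| +
    (if typeC then 0 else
     if b0 then P.+2 ^ i * P.+1 ^ (j - i.+1) * P.+1 ^ (m - j.+1) +
       (if odd q then P.+1 ^ i * P.+1 ^ (j - i.+1) * P.+2 ^ (m - j.+1)
        else P.+2 ^ i * P.+1 ^ (j - i.+1) * P.+1 ^ (m - j.+1))
     else if odd q then P.+1 ^ i * P.+1 ^ (j - i.+1) * P ^ (m - j.+1) else 0) =
  (if b0 then P.+2 else if odd q then P.+1 else if typeC then P.+2 else P) *
    (P.+2 ^ i * P.+1 ^ (j - i.+1) * (if b0 then P.+2 else P) ^ (m - j.+1)).
Proof.
pose E := q./2.+1 - m.
have hE : (q./2).+1 = m + E by rewrite /E; case: typeC P_def; move: P_big; clear; lia.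
have E0 : 0 < E by rewrite /E; case: typeC P_def; move: P_big; clear; lia.
have oq := odd_double_half q.
have := card_coincide typeC q_gt1 b0 lt_ij E0 hE.
have e1 b : fits (left_end typeC m) (merged i j b0 b) = [&& ~~ typeC, b0 & ~~ b].
  rewrite /fits /left_end /merged /rank; move: (ltn_ord j) lt_ij; clear.
  by case: typeC; case: b0; case: b => /=; lia.
have e2 b : fits (merged i j b0 b) (right_end typeC q m) =
    if typeC then [&& odd q, b0 & b] else odd q || b0 && b.
  rewrite /fits /right_end /merged /rank; move: (ltn_ord j) lt_ij; clear.
  by case: typeC; case: (odd q); case: b0; case: b => /=; lia.
have pF : \prod_(ab <- letters (others i j)) merged_room typeC q i j b0 E ab =
    P.+2 ^ i * P.+1 ^ (j - i.+1) * (if b0 then P.+2 else P) ^ (m - j.+1).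
  apply: prod_others => // k hk;
  move: P_def P_big hE oq lt_ij hk (ltn_ord k) (ltn_ord j);
  rewrite /merged_room /room /left_end /right_end /rank /E; clear.
  - case: typeC; case: b0; case: (odd q) => /=; lia.
  - case: typeC; case: b0; case: (odd q) => /=; lia.
  - case: typeC; case: b0; case: (odd q) => /=; lia.
have pS : ~~ typeC -> b0 ->
    \prod_(ab <- letters (others i j))
      room (merged i j b0 false) (right_end typeC q m) E.+1 ab =
    P.+2 ^ i * P.+1 ^ (j - i.+1) * P.+1 ^ (m - j.+1).
  move=> nC tb; apply: prod_others => // k hk;
  move: P_def P_big hE oq lt_ij hk (ltn_ord k) (ltn_ord j);
  rewrite (negPf nC) tb /room /merged /right_end /rank /E; clear.
  - case: (odd q) => /=; lia.
  - case: (odd q) => /=; lia.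
  - case: (odd q) => /=; lia.
have pT : ~~ typeC -> b0 -> ~~ odd q ->
    \prod_(ab <- letters (others i j)) room (left_end typeC m) (merged i j b0 true) E.+1 ab =
    P.+2 ^ i * P.+1 ^ (j - i.+1) * P.+1 ^ (m - j.+1).
  move=> nC tb od; apply: prod_others => // k hk;
  move: P_def P_big hE oq lt_ij hk (ltn_ord k) (ltn_ord j);
  rewrite (negPf nC) tb (negPf od) /room /merged /left_end /rank /E; clear => /=; lia.
have pT' : ~~ typeC -> odd q ->
    \prod_(ab <- letters (others i j)) room (left_end typeC m) (merged i j b0 false) E.+1 ab =
    P.+1 ^ i * P.+1 ^ (j - i.+1) * (if b0 then P.+2 else P) ^ (m - j.+1).
  move=> nC od; apply: prod_others => // k hk;
  move: P_def P_big hE oq lt_ij hk (ltn_ord k) (ltn_ord j);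
  rewrite (negPf nC) od /room /merged /left_end /rank /E; clear; case: b0 => /=; lia.
have coef : \sum_(b : bool) (fits (left_end typeC m) (merged i j b0 b) + E +
      fits (merged i j b0 b) (right_end typeC q m)) =
    (if b0 then P.+2 else if odd q then P.+1 else if typeC then P.+2 else P).
  rewrite big_bool !e1 !e2; move: P_def P_big hE oq; rewrite /E; clear.
  by case: typeC; case: b0; case: (odd q) => /=; lia.
rewrite coef pF => <-; congr (_ + _); rewrite big_bool !e1 !e2.
move: pS pT pT'; clear; case: typeC; case: b0; case: (odd q) => //= pS pT pT'.
- by rewrite pS // pT' // addnC.
- by rewrite pS // pT // addnC addn0.
- by rewrite pT'.
Qed.

Lemma count_consecutive :
  #|[set x : 'rV['Z_q]_m | consecutive typeC i j b0 x]| +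
    (if typeC || b0 then 0 else
     (if odd q then 1 else 2) * (P ^ i * P.+1 ^ (j - i.+1) * P.+1 ^ (m - j.+1))) =
  (if b0 then P else if odd q then P.+1 else if typeC then P else P.+2) *
    (P ^ i * P.+1 ^ (j - i.+1) * (if b0 then P else P.+2) ^ (m - j.+1)).
Proof.
pose E := q./2 - m.
have hE : (q./2).+1 = m + E.+1 by rewrite /E; case: typeC P_def; move: P_big; clear; lia.
have oq := odd_double_half q.
have := card_consecutive typeC q_gt1 b0 lt_ij hE.
have e1 b : fits (left_end typeC m) (step_head i j b0 b) = ~~ typeC && ~~ (b0 && b).
  rewrite /fits /left_end /step_head /head_letter /head_sign /rank.
  move: (ltn_ord j) (ltn_ord i) lt_ij; clear.
  by case: typeC; case: b0; case: b => /=; lia.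
have e2 b : fits (plain (last_letter i j b) (last_sign b0 b)) (right_end typeC q m) =
    if typeC then odd q && ~~ (b0 && ~~ b) else odd q || ~~ (b0 && ~~ b).
  rewrite /fits /right_end /plain /last_letter /last_sign /rank.
  move: (ltn_ord j) (ltn_ord i) lt_ij; clear.
  by case: typeC; case: (odd q); case: b0; case: b => /=; lia.
have pF : \prod_(ab <- letters (others i j)) step_room typeC q i j b0 E ab =
    P ^ i * P.+1 ^ (j - i.+1) * (if b0 then P else P.+2) ^ (m - j.+1).
  apply: prod_others => // k hk;
  move: P_def P_big hE oq lt_ij hk (ltn_ord k) (ltn_ord j);
  rewrite /step_room /room /left_end /right_end /rank /E; clear.
  - case: typeC; case: b0; case: (odd q) => /=; lia.
  - case: typeC; case: b0; case: (odd q) => /=; lia.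
  - case: typeC; case: b0; case: (odd q) => /=; lia.
have pS : ~~ typeC -> ~~ b0 ->
    \prod_(ab <- letters (others i j)) room (plain (last_letter i j true) (last_sign b0 true))
      (right_end typeC q m) E.+1 ab =
    P ^ i * P.+1 ^ (j - i.+1) * P.+1 ^ (m - j.+1).
  move=> nC tb; apply: prod_others => // k hk;
  move: P_def P_big hE oq lt_ij hk (ltn_ord k) (ltn_ord j);
  rewrite (negPf nC) (negPf tb) /room /plain /last_letter /last_sign /right_end /rank
    /E; clear;
  case: (odd q) => /=; lia.
have pT : ~~ typeC -> ~~ b0 -> ~~ odd q ->
    \prod_(ab <- letters (others i j))
      room (left_end typeC m) (step_head i j b0 false) E.+1 ab =
    P ^ i * P.+1 ^ (j - i.+1) * P.+1 ^ (m - j.+1).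
  move=> nC tb od; apply: prod_others => // k hk;
  move: P_def P_big hE oq lt_ij hk (ltn_ord k) (ltn_ord j);
  rewrite (negPf nC) (negPf tb) (negPf od) /room /step_head /head_letter /head_sign
    /left_end /rank /E; clear => /=; lia.
have coef : \sum_(b : bool) (fits (left_end typeC m) (step_head i j b0 b) + E +
      fits (plain (last_letter i j b) (last_sign b0 b)) (right_end typeC q m)) =
    (if b0 then P else if odd q then P.+1 else if typeC then P else P.+2).
  rewrite big_bool !e1 !e2; move: P_def P_big hE oq; rewrite /E; clear.
  by case: typeC; case: b0; case: (odd q) => /=; lia.
rewrite coef pF => <-; congr (_ + _); rewrite big_bool !e1 !e2.
move: pS pT; clear; case: typeC; case: b0; case: (odd q) => //= pS pT.
- by rewrite pS // mul1n !addn0.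
- by rewrite pS // pT // mul2n addn0 addnn.
Qed.
End ClosedForms.

(** * Hyperplanes and deletions *)
Lemma in_fset4 (K : choiceType) (a b c d x : K) :
  (x \in [fset a; b; c; d]%fset) = [|| x == a, x == b, x == c | x == d].
Proof. by rewrite !inE -!orbA. Qed.

Lemma in_fset2E (K : choiceType) (a b x : K) :
  (x \in [fset a; b]%fset) = (x == a) || (x == b).
Proof. by rewrite !inE. Qed.

Section Hyperplanes.
Variable m : nat.
Implicit Types (i j k l : 'I_m) (b : bool).

Definition form i j b : 'rV[int]_m := if b then 'x_i - 'x_j else 'x_i + 'x_j.
Definition listed (typeC : bool) i j b := (i < j)%N || [&& typeC, i == j & ~~ b].
Definition shi (typeC : bool) : {fset hyperplane m} := if typeC then shi_C m else shi_D m.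

Lemma formE i j b k : form i j b 0 k = (k == i)%:R + (if b then -1 else 1) * (k == j)%:R.
Proof. by rewrite /form; case: b; rewrite !mxE /= ?mulN1r ?mul1r. Qed.

Lemma form_double i : form i i false = 'x_i *+ 2.
Proof. by rewrite mulr2n. Qed.

Definition level (e : bool) : int := if e then 1 else 0.

Lemma shi_DP (H : hyperplane m) : reflect
  (exists i j b e, (i < j)%N /\ H = (form i j b, level e)) (H \in shi_D m).
Proof.
apply: (iffP (bigfcupP _ _ _ _)) => [[[i j] /= /andP[_ ij]]|[i [j [b [e [ij ->]]]]]].
  rewrite in_fset4 => /or4P[] /eqP->; exists i, j.
  - by exists true, false.
  - by exists true, true.
  - by exists false, false.
  by exists false, true.
exists (i, j); first by rewrite mem_index_enum.
rewrite in_fset4; apply/or4P; rewrite /form /level.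
by case: b e => [] []; [constructor 2|constructor 1|constructor 4|constructor 3]; apply: eqxx.
Qed.

Lemma shiP typeC (H : hyperplane m) : reflect
  (exists i j b e, listed typeC i j b /\ H = (form i j b, level e)) (H \in shi typeC).
Proof.
rewrite /shi /listed; case: typeC => /=; last first.
  apply: (iffP (shi_DP H)) => -[i [j [b [e [ij eH]]]]]; exists i, j, b, e; split=> //.
    by rewrite ij.
  by rewrite orbF in ij.
rewrite in_fsetU; apply: (iffP orP) => [[/bigfcupP[i _]|/shi_DP]|].
- rewrite in_fset2E => /orP[]/eqP->; exists i, i, false;
    [exists false|exists true]; by rewrite form_double eqxx orbT.
- by case=> i [j [b [e [ij ->]]]]; exists i, j, b, e; rewrite ij.
case=> i [j [b [e [/orP[ij|/andP[/eqP<- /negPf->]] ->]]]].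
  by right; apply/shi_DP; exists i, j, b, e.
left; apply/bigfcupP; exists i; first by rewrite mem_index_enum.
rewrite form_double in_fset2E /level; apply/orP.
by case: e; [right|left]; apply: eqxx.
Qed.

(** Proportional forms have the same support, which gives the indices; the signs
agree because the first coefficient is positive. *)
Lemma form_prop typeC i j b i' j' b' : listed typeC i j b -> listed typeC i' j' b' ->
    (forall k l, form i' j' b' 0 l * form i j b 0 k = form i' j' b' 0 k * form i j b 0 l) ->
  [/\ i = i', j = j' & b = b'].
Proof.
have neq0 i1 j1 b1 k : listed typeC i1 j1 b1 ->
    (form i1 j1 b1 0 k == 0) = (k != i1) && (k != j1).
  rewrite formE /listed; have [->|nk] /= := eqVneq k i1; last first.
    by rewrite add0r; have [_|_] := eqVneq k j1; case: b1.
  have [<-|nij] := eqVneq i1 j1; last by rewrite mulr0.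
  by rewrite ltnn => /and3P[_ _ /negPf->].
have supp : forall i1 j1 b1 i2 j2 b2, listed typeC i1 j1 b1 -> listed typeC i2 j2 b2 ->
    (forall k l, form i2 j2 b2 0 l * form i1 j1 b1 0 k =
                 form i2 j2 b2 0 k * form i1 j1 b1 0 l) ->
    forall l, (l == i2) || (l == j2) -> (l == i1) || (l == j1).
  move=> i1 j1 b1 i2 j2 b2.
  move=> h1 h2 h l; rewrite -[_ || _]negbK negb_or -(neq0 _ _ _ _ h2) => n2.
  rewrite -[_ || _]negbK negb_or -(neq0 _ _ _ _ h1); apply/negP => /eqP e.
  have := h i1 l; rewrite e mulr0 => /eqP; rewrite mulf_eq0 (negPf n2) /=.
  by rewrite (neq0 _ _ _ _ h1) eqxx.
move=> h1 h2 h.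
have s1 := supp _ _ _ _ _ _ h1 h2 h.
have h' k l : form i j b 0 l * form i' j' b' 0 k = form i j b 0 k * form i' j' b' 0 l.
  by rewrite mulrC -h mulrC.
have s2 := supp _ _ _ _ _ _ h2 h1 h'.
have le i1 j1 b1 : listed typeC i1 j1 b1 -> (i1 <= j1)%N.
  by case/orP => [/ltnW //|/and3P[_ /eqP-> _]].
have l1 := le _ _ _ h1; have l2 := le _ _ _ h2.
have ei : i = i'.
  have := s1 i'; rewrite eqxx => /(_ isT); have := s2 i; rewrite eqxx => /(_ isT).
  by rewrite -!val_eqE => /= *; apply: val_inj => /=; lia.
subst i'; have ej : j = j'.
  have := s1 j'; rewrite eqxx orbT => /(_ isT); have := s2 j; rewrite eqxx orbT => /(_ isT).
  by rewrite -!val_eqE => /= *; apply: val_inj => /=; lia.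
subst j'; split=> //; move: h1 h2; rewrite /listed.
have [ij _ _|_ /= /and3P[_ _ /negPf->] /and3P[_ _ /negPf->] //] := ltnP i j.
have := h i j; rewrite !formE !eqxx.
have -> : (j == i) = false by rewrite -val_eqE /=; lia.
have -> : (i == j) = false by rewrite -val_eqE /=; lia.
by case: (b) (b') => [] [].
Qed.

Lemma sum_form (S : nzRingType) (a : 'rV[int]_m) (x : 'rV[S]_m) i j b : a = form i j b ->
  \sum_(k < m) (a 0 k)%:~R * x 0 k = x 0 i + (if b then - x 0 j else x 0 j).
Proof.
move=> ->; have single l : \sum_(k < m) ((k == l)%:R : int)%:~R * x 0 k = x 0 l.
  rewrite (bigD1 l) //= eqxx mul1r big1 ?addr0 // => k /negPf->.
  by rewrite mul0r.
under eq_bigr => k _ do rewrite formE intrD mulrDl intrM -mulrA.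
rewrite big_split /= single -mulr_sumr single; case: b; first by rewrite mulN1r.
by rewrite mul1r.
Qed.

Lemma on_form (S : nzRingType) (x : 'rV[S]_m) i j b e :
  on_hyperplane (form i j b, level e) x =
    (x 0 i + (if b then - x 0 j else x 0 j) == e%:R).
Proof.
by rewrite /on_hyperplane /= (sum_form x (erefl _)) /level; case: e.
Qed.

(** A translation that maps one hyperplane to the other preserves directions, so
both linear parts a and a' vanish on the vectors a_k e_l - a_l e_k; this makes them
proportional. *)
Lemma parallel_form (R : realType) typeC i j b e i' j' b' e' :
    listed typeC i j b -> listed typeC i' j' b' ->
    parallel R (form i j b, level e) (form i' j' b', level e') ->
  [/\ i = i', j = j' & b = b'].
Proof.
move=> h1 h2 [v hv]; apply: (form_prop h1 h2) => k l.
pose lin (a : 'rV[int]_m) (x : 'rV[R]_m) := \sum_(k < m) (a 0 k)%:~R * x 0 k.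
have linD a x y : lin a (x + y) = lin a x + lin a y.
  by rewrite /lin -big_split /=; apply: eq_bigr => k' _; rewrite mxE mulrDr.
have linZ a c x : lin a (c *: x) = c * lin a x.
  by rewrite /lin mulr_sumr; apply: eq_bigr => k' _; rewrite mxE mulrCA.
have linB a k' : lin a (delta_mx 0 k') = (a 0 k')%:~R.
  rewrite /lin (bigD1 k') //= mxE !eqxx mulr1 big1 ?addr0 // => k1 nk.
  by rewrite mxE (negPf nk) andbF mulr0.
set a := form i j b in hv *; set a' := form i' j' b' in hv *.
have hv' x : (lin a x == (level e)%:~R) = (lin a' (x + v) == (level e')%:~R) by apply: hv.
have ai : (a 0 i)%:~R != 0 :> R.
  rewrite intr_eq0 /a formE eqxx; case/orP: h1 => [ij|/and3P[_ /eqP<- /negPf->]].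
    have -> : (i == j) = false by rewrite -val_eqE /=; lia.
    by rewrite mulr0.
  by rewrite eqxx.
pose x0 : 'rV[R]_m := ((level e)%:~R / (a 0 i)%:~R) *: delta_mx 0 i.
have x0a : lin a x0 = (level e)%:~R by rewrite linZ linB divfK.
have x0a' : lin a' (x0 + v) = (level e')%:~R by apply/eqP; rewrite -hv' x0a.
have key d : lin a d = 0 -> lin a' d = 0.
  move=> ad; have : lin a (x0 + d) == (level e)%:~R by rewrite linD ad addr0 x0a.
  by rewrite hv' addrAC linD x0a' -subr_eq0 addrC addKr => /eqP.
have := key ((a 0 k)%:~R *: delta_mx 0 l - (a 0 l)%:~R *: delta_mx 0 k).
rewrite -!scaleNr !linD !linZ !linB.
rewrite !mulNr [X in X - _]mulrC subrr => /(_ erefl)/eqP; rewrite subr_eq0.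
rewrite -!intrM eqr_int => /eqP e1.
by rewrite mulrC e1 mulrC.
Qed.
End Hyperplanes.

Import Order.TTheory Num.Theory.
Section Complement.
Variables (typeC : bool) (q m : nat) (i0 j0 : 'I_m) (b0 : bool).
Hypothesis q_gt1 : (1 < q)%N.
Hypothesis listed0 : listed typeC i0 j0 b0.
Implicit Types (x : 'rV['Z_q]_m) (i j : 'I_m) (b : bool).

Definition deletion : {fset hyperplane m} :=
  (shi m typeC `\` [fset (form i0 j0 b0, 0); (form i0 j0 b0, 1)])%fset.

Lemma form_inj i j b i' j' b' : listed typeC i j b -> listed typeC i' j' b' ->
  form i j b = form i' j' b' -> [/\ i = i', j = j' & b = b'].
Proof. by move=> h1 h2 e; apply: (form_prop h1 h2) => k l; rewrite e mulrC. Qed.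

Lemma avoid_on x i j b : avoid (x 0 i) (x 0 j) b =
  ~~ on_hyperplane (form i j b, 0) x && ~~ on_hyperplane (form i j b, 1) x.
Proof.
rewrite (on_form x i j b false) (on_form x i j b true) /avoid.
have -> : x 0 i + (if b then - x 0 j else x 0 j) = x 0 i - signed b (x 0 j).
  by rewrite /signed; case: b; rewrite ?opprK.
by rewrite subr_eq0 subr_eq [1%:R + _]addrC.
Qed.

Lemma complementP x : reflect
  (forall i j b, listed typeC i j b -> [&& i == i0, j == j0 & b == b0] = false ->
     avoid (x 0 i) (x 0 j) b)
  (x \in complement_mod deletion q).
Proof.
rewrite inE; apply: (iffP forallP) => [h i j b lij ne|h [H HA] /=].
  have inA e : (form i j b, level e) \in deletion.
    rewrite in_fsetD; apply/andP; split; last by apply/shiP; exists i, j, b, e.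
    rewrite in_fset2E !xpair_eqE -andb_orr negb_and; apply/orP; left.
    apply/negP => /eqP /(form_inj lij listed0)[ei ej eb].
    by rewrite ei ej eb !eqxx in ne.
  rewrite avoid_on; apply/andP; split.
    exact: (h [` inA false]%fset).
  exact: (h [` inA true]%fset).
move: HA; rewrite in_fsetD in_fset2E => /andP[ne /shiP[i [j [b [e [lij eH]]]]]].
have nij : [&& i == i0, j == j0 & b == b0] = false.
  apply/negP => /and3P[/eqP ei /eqP ej /eqP eb]; move: ne; rewrite eH ei ej eb /level.
  by case: (e); rewrite eqxx ?orbT.
have := h i j b lij nij; rewrite avoid_on eH => /andP[h1 h2].
by rewrite /level; case: (e).
Qed.

Lemma all_avoidP x : reflect (forall i j b, listed typeC i j b -> avoid (x 0 i) (x 0 j) b)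
  (all_avoid typeC x).
Proof.
apply: (iffP andP) => [[/forallP hs /forallP hp] i j b|h].
  case/orP=> [ij|/and3P[tC /eqP<- /negPf->]]; last by have := hs i; rewrite tC.
  have /forallP/(_ j)/implyP := hp i; rewrite /avoid_pair ij.
  have nij : i != j by rewrite -val_eqE /=; lia.
  by move=> /(_ nij)/andP[]; case: b.
have hp i j : (i < j)%N -> avoid (x 0 i) (x 0 j) true && avoid (x 0 i) (x 0 j) false.
  by move=> ij; rewrite !h // /listed ij.
split.
  by apply/forallP => k; apply/implyP => tC; apply: h; rewrite /listed tC eqxx orbT.
apply/forallP => k; apply/forallP => l; apply/implyP; rewrite -val_eqE /avoid_pair => nkl.
by case: ltnP => kl; apply: hp => //; move: nkl kl => /=; lia.
Qed.

Lemma avoid_othersP x : (i0 < j0)%N -> reflect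
  (forall i j b, listed typeC i j b -> [&& i == i0, j == j0 & b == b0] = false ->
     avoid (x 0 i) (x 0 j) b)
  (avoid_others typeC i0 j0 b0 x).
Proof.
move=> lt0; apply: (iffP and3P) => [[/forallP hs /forallP hp ho] i j b|h].
  case/orP=> [ij|/and3P[tC /eqP<- /negPf->]]; last by have := hs i; rewrite tC.
  move=> ne; have [o|] := boolP (others i0 j0 i || others i0 j0 j).
    have /forallP/(_ j)/implyP := hp i; rewrite o andbT /avoid_pair ij.
    have nij : i != j by rewrite -val_eqE /=; lia.
    by move=> /(_ nij)/andP[]; case: b {ne}.
  rewrite negb_or !negb_and !negbK => /andP[oi oj].
  have [ei ej] : i = i0 /\ j = j0.
    by case/orP: oi ij => /eqP->; case/orP: oj => /eqP-> //; rewrite ?ltnn // => lt1;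
      have := ltn_trans lt0 lt1; rewrite ltnn.
  move: ne; rewrite ei ej !eqxx /= => nb.
  by have -> : b = ~~ b0 by move: nb; case: (b) (b0) => [] [].
have hp i j : (i < j)%N -> others i0 j0 i || others i0 j0 j ->
    avoid (x 0 i) (x 0 j) true && avoid (x 0 i) (x 0 j) false.
  move=> ij o; rewrite !h // /listed ?ij //; apply/negP => /and3P[/eqP ei /eqP ej _];
  by move: o; rewrite ei ej /= !eqxx ?andbF.
split.
- apply/forallP => k; apply/implyP => tC; apply: h; first by rewrite /listed tC eqxx orbT.
  by apply/negP => /and3P[/eqP-> /eqP e _]; move: lt0; rewrite e ltnn.
- apply/forallP => k; apply/forallP => l; apply/implyP => /andP[nkl o].
  rewrite /avoid_pair; case: ltnP => kl; apply: hp => //; last by rewrite orbC.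
  by move: nkl kl; rewrite -val_eqE /=; lia.
apply: h; first by rewrite /listed lt0.
by case: b0; rewrite !andbF.
Qed.

Lemma all_avoid_others x : (i0 < j0)%N ->
  all_avoid typeC x = avoid_others typeC i0 j0 b0 x && avoid (x 0 i0) (x 0 j0) b0.
Proof.
move=> lt0; apply/all_avoidP/andP => [h|[/(avoid_othersP x lt0) h h0] i j b lij].
  by split; [apply/avoid_othersP => // i j b lij _; apply: h | apply: h].
case ne : [&& i == i0, j == j0 & b == b0]; last exact: h.
by case/and3P: ne => /eqP-> /eqP-> /eqP->.
Qed.

(** A point off the remaining hyperplanes is off all hyperplanes or on exactly one of
the two deleted ones. *)
Lemma card_deletion_pair : (i0 < j0)%N ->
  #|complement_mod deletion q| = (#|[set x : 'rV['Z_q]_m | all_avoid typeC x]| +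
     (#|[set x : 'rV['Z_q]_m | coincide typeC i0 j0 b0 x]| +
      #|[set x : 'rV['Z_q]_m | consecutive typeC i0 j0 b0 x]|))%N.
Proof.
move=> lt0; set N := [set x | _]; set A := [set x | _]; set B := [set x | _].
have dAB : A :&: B = set0.
  apply/setP => x; rewrite !inE /coincide /consecutive.
  apply/negP => /andP[/andP[_ /eqP->] /andP[_ /eqP]].
  by move/eqP; rewrite -subr_eq0 opprD addNKr oppr_eq0 oner_eq0.
have dN : N :&: (A :|: B) = set0.
  apply/setP => x; rewrite !inE all_avoid_others // /coincide /consecutive /avoid.
  by case: avoid_others; case: eqP; case: eqP.
have -> : complement_mod deletion q = N :|: (A :|: B).
  apply/setP => x; rewrite !in_setU !in_set all_avoid_others // /coincide /consecutive /avoid.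
  have -> : [forall H : deletion, ~~ on_hyperplane (val H) x] = avoid_others typeC i0 j0 b0 x.
    have := complementP x; rewrite [_ \in complement_mod _ _]inE => e.
    exact/e/avoid_othersP.
  by case: avoid_others; case: eqP; case: eqP.
by rewrite cardsU dN cards0 subn0 cardsU dAB cards0 subn0.
Qed.

Lemma card_deletion_double : i0 = j0 ->
  #|complement_mod deletion q| = (#|[set x : 'rV['Z_q]_m | all_avoid typeC x]| +
     #|[set x : 'rV['Z_q]_m | double_free i0 x]|)%N.
Proof.
move=> e0; have [tC /negPf eb] : typeC /\ ~~ b0.
  by move: listed0; rewrite /listed e0 ltnn eqxx => /andP[].
set N := [set x | _]; set A := [set x | _].
have dNA : N :&: A = set0.
  apply/setP => x; rewrite !inE; apply/negP => /andP[/all_avoidP h /and3P[_ _ /negP]]; apply.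
  by apply: h; rewrite /listed tC eqxx orbT.
have -> : complement_mod deletion q = N :|: A; last by rewrite cardsU dNA cards0 subn0.
apply/setP => x; rewrite in_setU [x \in N]in_set [x \in A]in_set.
apply/complementP/orP => [h|].
  case h0 : (avoid (x 0 i0) (x 0 i0) false).
    left; apply/all_avoidP => i j b lij.
    case ne : [&& i == i0, j == j0 & b == b0]; last exact: h.
    by case/and3P: ne => /eqP-> /eqP-> /eqP->; rewrite -e0 eb.
  right; apply/and3P; split; last by rewrite h0.
    apply/forallP => k; apply/implyP => nk; apply: h; first by rewrite /listed tC eqxx orbT.
    by rewrite (negPf nk).
  have hp i j : (i < j)%N -> avoid (x 0 i) (x 0 j) true && avoid (x 0 i) (x 0 j) false.
    move=> ij; rewrite !h // /listed ?ij //; apply/negP => /and3P[/eqP ei /eqP ej _];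
    by move: ij; rewrite ei ej e0 ltnn.
  apply/forallP => k; apply/forallP => l; apply/implyP; rewrite -val_eqE /avoid_pair => nkl.
  by case: ltnP => kl; apply: hp => //; move: nkl kl => /=; lia.
move=> h i j b lij ne; case: h => [/all_avoidP h|/and3P[/forallP hs /forallP hp _]];
  first exact: h.
case/orP: lij => [ij|/and3P[_ /eqP ej /negPf ebb]].
  have /forallP/(_ j)/implyP := hp i; rewrite /avoid_pair ij.
  have nij : i != j by rewrite -val_eqE /=; lia.
  by move=> /(_ nij)/andP[]; case: b {ne}.
move: ne; rewrite -ej ebb eb -e0 eqxx andbT andbb => /negbT ne.
by have /implyP := hs i; apply.
Qed.
End Complement.

(** * Comparison of the two parities *)
Section Polynomials.
Variables (R : comNzRingType) (typeC b0 o : bool) (a d c : nat) (p : R).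

(** Here p stands for P, the numbers a, d, c are those of the coordinates before,
between and after the two indices of the block, and o is the parity of q. *)
Definition coincide_poly : R :=
  (if b0 then p + 2 else if o then p + 1 else if typeC then p + 2 else p) *
    ((p + 2) ^+ a * (p + 1) ^+ d * (if b0 then p + 2 else p) ^+ c)
  - (if typeC then 0 else
     if b0 then (p + 2) ^+ a * (p + 1) ^+ d * (p + 1) ^+ c +
       (if o then (p + 1) ^+ a * (p + 1) ^+ d * (p + 2) ^+ c
        else (p + 2) ^+ a * (p + 1) ^+ d * (p + 1) ^+ c)
     else if o then (p + 1) ^+ a * (p + 1) ^+ d * p ^+ c else 0).

Definition consecutive_poly : R :=
  (if b0 then p else if o then p + 1 else if typeC then p else p + 2) *
    (p ^+ a * (p + 1) ^+ d * (if b0 then p else p + 2) ^+ c)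
  - (if typeC || b0 then 0 else
     (if o then 1 else 2) * (p ^+ a * (p + 1) ^+ d * (p + 1) ^+ c)).

Definition double_poly : R :=
  if o then (p + 1) ^+ a * p ^+ c + p ^+ a * (p + 1) ^+ c
  else ((p + 1) ^+ a * p ^+ c) *+ 2.

Definition deletion_poly (diag : bool) m : R :=
  p ^+ m + (if diag then double_poly else coincide_poly + consecutive_poly).
End Polynomials.

Lemma rmorph_deletion_poly (R S : comNzRingType) (phi : {rmorphism R -> S})
    typeC b0 o a d c diag m p :
  phi (deletion_poly typeC b0 o a d c p diag m) =
  deletion_poly typeC b0 o a d c (phi p) diag m.
Proof.
have p1 : phi (p + 1) = phi p + 1 by rewrite rmorphD rmorph1.
have p2 : phi (p + 2) = phi p + 2 by rewrite rmorphD rmorph_nat.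
rewrite /deletion_poly rmorphD rmorphXn; congr (_ + _); case: diag.
  rewrite /double_poly -p1; case: o; first by rewrite rmorphD !rmorphM !rmorphXn.
  by rewrite rmorphMn rmorphM !rmorphXn.
rewrite rmorphD /coincide_poly /consecutive_poly -p1 -p2.
congr (_ + _); rewrite rmorphB; congr (_ - _).
- by case: typeC; case: b0; case: o; rewrite !rmorphM !rmorphXn.
- by case: typeC; case: b0; case: o;
  rewrite ?rmorph0 // ?[phi (_ * _ + _)]rmorphD !rmorphM !rmorphXn.
- by case: typeC; case: b0; case: o; rewrite !rmorphM !rmorphXn.
by case: typeC; case: b0; case: o; rewrite ?rmorph0 // !rmorphM !rmorphXn ?rmorph1 ?rmorph_nat.
Qed.

(** A nonzero polynomial has finitely many roots, and each parity class is
infinite. *)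
Lemma poly_eq_parity (f g : {poly rat}) (o : bool) N :
  (forall n, (N <= n)%N -> odd n = o -> f.[n%:R] = g.[n%:R]) -> f = g.
Proof.
move=> h; apply/eqP; rewrite -subr_eq0; apply/negPn/negP => nz.
pose s := [seq ((N + k).*2 + o)%:R : rat | k <- iota 0 (size (f - g))].
have : (size s < size (f - g)%R)%N; last by rewrite size_map size_iota ltnn.
apply: max_poly_roots => //.
  apply/allP => _ /mapP[k _ ->]; rewrite rootE hornerD hornerN subr_eq0; apply/eqP.
  by apply: h; [lia | rewrite oddD odd_double; case: (o)].
rewrite map_inj_uniq ?iota_uniq // => k l /eqP; rewrite eqr_nat => /eqP; lia.
Qed.

Lemma deletion_poly_balanced (R : comNzRingType) typeC b0 o a d c diag m (p : R) :
  (~~ diag && typeC && b0) || (a == c) ->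
  deletion_poly typeC b0 o a d c p diag m = deletion_poly typeC b0 true a d c p diag m.
Proof.
rewrite /deletion_poly /double_poly /coincide_poly /consecutive_poly => h; congr (_ + _).
case: diag h => /= [/eqP->|]; first by case: o; rewrite // [_ * p ^+ _]mulrC mulr2n.
case: o => //; case: typeC; case: b0 => //= /eqP->; ring.
Qed.

Lemma exp_diff_inj a c : (3 ^ a + 2 ^ c = 3 ^ c + 2 ^ a)%N -> a = c.
Proof.
have le k : (2 ^ k <= 3 ^ k)%N by elim: k => // k IH; rewrite !expnS; lia.
have lt k l : (k < l)%N -> (3 ^ k + 2 ^ l < 3 ^ l + 2 ^ k)%N.
  elim: l => // l IH; rewrite ltnS leq_eqVlt => /orP[/eqP->|/IH].
    by rewrite !expnS; have := le l; have := expn_gt0 3 l; lia.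
  by rewrite !expnS; have := le l; lia.
by case: (ltngtP a c) => // /lt; lia.
Qed.

Lemma exp_ratio_inj a c : (3 ^ a * 2 ^ c = 3 ^ c * 2 ^ a)%N -> a = c.
Proof.
have lt k n : (3 ^ k * 2 ^ (k + n.+1) < 3 ^ (k + n.+1) * 2 ^ k)%N.
  have pow : (2 ^ n.+1 < 3 ^ n.+1)%N by rewrite ltn_exp2r.
  rewrite !expnD mulnCA mulnA [(_ * 2 ^ k)%N]mulnC mulnA ltn_mul2l pow andbT.
  by rewrite muln_gt0 !expn_gt0.
case: (ltngtP a c) => // ac e.
  by have := lt a (c - a.+1)%N; rewrite -addSnnS subnKC // e ltnn.
by have := lt c (a - c.+1)%N; rewrite -addSnnS subnKC // -e ltnn.
Qed.

(** At p = 1 all factors are powers of 2 and 3, and equality for the two parities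
becomes one of the equations 2^a = 2^c, 3^a = 3^c, 3^a 2^c = 3^c 2^a and
3^a + 2^c = 3^c + 2^a. *)
Lemma deletion_poly_unbalanced typeC b0 a d c diag m :
    (diag ==> typeC && ~~ b0) ->
    deletion_poly typeC b0 false a d c (1 : rat) diag m =
    deletion_poly typeC b0 true a d c 1 diag m ->
  (~~ diag && typeC && b0) || (a == c).
Proof.
have inj3 k l : 3 ^+ k = 3 ^+ l :> rat -> k = l.
  by move/eqP; rewrite -!natrX eqr_nat eqn_exp2l // => /eqP.
have inj2 k l : 2 ^+ k = 2 ^+ l :> rat -> k = l.
  by move/eqP; rewrite -!natrX eqr_nat eqn_exp2l // => /eqP.
rewrite /deletion_poly => hd /addrI; move: hd.
rewrite /double_poly /coincide_poly /consecutive_poly.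
have -> : 1 + 1 = 2 :> rat by [].
have -> : 1 + 2 = 3 :> rat by [].
rewrite !expr1n; have n2 : (2 : rat) ^+ d != 0 by rewrite expf_neq0.
case: diag => /=.
  move=> /andP[_ _] e; apply/eqP/inj2; move: e; move: (_ ^+ a) (_ ^+ c) => u v; lra.
case: typeC; case: b0 => //= _; rewrite ?expr1n => e; apply/eqP.
- apply: inj3; apply: (mulIf n2); move: e.
  move: (3 ^+ a) (3 ^+ c) (2 ^+ d) => u v w; lra.
- apply: exp_ratio_inj; apply/eqP; rewrite -(eqr_nat rat) !natrM !natrX; apply/eqP.
  apply: (mulIf n2); move: e.
  move: (3 ^+ a) (3 ^+ c) (2 ^+ a) (2 ^+ c) (2 ^+ d) => u v u' v' w; lra.
apply: exp_diff_inj; apply/eqP; rewrite -(eqr_nat rat) !natrD !natrX; apply/eqP.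
apply: (mulIf n2); move: e.
move: (3 ^+ a) (3 ^+ c) (2 ^+ a) (2 ^+ c) (2 ^+ d) => u v u' v' w; lra.
Qed.

Section Deletion.
Variables (typeC : bool) (m : nat) (i0 j0 : 'I_m) (b0 : bool).
Hypothesis listed0 : listed typeC i0 j0 b0.
Let a : nat := i0.
Let d := (j0 - i0.+1)%N.
Let c := (m - j0.+1)%N.
Let shift : rat := (if typeC then 0 else 2) - (2 * m)%:R.

Definition balanced := (typeC && b0) || (j0 == rev_ord i0).

Lemma listed_diag : i0 = j0 -> typeC /\ ~~ b0.
Proof. by move=> e; move: listed0; rewrite /listed e ltnn eqxx => /andP[]. Qed.

Lemma listed_lt : i0 != j0 -> (i0 < j0)%N.
Proof. by move=> ne; move: listed0; rewrite /listed (negPf ne) andbF orbF. Qed.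

(** The bound on q leaves gaps in every word. *)
Lemma card_deletion q : (2 * m + 9 < q)%N ->
  (#|complement_mod (deletion typeC i0 j0 b0) q|)%:R =
  deletion_poly typeC b0 (odd q) a d c (q%:R + shift) (i0 == j0) m.
Proof.
move=> hq; have q_gt1 : (1 < q)%N by lia.
pose P := (q + (if typeC then 0 else 2) - 2 * m)%N.
have P_def : (q + (if typeC then 0 else 2) = 2 * m + P)%N.
  by rewrite /P; case: typeC; lia.
have P_big : (7 < P)%N by rewrite /P; case: typeC; lia.
have -> : q%:R + shift = P%:R.
  apply: (addIr (2 * m)%:R); rewrite /shift addrA subrK [RHS]addrC -!natrD -P_def natrD.
  by case: typeC.
have P1 : P.+1%:R = P%:R + 1 :> rat by rewrite -addn1 natrD.
have P2 : P.+2%:R = P%:R + 2 :> rat by rewrite -addn2 natrD.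
rewrite /deletion_poly -natrX.
have [e0|ne0] := eqVneq i0 j0.
  have [tC nb] := listed_diag e0.
  rewrite (card_deletion_double q_gt1 listed0 e0) natrD (count_all q_gt1 P_def P_big).
  congr (_ + _); rewrite (count_double q_gt1 P_def P_big i0 tC) /double_poly -P1 /a /c -e0.
  by case: (odd q); rewrite -?muln2 ?natrD !natrM !natrX ?mulr_natr.
have lt0 := listed_lt ne0.
rewrite (card_deletion_pair q_gt1 listed0 lt0) !natrD (count_all q_gt1 P_def P_big).
congr (_ + (_ + _)).
  have := count_coincide q_gt1 P_def P_big b0 lt0; rewrite -/a -/d -/c.
  move/(congr1 (fun n => n%:R : rat)); rewrite natrD => /(canRL (addrK _)) ->.
  rewrite /coincide_poly -P1 -P2; congr (_ - _).
    by case: typeC; case: b0; case: (odd q); rewrite !natrM !natrX.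
  by case: typeC; case: b0; case: (odd q); rewrite ?natrD ?natrM ?natrX.
have := count_consecutive q_gt1 P_def P_big b0 lt0; rewrite -/a -/d -/c.
move/(congr1 (fun n => n%:R : rat)); rewrite natrD => /(canRL (addrK _)) ->.
rewrite /consecutive_poly -P1 -P2; congr (_ - _).
  by case: typeC; case: b0; case: (odd q); rewrite !natrM !natrX.
by case: typeC; case: b0; case: (odd q); rewrite ?natrM ?natrX.
Qed.

Lemma balancedE : balanced = (~~ (i0 == j0) && typeC && b0) || (a == c).
Proof.
rewrite /balanced; congr (_ || _).
  by have [e0|_] //= := eqVneq i0 j0; have [-> /negPf->] := listed_diag e0.
by rewrite -val_eqE /a /c /=; have := ltn_ord i0; have := ltn_ord j0; lia.
Qed.

(** A polynomial that agrees with the count for all large q agrees with the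
polynomial of each parity. *)
Lemma deletion_is_poly :
  char_quasi_poly_is_poly (deletion typeC i0 j0 b0) <-> balanced.
Proof.
pose F o : {poly rat} := deletion_poly typeC b0 o a d c ('X + shift%:P) (i0 == j0) m.
have FE o x : (F o).[x] = deletion_poly typeC b0 o a d c (x + shift) (i0 == j0) m.
  rewrite -[LHS]/(horner_eval x (F o)) rmorph_deletion_poly.
  by rewrite /= /horner_eval hornerD hornerX hornerC.
rewrite balancedE; split=> [[f [N hf]]|bal].
  have fF o : f = F o.
    apply: (@poly_eq_parity _ _ o (N + 2 * m + 10)) => n hn on.
    by rewrite -hf ?card_deletion ?FE ?on //; lia.
  apply: (@deletion_poly_unbalanced typeC b0 a d c (i0 == j0) m).
    by apply/implyP => /eqP /listed_diag[-> ->].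
  have := congr1 (horner^~ (1 - shift)) (etrans (esym (fF false)) (fF true)).
  by rewrite /= !FE subrK.
exists (F true), (2 * m + 10)%N => q q_gt1 hq.
by rewrite FE card_deletion ?deletion_poly_balanced //; lia.
Qed.
End Deletion.

(** * Parallel pairs *)
Section Pairs.
Variable m : nat.
Implicit Types (i j : 'I_m) (b e : bool) (H K v : hyperplane m).

Lemma same_pairC H H' K K' : same_pair H H' K K' = same_pair H' H K K'.
Proof. by rewrite /same_pair orbC; congr (_ || _); rewrite andbC. Qed.

Lemma same_pair_levels (v w : 'rV[int]_m) :
  same_pair (v, 0) (v, 1) (w, 0) (w, 1) = (v == w).
Proof.
rewrite /same_pair /same_hyperplane.
have oppE (y : 'rV[int]_m) (n : int) : - (y, n) = (- y, - n) by [].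
rewrite !oppE !xpair_eqE oppr0 !eqxx !andbT.
have -> : ((0 : int) == 1) = false by [].
have -> : ((1 : int) == 0) = false by [].
have -> : ((1 : int) == - 1) = false by [].
by rewrite !andbF !orbF; case: (v == w) => //; rewrite andbF.
Qed.

Lemma parallel_pair (R : realType) typeC H H' :
    H \in shi m typeC -> H' \in shi m typeC -> ~~ same_hyperplane H H' ->
    parallel R H H' ->
  exists i j b, [/\ listed typeC i j b,
    [fset H; H']%fset = [fset (form i j b, 0%R); (form i j b, 1%R)]%fset &
    forall K K', same_pair H H' K K' = same_pair (form i j b, 0) (form i j b, 1) K K'].
Proof.
move=> /shiP[i [j [b [e [l1 ->]]]]] /shiP[i' [j' [b' [e' [l2 ->]]]]] ns par.
have [ei ej eb] := parallel_form l1 l2 par; subst i' j' b'.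
have -> : e' = ~~ e.
  move: ns; rewrite /same_hyperplane negb_or => /andP[ns _].
  by case: (e =P e') ns => [->|]; [rewrite eqxx | case: (e) (e') => [] []].
exists i, j, b; split; first exact: l1.
  by case: e {ns par}; [rewrite fsetUC | ].
by move=> K K'; case: e {ns par}; [rewrite same_pairC | ].
Qed.

Lemma listedW typeC i j b : listed typeC i j b -> listed true i j b.
Proof. by case/orP => [h|/and3P[_ h1 h2]]; rewrite /listed ?h // h1 h2 orbT. Qed.

Lemma form_rev typeC i j b k : listed typeC i j b ->
  form i j b = 'x_k + 'x_(rev_ord k) -> j = rev_ord i /\ ~~ b.
Proof.
move=> lij; have [kr|rk] := leqP k (rev_ord k).
  have lk : listed true k (rev_ord k) false.
    by move: kr; rewrite /listed leq_eqVlt andTb andbT orbC.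
  by case/(form_inj (listedW lij) lk) => -> -> ->.
have lk : listed true (rev_ord k) k false by rewrite /listed rk.
by rewrite addrC => /(form_inj (listedW lij) lk)[-> -> ->]; rewrite rev_ordK.
Qed.

(** If k exceeds its mirror image, the form on the right is minus a listed one;
[form_prop] asks for proportionality only, so it still applies. *)
Lemma form_rev_sub typeC i j b k : listed typeC i j b ->
  form i j b = 'x_k - 'x_(rev_ord k) -> j = rev_ord i.
Proof.
move=> lij; case: (ltngtP k (rev_ord k)) => [kr|rk|/val_inj kk].
- have lk : listed true k (rev_ord k) true by rewrite /listed kr.
  by case/(form_inj (listedW lij) lk) => -> -> _.
- have lk : listed true (rev_ord k) k true by rewrite /listed rk.
  rewrite -opprB => e.
  suff [-> -> _] : [/\ i = rev_ord k, j = k & b = true] by rewrite rev_ordK.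
  by apply: (form_prop (listedW lij) lk) => k1 l1; rewrite e !mxE; ring.
rewrite -kk subrr => /rowP/(_ i); rewrite formE mxE eqxx.
case/orP: lij => [ij|/and3P[_ /eqP<- /negPf->]]; last by rewrite eqxx.
have -> : (i == j) = false by rewrite -val_eqE /=; lia.
by rewrite mulr0 => /eqP.
Qed.
End Pairs.

Theorem corollary1p9 (R : realType) (m : nat) (m_gt0 : (0 < m)%N) :
  (forall H H' : hyperplane m,
     H \in shi_C m -> H' \in shi_C m ->
     ~~ same_hyperplane H H' -> parallel R H H' ->
     char_quasi_poly_is_poly (shi_C m `\` [fset H; H'])%fset <->
     [\/ odd m /\ (exists i : 'I_m, i.+1 = m.+1./2 /\
           same_pair H H' ('x_i *+ 2, 0) ('x_i *+ 2, 1)),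
         (exists i j : 'I_m, (i < j)%N /\
           same_pair H H' ('x_i - 'x_j, 0) ('x_i - 'x_j, 1))
       | (exists i : 'I_m,
           same_pair H H' ('x_i + 'x_(rev_ord i), 0)
                          ('x_i + 'x_(rev_ord i), 1))]) /\
  (forall H H' : hyperplane m,
     H \in shi_D m -> H' \in shi_D m ->
     ~~ same_hyperplane H H' -> parallel R H H' ->
     char_quasi_poly_is_poly (shi_D m `\` [fset H; H'])%fset <->
     (exists i : 'I_m,
        same_pair H H' ('x_i - 'x_(rev_ord i), 0)
                       ('x_i - 'x_(rev_ord i), 1)) \/
     (exists i : 'I_m,
        same_pair H H' ('x_i + 'x_(rev_ord i), 0)
                       ('x_i + 'x_(rev_ord i), 1))).
Proof.
split=> H H' HA HA' ns par.
  have [i0 [j0 [b0 [l0 -> sE]]]] := @parallel_pair m R true H H' HA HA' ns par.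
  rewrite -[(_ `\` _)%fset]/(deletion true i0 j0 b0) (deletion_is_poly l0) /balanced andTb.
  split=> [/orP[tb|/eqP jr]|[[om [i [mi]]]|[i [j [ij]]]|[i]]].
  - constructor 2; exists i0, j0; move: l0; rewrite tb /listed andbF orbF => ij.
    by split=> //; rewrite sE same_pair_levels /form tb.
  - case tb : b0 l0 sE => l0 sE.
      constructor 2; exists i0, j0; split; first by move: l0; rewrite /listed andbF orbF.
      by rewrite sE same_pair_levels.
    by constructor 3; exists i0; rewrite sE same_pair_levels /form jr.
  - rewrite sE same_pair_levels -form_double => /eqP.
    have li : listed true i i false by rewrite /listed eqxx orbT.
    case/(form_inj l0 li) => -> -> _; apply/orP; right; rewrite -val_eqE /=.
    by apply/eqP; have := odd_double_half m; rewrite om; move: mi; clear; lia.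
  - rewrite sE same_pair_levels -[_ - _]/(form i j true) => /eqP.
    have lij : listed true i j true by rewrite /listed ij.
    by case/(form_inj l0 lij) => _ _ ->.
  rewrite sE same_pair_levels => /eqP /(form_rev l0)[-> _].
  by rewrite eqxx orbT.
have [i0 [j0 [b0 [l0 -> sE]]]] := @parallel_pair m R false H H' HA HA' ns par.
rewrite -[(_ `\` _)%fset]/(deletion false i0 j0 b0) (deletion_is_poly l0) /balanced /=.
split=> [/eqP jr|[[i]|[i]]].
- case tb : b0 l0 sE => l0 sE; [left|right]; exists i0;
    by rewrite sE same_pair_levels /form jr.
- by rewrite sE same_pair_levels => /eqP /(form_rev_sub l0)->.
by rewrite sE same_pair_levels => /eqP /(form_rev l0)[-> _].
Qed.
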